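(* Let $n\ge 2$, let $K\subset\mathbb{R}^n$ be a convex body, and let $\gamma\subset\mathbb{R}^n$ be any curve such that $K\subset \operatorname{co}(\gamma)$. Then $$ N(K)=nW_{n-1}(K)\le \frac{\pi^{\frac{n-1}{2}}}{2\,\Gamma\!\left(\frac{n+1}{2}\right)}\cdot \operatorname{length}(\gamma)+\frac{\pi^{\frac{n}{2}-1}}{\Gamma\!\left(\frac{n}{2}\right)}\cdot \operatorname{diam}(K), $$ where $\Gamma$ is the gamma function (the inequality being trivial if $\operatorname{length}(\gamma)=\infty$).
   Context: $\mathbb{R}^n$ carries the standard Euclidean metric $d$. A convex body is any nonempty compact convex subset of $\mathbb{R}^n$ (empty interior allowed). $\operatorname{co}(A)$ denotes the convex hull of $A$, and $\operatorname{diam}(K)=\max\{d(x,y): x,y\in K\}$. A curve is the image of a continuous map $\varphi:[a,b]\to\mathbb{R}^n$; its length is $\operatorname{length}(\gamma)=\sup\sum_{i=1}^m d(\varphi(t_{i-1}),\varphi(t_i))$ over all partitions $a=t_0<t_1<\dots<t_m=b$ (possibly $+\infty$). The quermassintegrals $W_0(K),\dots,W_n(K)$ are defined by the Steiner formula: for $\varepsilon\ge 0$, the volume of the outer parallel body $K_\varepsilon=\{x\in\mathbb{R}^n: d(K,x)\le\varepsilon\}$ satisfies $\operatorname{vol}(K_\varepsilon)=\sum_{k=0}^n \binom{n}{k} W_k(K)\,\varepsilon^k$. The norm of $K$ is $N(K):=nW_{n-1}(K)$; equivalently $N(K)=\int_{S^{n-1}} h(K,u)\,du=\frac12\int_{S^{n-1}}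 w(K,u)\,du$, where $h(K,u)=\sup\{(x,u):x\in K\}$ is the support function, $w(K,u)=h(K,u)+h(K,-u)$ is the width function, and $du$ is the standard surface measure on the unit sphere $S^{n-1}$. (For $n=2$, $N(K)$ is the perimeter of $K$.) *)

(* Defs.v *)
From HB Require Import structures.
From mathcomp Require Import all_boot all_order all_algebra.
From mathcomp Require Import all_classical all_reals all_analysis.
Set Implicit Arguments. Unset Strict Implicit. Unset Printing Implicit Defensive.
Import Order.TTheory GRing.Theory Num.Theory.
Import numFieldNormedType.Exports.
Local Open Scope classical_set_scope.
Local Open Scope ring_scope.

Section Defs.
Variable R : realType.

Definition edist (n : nat) (x y : 'rV[R]_n) : R :=
  Num.sqrt (\sum_(i < n) (x ord0 i - y ord0 i) ^+ 2).

Definition convex_set (n : nat) (K : set 'rV[R]_n) : Prop :=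
  forall x y t, K x -> K y -> 0 <= t -> t <= 1 -> K ((1 - t) *: x + t *: y).

(* convex body: nonempty compact convex subset (empty interior allowed) *)
Definition convex_body (n : nat) (K : set 'rV[R]_n) : Prop :=
  K !=set0 /\ compact K /\ convex_set K.

Definition conv_hull (n : nat) (A : set 'rV[R]_n) : set 'rV[R]_n :=
  [set x | exists (m : nat) (w : 'I_m -> R) (p : 'I_m -> 'rV[R]_n),
     (forall i, 0 <= w i) /\ \sum_(i < m) w i = 1 /\ (forall i, A (p i)) /\
     x = \sum_(i < m) w i *: p i].

Definition diam (n : nat) (K : set 'rV[R]_n) : R :=
  sup [set edist x y | x in K & y in K].

Definition dist_set (n : nat) (K : set 'rV[R]_n) (x : 'rV[R]_n) : R :=
  inf [set edist y x | y in K].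
Definition parallel_body (n : nat) (K : set 'rV[R]_n) (eps : R) : set 'rV[R]_n :=
  [set x | dist_set K x <= eps].

(* n-dimensional Lebesgue volume as an iterated Lebesgue integral
   (by Tonelli this is the Lebesgue measure for Borel sets) *)
Fixpoint iter_int (k : nat) (f : seq R -> \bar R) : \bar R :=
  match k with
  | 0 => f [::]
  | k'.+1 => (\int[@lebesgue_measure R]_x iter_int k' (fun s => f (x :: s)))%E
  end.
Definition vol (n : nat) (A : set 'rV[R]_n) : \bar R :=
  iter_int n (fun s => (\1_A (\row_(i < n) nth 0 s i) : R)%:E).

(* W : 'I_n.+1 -> R are the quermassintegrals of K (Steiner formula) *)
Definition quermass (n : nat) (K : set 'rV[R]_n) (W : 'I_n.+1 -> R) : Prop :=
  forall eps : R, 0 <= eps ->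
    vol (parallel_body K eps) = (\sum_(k < n.+1) 'C(n, k)%:R * W k * eps ^+ k)%:E.

Definition curve_length (n : nat) (phi : R -> 'rV[R]_n) (a b : R) : \bar R :=
  ereal_sup [set l | exists (m : nat) (t : nat -> R),
     [/\ t 0%N = a, t m = b, (forall i, (i < m)%N -> t i < t i.+1) &
      l = (\sum_(i < m) edist (phi (t i)) (phi (t i.+1)))%:E]].

Definition Gamma (x : R) : R :=
  fine (\int[@lebesgue_measure R]_(t in [set t : R | (0 < t)%R])
          (powR t (x - 1) * expR (- t))%R%:E)%E.

End Defs.

(* Main.v *)
(** Let [g v = exp (- |v|^2 / 2)].  Integrating the Steiner polynomial of [K] against
    Gaussians of width [s] and comparing the coefficients of [1 / s] as [s -> oo] bounds
    [n W_{n-1}] by a multiple of the integral of [h_K g].  Up to [eps |v|], [h_K] is the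
    support function of a finite subset of [K], which lies in the hull of a polygon
    inscribed in the curve.  Hence it suffices to integrate over the space the function
    [F v = max_i <k_i, v> - 1/4 sum_j |<z_j - z_{j-1}, v>|].

    By the planar case, the integral of [F] over every great circle is at most the diameter
    [d].  Averages of [F] over finitely many rotations keep this property and their supremum
    on the sphere can be brought down to [d / 2 pi], so the integral of [F g] is at most
    [d / 2 pi] times that of [|v| g].

    In the plane one replaces the polygon by a shortest one with as few vertices as possible
    whose support function still dominates [h_K]; it has no crossing edges.  A rotating
    direction provides a vertex which is extreme opposite to two extreme vertices, one before
    and one after it.  Cutting there, the two pieces are separated by a direction [e], and a
    one-sided Crofton estimate for each piece bounds the perimeter of [K] by the length plus
    the width of [K] in direction [e]. *)
From HB Require Import structures.
From mathcomp Require Import all_boot all_order all_algebra.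
From mathcomp Require Import all_classical all_reals all_analysis.
From mathcomp Require Import measurable_realfun gauss_integral.
From mathcomp Require Import lra ring zify.
Require Import Defs.
Set Implicit Arguments. Unset Strict Implicit. Unset Printing Implicit Defensive.
Import Order.TTheory GRing.Theory Num.Theory.
Import numFieldNormedType.Exports.
Local Open Scope classical_set_scope.
Local Open Scope ring_scope.

(** * Maxima over nonempty lists, given by a head and a tail *)

Section finite_max.
Variables (R : realType) (T : Type).
Implicit Types (x : T) (s : seq T) (f g : T -> R).

(** Closing a polygon by its chord bounds the perimeter of its hull by length plus chord, but the
    curve may run far outside [K], so its chord is not controlled by the diameter. The planar
    argument is shaped by this: a part of the polygon that leaves the half plane containing [K] is
    charged by its length only, wherever it ends, and the end coordinates are replaced by the extent
    of [K]. The cut is needed because a one-sided estimate sees only a half circle of directions: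
    the vertices after the cut must dominate [K] on one half circle, those before it on the other.

    The factor 1/4 in [F] is Crofton's: over a great circle, [|<z, v>|] integrates to four times the
    length of the projection of [z] to the plane of the circle.

    Gaussian integrals take the place of integrals over the sphere: they factor over the
    coordinates, are invariant under rotations, and their radial moments supply both Gamma values.
    Finite families of rotations take the place of an invariant measure on the great circles; they
    suffice because only an upper bound for a supremum is wanted. *)

Definition maxs x0 s f : R := \big[Num.max/f x0]_(x <- s) f x.

Lemma maxs_nil x0 f : maxs x0 [::] f = f x0.
Proof. by rewrite /maxs big_nil. Qed.

Lemma maxs_head x0 x s f : maxs x0 (x :: s) f = Num.max (f x) (maxs x0 s f).
Proof. by rewrite /maxs big_cons. Qed.

Lemma maxs_cons x0 x s f : maxs x0 (x :: s) f = Num.max (f x0) (maxs x s f).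
Proof.
elim: s => [|y s ih]; first by rewrite maxs_head !maxs_nil maxC.
rewrite maxs_head in ih; rewrite !maxs_head [LHS]maxCA ih.
exact: maxCA.
Qed.

Lemma maxs_ge0 x0 s f : f x0 <= maxs x0 s f.
Proof. by elim: s => [|x s ih]; rewrite ?maxs_nil// maxs_head le_max ih orbT. Qed.

End finite_max.

Section finite_max_eq.
Variables (R : realType) (T : eqType).
Implicit Types (x : T) (s : seq T) (f g : T -> R).

Lemma maxs_ge x0 s f x : x \in x0 :: s -> f x <= maxs x0 s f.
Proof.
rewrite inE => /predU1P[->|]; first exact: maxs_ge0.
elim: s => // y s ih; rewrite inE maxs_head le_max => /predU1P[->|/ih ->].
  by rewrite lexx.
by rewrite orbT.
Qed.

Lemma maxs_ex x0 s f : exists2 x, x \in x0 :: s & maxs x0 s f = f x.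
Proof.
elim: s => [|y s [x xs e]]; first by exists x0; rewrite ?maxs_nil ?mem_head.
rewrite maxs_head; case: (leP (f y) (maxs x0 s f)) => _.
  by exists x; rewrite // !inE in xs *; case/predU1P: xs => ->; rewrite ?eqxx ?orbT.
by exists y; rewrite // !inE eqxx orbT.
Qed.

Lemma maxs_le x0 s f (m : R) : (forall x, x \in x0 :: s -> f x <= m) -> maxs x0 s f <= m.
Proof. by move=> h; have [x /h hx ->] := maxs_ex x0 s f. Qed.

Lemma maxs_mono x0 s y0 t f : {subset x0 :: s <= y0 :: t} ->
  maxs x0 s f <= maxs y0 t f.
Proof. by move=> st; apply: maxs_le => x /st; exact: maxs_ge. Qed.

Lemma maxs_continuous (X : topologicalType) x0 s (f : T -> X -> R) :
  (forall x, continuous (f x)) -> continuous (fun t => maxs x0 s (f ^~ t)).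
Proof.
move=> cf; elim: s => [|x s ih].
  by rewrite (_ : (fun t => _) = f x0)//; apply/funext => t; rewrite maxs_nil.
rewrite (_ : (fun t => _) = (f x \max (fun t => maxs x0 s (f ^~ t)))); last first.
  by apply/funext => t; rewrite maxs_head.
by move=> t; apply: continuous_max; [exact: cf|exact: ih].
Qed.

End finite_max_eq.

(** * Integrals of continuous functions over segments *)

Section interval_integral.
Variable R : realType.
Implicit Types (f g F : R -> R) (a b c : R).

Definition cint a b f : R := \int[lebesgue_measure]_(x in `[a, b]) f x.

Lemma continuous_integrable a b f : continuous f ->
  lebesgue_measure.-integrable `[a, b] (EFin \o f).
Proof.
move=> cf; apply: continuous_compact_integrable; first exact: segment_compact.
exact: continuous_subspaceT.
Qed.

Lemma cint_le a b f g : continuous f -> continuous g ->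
  (forall x, a <= x <= b -> f x <= g x) -> cint a b f <= cint a b g.
Proof.
move=> cf cg fg; apply: le_Rintegral => //; try exact: continuous_integrable.
Qed.

Lemma cintD a b f g : continuous f -> continuous g ->
  cint a b (fun x => f x + g x) = cint a b f + cint a b g.
Proof. by move=> cf cg; apply: RintegralD => //; exact: continuous_integrable. Qed.

Lemma cintZ a b f r : continuous f -> cint a b (fun x => r * f x) = r * cint a b f.
Proof. by move=> cf; apply: RintegralZl => //; exact: continuous_integrable. Qed.

Lemma eq_cint a b f g : (forall x, f x = g x) -> cint a b f = cint a b g.
Proof. by move=> fg; congr cint; apply/funext. Qed.

Lemma cint_split a b c f : continuous f -> a <= b -> b <= c ->
  cint a c f = cint a b f + cint b c f.
Proof.
move=> cf ab bc; have := @Rintegral_itvB R f (BLeft a) (BRight c) b.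
rewrite /cint -(@Rintegral_itv_obnd_cbnd _ b (BRight c)); last first.
  have := @continuous_integrable b c f cf.
  by apply: integrableS => //; exact: subset_itv_oc_cc.
by move=> <- //; rewrite ?bnd_simp//; [ring|exact: continuous_integrable].
Qed.

Lemma cint_FTC a b f F : continuous f -> a <= b ->
  (forall x, is_derive x (1 : R) F (f x)) -> cint a b f = F b - F a.
Proof.
move=> cf; rewrite le_eqVlt => /predU1P[<- _|ab dF].
  by rewrite /cint set_itv1 Rintegral_set1 subrr.
have cF : continuous F.
  move=> x; apply/differentiable_continuous/derivable1_diffP.
  by have := dF x => -[].
rewrite /cint /Rintegral (@continuous_FTC2 _ f F)//.
- exact: continuous_subspaceT.
- split; last 2 first.
  + by apply: cvg_at_right_filter; exact: cF.
  + by apply: cvg_at_left_filter; exact: cF.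
  + by move=> x _; have := dF x => -[].
- by move=> x _; have := dF x => -[_]; rewrite derive1E.
Qed.

Lemma cint_shift a b c f : continuous f -> a <= b ->
  cint (a + c) (b + c) f = cint a b (fun x => f (x + c)).
Proof.
move=> cf ab; pose G x := x + c.
have dG : derive1 G = cst 1.
  apply/funext => x; rewrite derive1E (_ : G = (id + cst c)%R)//.
  by rewrite deriveD// derive_id derive_cst addr0.
have cG : continuous G.
  by move=> x; apply: cvgD; [exact: cvg_id|exact: cvg_cst].
rewrite /cint /Rintegral -[a + c]/(G a) -[b + c]/(G b).
rewrite (@integration_by_substitution_increasing _ G)//.
- by congr fine; apply: eq_integral => x _; rewrite dG /= /cst /= fctE mulr1.
- by move=> x y _ _; rewrite /G ltrD2r.
- by rewrite dG => x _; exact: cvg_cst.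
- by rewrite dG; exact: is_cvg_cst.
- by rewrite dG; exact: is_cvg_cst.
- split.
  + by move=> x _; apply: derivableD => //.
  + by apply: cvg_at_right_filter; exact: cG.
  + by apply: cvg_at_left_filter; exact: cG.
- exact: continuous_subspaceT.
Qed.

Lemma cint_opp a b f : continuous f -> a <= b ->
  cint (- b) (- a) f = cint a b (fun x => f (- x)).
Proof.
move=> cf ab; rewrite /cint /Rintegral integration_by_substitution_oppr//.
exact: continuous_subspaceT.
Qed.

Lemma cint_periodic p a b f : continuous f -> 0 <= p -> (forall x, f (x + p) = f x) ->
  a <= b -> b <= a + p -> cint a (a + p) f = cint b (b + p) f.
Proof.
move=> cf p0 fp ab bap.
rewrite (cint_split cf ab bap) (@cint_split b (a + p) (b + p))// ?lerD2r//.
rewrite (cint_shift _ cf ab) addrC; congr (_ + _).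
by apply: eq_cint => x; rewrite fp.
Qed.

End interval_integral.

(** * Planar support functions and the Crofton estimate on a half circle *)

Section plane.
Variable R : realType.
Local Notation pt := (R * R)%type.
Implicit Types (p q v w : pt) (s : seq pt) (a b t x : R).

Definition pdot p t : R := p.1 * cos t + p.2 * sin t.
Definition pnorm p : R := Num.sqrt (p.1 ^+ 2 + p.2 ^+ 2).
Definition psub p q : pt := (p.1 - q.1, p.2 - q.2).
Definition pdist p q : R := pnorm (psub p q).

Fixpoint plen p s : R := if s is q :: s' then pdist p q + plen q s' else 0.

Lemma continuous_pdot p : continuous (pdot p).
Proof.
move=> t; apply: cvgD; apply: cvgM; try exact: cvg_cst.
  exact: continuous_cos.
exact: continuous_sin.
Qed.

Lemma continuous_hmax p s : continuous (fun t => maxs p s (pdot ^~ t)).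
Proof. by apply: maxs_continuous => q; exact: continuous_pdot. Qed.

Lemma pnorm_ge0 p : 0 <= pnorm p. Proof. exact: sqrtr_ge0. Qed.

Lemma pdist_ge0 p q : 0 <= pdist p q. Proof. exact: pnorm_ge0. Qed.

Lemma sqr_pnorm p : pnorm p ^+ 2 = p.1 ^+ 2 + p.2 ^+ 2.
Proof. by rewrite sqr_sqrtr// addr_ge0// sqr_ge0. Qed.

Lemma pdistC p q : pdist p q = pdist q p.
Proof. by rewrite /pdist /pnorm /=; congr Num.sqrt; ring. Qed.

Lemma pdot_bound p (c d : R) : c ^+ 2 + d ^+ 2 <= 1 -> p.1 * c + p.2 * d <= pnorm p.
Proof.
move=> cd; apply: (le_trans (ler_norm _)).
rewrite -(@ler_pXn2r _ 2)// ?nnegrE ?pnorm_ge0// real_normK ?num_real//.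
rewrite sqr_pnorm; have : 0 <= (p.1 * d - p.2 * c) ^+ 2 by exact: sqr_ge0.
have : 0 <= p.1 ^+ 2 + p.2 ^+ 2 by rewrite addr_ge0// sqr_ge0.
by nra.
Qed.

Lemma pdot_le_pnorm p t : pdot p t <= pnorm p.
Proof. by apply: pdot_bound; rewrite cos2Dsin2. Qed.

Lemma polar p : exists2 a, - pi <= a <= pi & p = (pnorm p * cos a, pnorm p * sin a).
Proof.
have [p0|p0] := eqVneq (pnorm p) 0.
  exists 0; first by rewrite oppr_le0 pi_ge0.
  move/eqP: (sqr_pnorm p); rewrite p0 expr0n/= eq_sym paddr_eq0 ?sqr_ge0//.
  by rewrite !sqrf_eq0 => /andP[/eqP p1 /eqP p2]; rewrite !mul0r; case: p p1 p2 {p0} => ? ? /= -> ->.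
have p_gt0 : 0 < pnorm p by rewrite lt_def p0 pnorm_ge0.
have n1 : (p.1 / pnorm p) ^+ 2 + (p.2 / pnorm p) ^+ 2 = 1.
  by rewrite !expr_div_n -mulrDl -sqr_pnorm divff// expf_neq0.
have c1 : -1 <= p.1 / pnorm p <= 1.
  by rewrite -ler_norml -(@ler_pXn2r _ 2)// ?nnegrE// expr1n real_normK ?num_real// -n1 lerDl sqr_ge0.
have [/andP[a0 a1] ca] := acos_def c1.
have sa : sin (acos (p.1 / pnorm p)) = `|p.2 / pnorm p|.
  by rewrite sin_acos// -sqrtr_sqr -n1 addrAC subrr add0r.
have [p2|p2] := leP 0 p.2.
  exists (acos (p.1 / pnorm p)); first by rewrite a1 (le_trans _ a0)// oppr_le0 pi_ge0.
  rewrite ca sa ger0_norm ?divr_ge0 ?pnorm_ge0// !(mulrC (pnorm p)) !divfK//.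
  by case: p {p0 p_gt0 n1 c1 a0 a1 ca sa p2}.
exists (- acos (p.1 / pnorm p)); first by rewrite lerN2 a1 (le_trans _ (pi_ge0 _))// oppr_le0.
rewrite cosN sinN ca sa ltr0_norm ?pmulr_llt0 ?invr_gt0//.
rewrite opprK !(mulrC (pnorm p)) !divfK//.
by case: p {p0 p_gt0 n1 c1 a0 a1 ca sa p2}.
Qed.

(** The sum is measured along its own direction, where each summand contributes at most its norm. *)
Lemma pnormD p q : pnorm (p.1 + q.1, p.2 + q.2) <= pnorm p + pnorm q.
Proof.
have [a _ e] := polar (p.1 + q.1, p.2 + q.2).
set r := (p.1 + q.1, _) in e *.
have -> : pnorm r = pdot p a + pdot q a.
  transitivity (pdot r a); last by rewrite /pdot/=; ring.
  rewrite {2}e /pdot/= -!mulrA -mulrDr -!expr2 cos2Dsin2 mulr1.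
  by [].
by rewrite lerD// pdot_le_pnorm.
Qed.

Lemma pdist_tri p q v : pdist p v <= pdist p q + pdist q v.
Proof.
rewrite /pdist; have := pnormD (psub p q) (psub q v).
by rewrite /psub/= !addrA !subrK.
Qed.

Lemma plen_ge0 p s : 0 <= plen p s.
Proof. by elim: s p => //= q s ih p; rewrite addr_ge0// pdist_ge0. Qed.

Lemma plen_cat p s1 s2 : plen p (s1 ++ s2) = plen p s1 + plen (last p s1) s2.
Proof. by elim: s1 p => [|q s ih] p /=; rewrite ?add0r// ih addrA. Qed.

Lemma is_derive_pdot (p : pt) x :
  is_derive x (1 : R) (fun t => p.1 * sin t - p.2 * cos t) (pdot p x).
Proof.
have -> : pdot p x = p.1 *: cos x - p.2 *: (- sin x).
  by rewrite /pdot scalerN opprK.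
exact: is_deriveB.
Qed.

Lemma cint_pdot p a b : a <= b ->
  cint a b (pdot p) = p.1 * (sin b - sin a) - p.2 * (cos b - cos a).
Proof.
move=> ab; rewrite (cint_FTC (@continuous_pdot p) ab (is_derive_pdot p)).
by ring.
Qed.

Lemma pihalf_ge0 : 0 <= pi / 2 :> R. Proof. by rewrite divr_ge0// pi_ge0. Qed.

Lemma pdot_abs_continuous p : continuous (fun t => `|pdot p t|).
Proof. by move=> t; apply: (@cvg_norm _ R); exact: continuous_pdot. Qed.

(** In polar form the integrand is [pnorm p * |cos (t - a)|]; since [|cos|] has period [pi], the
    shift by [a] does not change the integral over a half circle. *)
Lemma cint_abs_pdot p : cint (- (pi / 2)) (pi / 2) (fun t => `|pdot p t|) = 2 * pnorm p.
Proof.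
have [a /andP[a1 a2] e] := polar p.
pose f (t : R) : R := `|cos t|.
have cf : continuous f by move=> t; apply: (@cvg_norm _ R); exact: continuous_cos.
have pf (t : R) : f (t + pi) = f t by rewrite /f cosDpi normrN.
transitivity (pnorm p * cint (- (pi / 2)) (pi / 2) (fun t => f (t - a))).
  rewrite -cintZ; last first.
    by move=> t; apply: (continuous_comp (f := fun t => t - a) (g := f)); [apply: cvgB; [exact: cvg_id|exact: cvg_cst]|exact: cf].
  apply: eq_cint => t; rewrite /f -[in RHS](ger0_norm (pnorm_ge0 p)) -normrM.
  by congr (`|_|); rewrite {1}e /pdot/= cosB; ring.
rewrite -cint_shift//; last by have := pihalf_ge0; lra.
rewrite mulrC; congr (_ * _).
have h1 : cint (- (pi / 2)) (- (pi / 2) + pi) f = 2.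
  have -> : - (pi / 2) + pi = pi / 2 :> R by lra.
  have -> : cint (- (pi / 2)) (pi / 2) f = cint (- (pi / 2)) (pi / 2) (pdot (1, 0)).
    have fE t : - (pi / 2) <= t <= pi / 2 -> f t = pdot (1, 0) t.
      by move=> ht; rewrite /f /pdot/= mul1r mul0r addr0 ger0_norm// cos_ge0_pihalf.
    apply/eqP; rewrite eq_le !cint_le//; try exact: continuous_pdot.
      by move=> t /fE ->.
    by move=> t /fE ->.
  rewrite cint_pdot; last by have := pihalf_ge0; lra.
  by rewrite /= sinN sin_pihalf; lra.
have -> : pi / 2 + - a = - (pi / 2) + - a + pi by lra.
have [a0|a0] := leP a 0.
  by rewrite -(@cint_periodic _ pi (- (pi / 2)) _ f cf (pi_ge0 R) pf)//; lra.
by rewrite (@cint_periodic _ pi _ (- (pi / 2)) f cf (pi_ge0 R) pf)//; lra.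
Qed.

(** Putting [p] in front of [q] raises the support function by at most the positive part of
    [pdot (psub p q)], whose integral over the right half circle is [pdist p q + p.1 - q.1]. The
    coordinates telescope, and the last vertex alone gives twice its first coordinate. *)
Lemma crofton_half p s :
  cint (- (pi / 2)) (pi / 2) (fun t => maxs p s (pdot ^~ t)) <=
  plen p s + p.1 + (last p s).1.
Proof.
elim: s p => [|q s ih] p /=.
  rewrite (@eq_cint _ _ _ _ (pdot p)); last by move=> t; rewrite maxs_nil.
  rewrite cint_pdot ?sinN ?sin_pihalf ?cosN; last by have := pihalf_ge0; lra.
  by lra.
pose y := psub p q.
have cy : continuous (fun t => 2^-1 * (`|pdot y t| + pdot y t)).
  move=> t; apply: cvgM; first exact: cvg_cst.
  by apply: cvgD; [exact: pdot_abs_continuous|exact: continuous_pdot].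
apply: (@le_trans _ _ (cint (- (pi / 2)) (pi / 2)
    (fun t => maxs q s (pdot ^~ t) + 2^-1 * (`|pdot y t| + pdot y t)))).
  apply: cint_le; first exact: continuous_hmax.
    by move=> t; apply: cvgD; [exact: continuous_hmax|exact: cy].
  move=> t _; rewrite maxs_cons ge_max; apply/andP; split.
    have -> : pdot p t = pdot q t + pdot y t by rewrite /y /pdot/=; ring.
    by have := @maxs_ge0 _ _ q s (pdot ^~ t); have := ler_norm (pdot y t); lra.
  by have := ler_normr (pdot y t) (- pdot y t); have := ler_norm (- pdot y t); rewrite normrN; lra.
rewrite cintD//; last exact: continuous_hmax.
rewrite cintZ; last first.
  by move=> t; apply: cvgD; [exact: pdot_abs_continuous|exact: continuous_pdot].
rewrite cintD; [|exact: pdot_abs_continuous|exact: continuous_pdot].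
rewrite cint_abs_pdot cint_pdot ?sinN ?sin_pihalf ?cosN; last by have := pihalf_ge0; lra.
have := ih q; rewrite /pdist -/y.
have -> : y.1 = p.1 - q.1 by [].
by lra.
Qed.

End plane.

Arguments pdot {R} p t.

(** * The cost of a path beyond a line that bounds [K] *)

Section half.
Variable R : realType.
Local Notation pt := (R * R)%type.
Implicit Types (p q v w : pt) (s : seq pt) (a b t x : R).

Lemma cint_le_oo a b (f g : R -> R) : continuous f -> continuous g ->
  (forall x, a < x < b -> f x <= g x) -> cint a b f <= cint a b g.
Proof.
move=> cf cg fg; rewrite /cint.
have i1 (f' : R -> R) : continuous f' -> lebesgue_measure.-integrable `]a, b[ (EFin \o f').
  move=> cf'; have := @continuous_integrable R a b f' cf'.
  by apply: integrableS => //; exact: subset_itv_oo_cc.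
have i2 (f' : R -> R) : continuous f' -> lebesgue_measure.-integrable `[a, b[ (EFin \o f').
  move=> cf'; have := @continuous_integrable R a b f' cf'.
  by apply: integrableS => //; exact: subset_itv_co_cc.
rewrite -!(@Rintegral_itv_bndo_bndc _ (BLeft a) b); try exact: i2.
rewrite -!(@Rintegral_itv_obnd_cbnd _ a (BLeft b)); try exact: i1.
apply: le_Rintegral => //; try exact: i1.
Qed.

(** The angle [a] is the supremum of the set where [f <= g], or 0 if this set is empty; the guard
    [0 < a] covers the empty case. *)
Lemma last_ge b (f g : R -> R) : continuous f -> continuous g -> 0 <= b ->
  exists a, [/\ 0 <= a <= b, 0 < a -> f a <= g a &
    forall t, a < t <= b -> g t <= f t].
Proof.
move=> cf cg b0.
pose Z := [set t | 0 <= t <= b /\ f t <= g t].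
have [Z0|/set0P Zn0] := eqVneq Z set0.
  exists 0; split; rewrite ?lexx ?b0 ?ltxx// => t /andP[t0 tb].
  have : ~ Z t by rewrite Z0.
  by move=> /not_andP[]; [rewrite (ltW t0) tb|move/negP; rewrite -ltNge => /ltW].
have Zub : ubound Z b by move=> t [/andP[]].
have hZ : has_sup Z by split => //; exists b.
have sb : sup Z <= b by exact: ge_sup.
have s0 : 0 <= sup Z.
  case: Zn0 => z Zz; apply: (@le_trans _ _ z); first by case: Zz => /andP[].
  exact: sup_upper_bound.
exists (sup Z); split; first by rewrite s0 sb.
- move=> _; rewrite leNgt; apply/negP => gf.
  have cd : continuous (fun t => f t - g t).
    by move=> t; apply: cvgB; [exact: cf|exact: cg].
  have : \forall t \near sup Z, 0 < f t - g t.
    by apply: (cvgr_gt _ (cd (sup Z))); rewrite subr_gt0.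
  move=> /nbhs_ballP[e /= e0 he].
  have [z Zz zs] := @sup_adherent R Z e e0 hZ.
  have /he /= : ball (sup Z) e z.
    rewrite /ball/= ltr_norml; have := @sup_upper_bound R Z hZ z Zz.
    by move=> h; apply/andP; split; lra.
  by case: Zz => _; lra.
- move=> t /andP[st tb]; have : ~ Z t.
    by move=> /(sup_upper_bound hZ) ts; lra.
  by move=> /not_andP[]; [rewrite tb (le_trans s0 (ltW st))|move/negP; rewrite -ltNge => /ltW].
Qed.

(** Past the last angle [a] at which the list of [t] reaches that of [s], the latter dominates [K]
    alone. Below [a], the points of [K] lie in the wedge bounded by the vertical line at [x] and by
    the support line in direction [a] through a vertex [q] of the first list. Their support function
    is at most that of the corner of the wedge, while [w] bounds the support function of [s] from
    below. The resulting cost is rewritten as a linear form in [q - w], with [p = cos a]. The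
    quadratic constraint on [c] is what lets the costs of two quarter circles be combined in
    [tail_bound]. *)
Lemma side_bound (k0 s0 t0 w : pt) (k s t : seq pt) x : w \in s0 :: s -> w.1 = x ->
  (forall p, p \in k0 :: k -> p.1 <= x) ->
  (forall th : R, 0 <= th <= pi / 2 -> maxs k0 k (pdot ^~ th) <=
     Num.max (maxs s0 s (pdot ^~ th)) (maxs t0 t (pdot ^~ th))) ->
  exists (c p : R) (q : pt), [/\ q \in t0 :: t, 0 <= p <= 1, 2 * c ^+ 2 <= p * (1 - p) &
    cint 0 (pi / 2) (fun th => maxs k0 k (pdot ^~ th)) <=
    cint 0 (pi / 2) (fun th => maxs s0 s (pdot ^~ th)) +
    (psub q w).1 * c + (psub q w).2 * (1 - p)].
Proof.
move=> ws wx kx kst; pose hK th := maxs k0 k (pdot ^~ th); pose hS th := maxs s0 s (pdot ^~ th).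
rewrite -/hK -/hS.
pose hT th := maxs t0 t (pdot ^~ th).
have cK : continuous hK by exact: continuous_hmax.
have cS : continuous hS by exact: continuous_hmax.
have cT : continuous hT by exact: continuous_hmax.
have [a [/andP[a0 a1] aT aS]] := last_ge cS cT (pihalf_ge0 R).
have hi : cint a (pi / 2) hK <= cint a (pi / 2) hS.
  apply: cint_le_oo => // th /andP[h1 h2].
  have := kst th; rewrite (le_trans a0 (ltW h1)) (ltW h2) => /(_ isT) /le_trans; apply.
  by rewrite ge_max lexx/= aS// h1 ltW.
rewrite !(@cint_split _ 0 a (pi / 2))//.
have [a_0|an0] := eqVneq a 0.
  (* For [a = 0] there is no cost: with these values the linear form in [q - w] vanishes. *)
  exists 0, 1, t0; split; rewrite ?mem_head ?lexx ?ler01//; first by lra.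
  by move: hi; rewrite a_0 /cint set_itv1 !Rintegral_set1; lra.
have {an0}a_gt0 : 0 < a by rewrite lt_def an0.
have sa0 : 0 < sin a.
  by rewrite sin_gt0_pi// a_gt0 (le_lt_trans a1)//; have := pi_gt0 R; lra.
have ca0 : 0 <= cos a by rewrite cos_ge0_pihalf// a1 andbT; have := pihalf_ge0 R; lra.
have cs := cos2Dsin2 a.
have [q qt hq] := maxs_ex t0 t (pdot ^~ a).
(* The corner of the wedge is [(x, A)]: the point of the vertical line at [x] on the support line
   through [q]. *)
pose A := (pdot q a - x * cos a) / sin a.
have AE : pdot q a = x * cos a + A * sin a by rewrite /A divfK ?gt_eqF//; ring.
have p01 : 0 <= cos a <= 1 by rewrite ca0 cos_le1.
exists ((1 - cos a) / sin a * cos a), (cos a), q; split => //.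
  have -> : 2 * ((1 - cos a) / sin a * cos a) ^+ 2 =
      2 * ((1 - cos a) ^+ 2 * cos a ^+ 2) / sin a ^+ 2.
    by field; rewrite gt_eqF.
  rewrite ler_pdivrMr ?exprn_gt0//.
  have -> : sin a ^+ 2 = (1 - cos a) * (1 + cos a) by rewrite -subr_sqr expr1n -cs addrAC subrr add0r.
  have : 0 <= (1 - cos a) ^+ 2 * cos a * (1 - cos a).
    by case/andP: p01 => _ c1; rewrite !mulr_ge0 ?sqr_ge0// subr_ge0.
  by nra.
have lo : cint 0 a hK <= cint 0 a (pdot (x, A)).
  apply: cint_le => //; first exact: continuous_pdot.
  move=> th /andP[th0 tha]; apply: maxs_le => p pk.
  have dpa : pdot p a <= pdot q a.
    have := @maxs_ge _ _ k0 k (pdot ^~ a) p pk => /le_trans; apply.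
    have := kst a; rewrite a0 a1 => /(_ isT) /le_trans; apply.
    by rewrite ge_max -hq lexx andbT; exact: aT.
  have sth : 0 <= sin th by rewrite sin_ge0_pi// th0 (le_trans tha)//; have := pi_ge0 R; lra.
  have sat : 0 <= sin (a - th).
    by rewrite sin_ge0_pi// subr_ge0 tha; have := pi_ge0 R; lra.
  have px := kx p pk.
  rewrite -(ler_pM2r sa0).
  (* For [0 <= th <= a] the direction [th] is a nonnegative combination of the directions [a] and 0,
     with weights [sin th / sin a] and [sin (a - th) / sin a]. *)
  rewrite (_ : pdot p th * sin a = sin th * pdot p a + sin (a - th) * p.1); last first.
    by rewrite /pdot sinB; ring.
  rewrite (_ : pdot (x, A) th * sin a = sin th * pdot q a + sin (a - th) * x); last first.
    by rewrite AE /pdot/= sinB; ring.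
  by rewrite lerD// ler_wpM2l.
have low : cint 0 a (pdot w) <= cint 0 a hS.
  apply: cint_le => //; first exact: continuous_pdot.
  by move=> th _; exact: (@maxs_ge _ _ s0 s (pdot ^~ th)).
move: lo low hi; rewrite !cint_pdot// sin0 cos0 /= wx !subr0.
have E : (q.1 - x) * ((1 - cos a) / sin a * cos a) + (q.2 - w.2) * (1 - cos a) =
    (1 - cos a) * (A - w.2).
  move: AE; rewrite /pdot => AE.
  have -> : A = ((q.1 - x) * cos a + q.2 * sin a) / sin a.
    by rewrite /A /pdot; congr (_ / _); ring.
  by field; rewrite gt_eqF.
by rewrite -addrA E; lra.
Qed.

Lemma plen_ge_mem w s q : q \in s -> pdist w q <= plen w s.
Proof.
elim: s w => // p s ih w; rewrite inE /= => /predU1P[->|/ih h].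
  by rewrite lerDl plen_ge0.
by rewrite (le_trans (pdist_tri w p q))// lerD2l.
Qed.

Lemma plen_ge_mem2 w s p q : p \in s -> q \in s ->
  pdist w p + pdist p q <= plen w s \/ pdist w q + pdist q p <= plen w s.
Proof.
elim: s w => // r s ih w; rewrite !inE /=.
have [->|pr] := eqVneq p r; have [->|qr] := eqVneq q r => //=.
- move=> _ _; left; rewrite lerD2l (_ : pdist r r = 0) ?plen_ge0//.
  by rewrite /pdist /pnorm /= !subrr expr0n/= addr0 sqrtr0.
- by move=> _ qs; left; rewrite lerD2l plen_ge_mem.
- by move=> ps _; right; rewrite lerD2l plen_ge_mem.
- move=> ps qs; have [h|h] := ih r ps qs; [left|right].
  + by have := pdist_tri w r p; lra.
  + by have := pdist_tri w r q; lra.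
Qed.

Let refl p : pt := (p.1, - p.2).

Lemma maxs_map (T U : Type) (f : T -> U) (x0 : T) (s : seq T) (g : U -> R) :
  maxs (f x0) (map f s) g = maxs x0 s (g \o f).
Proof. by elim: s => [|y s ih]; rewrite ?maxs_nil//= !maxs_head ih. Qed.

Let maxs_refl p s th : maxs (refl p) (map refl s) (pdot ^~ th) = maxs p s (pdot ^~ (- th)).
Proof.
rewrite maxs_map; congr maxs; apply/funext => q; rewrite /pdot/= cosN sinN.
by rewrite !mulrN mulNr.
Qed.

(** Both quarter circles are treated by [side_bound], the lower one after a reflection in the first
    axis. The costs are linear forms in [q1 - w] and [q2 - w] with coefficient vectors
    [(c1, 1 - p1)] and [(c2, p2 - 1)]. On a path from [w] that meets [q1] before [q2], they add up
    to a form in [q1 - w] with the sum of the two vectors plus a form in [q2 - q1] with the second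
    one. All these vectors have norm at most 1, so the length of the path pays for both; the other
    order is symmetric. *)
Lemma tail_bound (k0 s0 t0 w : pt) (k s t : seq pt) x : w \in s0 :: s -> w.1 = x ->
  (forall p, p \in k0 :: k -> p.1 <= x) ->
  (forall th : R, - (pi / 2) <= th <= pi / 2 -> maxs k0 k (pdot ^~ th) <=
     Num.max (maxs s0 s (pdot ^~ th)) (maxs t0 t (pdot ^~ th))) ->
  cint (- (pi / 2)) (pi / 2) (fun th => maxs k0 k (pdot ^~ th)) <=
  cint (- (pi / 2)) (pi / 2) (fun th => maxs s0 s (pdot ^~ th)) + plen w (t0 :: t).
Proof.
move=> ws wx kx kst; have ph0 := pihalf_ge0 R.
have [c1 [p1 [q1 [q1t /andP[p10 p11] c1p h1]]]] : exists (c p : R) (q : pt), [/\ q \in t0 :: t, 0 <= p <= 1, 2 * c ^+ 2 <= p * (1 - p) &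
    cint 0 (pi / 2) (fun th => maxs k0 k (pdot ^~ th)) <=
    cint 0 (pi / 2) (fun th => maxs s0 s (pdot ^~ th)) +
    (psub q w).1 * c + (psub q w).2 * (1 - p)].
  apply: side_bound ws wx kx _ => th /andP[h1 h2]; apply: kst.
  by rewrite h2 andbT; lra.
have [c2 [p2 [q2 [q2t /andP[p20 p21] c2p h2]]]] : exists (c p : R) (q : pt), [/\ q \in t0 :: t, 0 <= p <= 1, 2 * c ^+ 2 <= p * (1 - p) &
    cint (- (pi / 2)) 0 (fun th => maxs k0 k (pdot ^~ th)) <=
    cint (- (pi / 2)) 0 (fun th => maxs s0 s (pdot ^~ th)) +
    (psub q w).1 * c - (psub q w).2 * (1 - p)].
  have [c [p [q [qt p01 cp h]]]] : exists (c p : R) (q : pt), [/\ q \in refl t0 :: map refl t, 0 <= p <= 1, 2 * c ^+ 2 <= p * (1 - p) &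
    cint 0 (pi / 2) (fun th => maxs (refl k0) (map refl k) (pdot ^~ th)) <=
    cint 0 (pi / 2) (fun th => maxs (refl s0) (map refl s) (pdot ^~ th)) +
    (psub q (refl w)).1 * c + (psub q (refl w)).2 * (1 - p)].
    apply: (@side_bound _ _ _ (refl w) _ _ _ x) => //.
    - by rewrite -[refl s0 :: _]/(map refl (s0 :: s)) map_f.
    - by move=> p; rewrite -[refl k0 :: _]/(map refl (k0 :: k)) => /mapP[p' /kx h ->].
    - move=> th /andP[h1' h2']; rewrite !maxs_refl; apply: kst.
      by rewrite lerN2 h2'/=; lra.
  move: qt; rewrite -[refl t0 :: _]/(map refl (t0 :: t)) => /mapP[q' q't qE].
  exists c, p, q'; split => //.
  rewrite -[X in cint _ X]oppr0 !cint_opp//; try exact: continuous_hmax.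
  move: h; rewrite (eq_cint _ _ (maxs_refl k0 k)) (eq_cint _ _ (maxs_refl s0 s)) qE /psub/=.
  by move=> h; rewrite (le_trans h)// -!addrA lerD2l lerD2l -mulNr opprB opprK (addrC (- _)).
rewrite !(@cint_split _ (- (pi / 2)) 0 (pi / 2)) ?oppr_le0//; try exact: continuous_hmax.
suff : (psub q1 w).1 * c1 + (psub q1 w).2 * (1 - p1) +
    ((psub q2 w).1 * c2 - (psub q2 w).2 * (1 - p2)) <= plen w (t0 :: t) by lra.
(* Since [(c1 + c2)^2 <= p1 (1 - p1) + p2 (1 - p2)], the left side is at most [p1 + p2 - 2 p1 p2],
   which does not exceed 1 on the unit square. *)
have n12 : (c1 + c2) ^+ 2 + (p2 - p1) ^+ 2 <= 1.
  by have := sqr_ge0 (c1 - c2); nra.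
have n1 : c1 ^+ 2 + (1 - p1) ^+ 2 <= 1 by nra.
have n2 : c2 ^+ 2 + (- (1 - p2)) ^+ 2 <= 1 by nra.
have [h|h] := plen_ge_mem2 w q1t q2t.
  apply: le_trans h; have e1 := @pdot_bound R (psub q1 w) _ _ n12.
  have e2 := @pdot_bound R (psub q2 q1) _ _ n2.
  by move: e1 e2; rewrite -/(pdist _ _) -/(pdist q2 q1) pdistC (pdistC q2) /psub/=; lra.
apply: le_trans h; have e1 := @pdot_bound R (psub q2 w) _ _ n12.
have e2 := @pdot_bound R (psub q1 q2) _ _ n1.
by move: e1 e2; rewrite -/(pdist _ _) -/(pdist q1 q2) pdistC (pdistC q1) /psub/=; lra.
Qed.

End half.

(** * One-sided and two-sided estimates for the perimeter of [K] *)

Section half_bound.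
Variable R : realType.
Local Notation pt := (R * R)%type.
Implicit Types (p q v w : pt) (s : seq pt) (a b t x : R).

Lemma pnormZ (c : R) p : pnorm (c * p.1, c * p.2) = `|c| * pnorm p.
Proof.
by rewrite /pnorm /= !exprMn -mulrDr sqrtrM ?sqr_ge0// sqrtr_sqr.
Qed.

Lemma pdist_between p q (c : R) : 0 <= c <= 1 ->
  let w := (p.1 + c * (q.1 - p.1), p.2 + c * (q.2 - p.2)) in
  pdist p w + pdist w q = pdist p q.
Proof.
move=> /andP[c0 c1] w; rewrite /pdist.
have -> : psub p w = (c * (psub p q).1, c * (psub p q).2).
  by rewrite /psub /w/=; congr (_, _); ring.
have -> : psub w q = ((1 - c) * (psub p q).1, (1 - c) * (psub p q).2).
  by rewrite /psub /w/=; congr (_, _); ring.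
by rewrite !pnormZ !ger0_norm ?subr_ge0//; ring.
Qed.

(** The prefix grows as long as the next vertex satisfies [y.1 <= x]. Where an edge leaves this half
    plane, its crossing point [w] ends a prefix to which [crofton_half] applies with last coordinate
    [x], and everything after [w] is left to [tail_bound]. *)
Lemma half_prefix (k0 : pt) (k : seq pt) x (r p : seq pt) (p0 : pt) :
  (forall q, q \in k0 :: k -> q.1 <= x) -> (last p0 p).1 <= x ->
  (forall th : R, - (pi / 2) <= th <= pi / 2 ->
    maxs k0 k (pdot ^~ th) <= maxs p0 (p ++ r) (pdot ^~ th)) ->
  cint (- (pi / 2)) (pi / 2) (fun th => maxs k0 k (pdot ^~ th)) <=
  plen p0 (p ++ r) + p0.1 + x.
Proof.
move=> kx; elim: r p => [|y r ih] p lx kp.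
  apply: (@le_trans _ _ (cint (- (pi / 2)) (pi / 2) (fun th => maxs p0 p (pdot ^~ th)))).
    apply: cint_le; try exact: continuous_hmax.
    by move=> th hth; have := kp th hth; rewrite cats0.
  by rewrite (le_trans (crofton_half _ _))// cats0 lerD2l.
have [yx|xy] := leP y.1 x.
  by rewrite -cat_rcons; apply: ih; rewrite ?last_rcons// cat_rcons.
set l := last p0 p in lx.
pose c := (x - l.1) / (y.1 - l.1).
have yl : 0 < y.1 - l.1 by lra.
have c01 : 0 <= c <= 1.
  by rewrite /c ler_pdivlMr// ler_pdivrMr// mul0r mul1r; apply/andP; split; lra.
pose w := (l.1 + c * (y.1 - l.1), l.2 + c * (y.2 - l.2)).
have wx : w.1 = x by rewrite /w /c /= divfK ?gt_eqF//; ring.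
have wE := pdist_between l y c01; rewrite -/w in wE.
have ws : w \in p0 :: rcons p w by rewrite inE mem_rcons mem_head orbT.
apply: le_trans; first apply: (@tail_bound R k0 p0 y w k (rcons p w) r x ws wx kx).
  move=> th hth; apply: (le_trans (kp th hth)); apply: maxs_le => q.
  rewrite inE mem_cat orbA => /orP[qp|qr]; rewrite le_max.
    apply/orP; left; apply: (@maxs_ge _ _ p0 (rcons p w) (pdot ^~ th)).
    by move: qp; rewrite !inE mem_rcons inE => /orP[->//|->]; rewrite !orbT.
  by rewrite (@maxs_ge _ _ y r (pdot ^~ th))// orbT.
have := crofton_half p0 (rcons p w).
rewrite last_rcons wx -cats1 !plen_cat -/l /= => h.
by rewrite -wE; lra.
Qed.

(** Compared with [crofton_half], the first coordinate of the end of the path is replaced by a bound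
    [x] for [K]: this is what turns a chord of the path into a width of [K]. A path starting beyond
    [x] is preceded by its horizontal projection [v] to the line, at the price of an edge of length
    [w0.1 - x]. *)
Lemma half_bound (k0 w0 : pt) (k w : seq pt) x :
  (forall q, q \in k0 :: k -> q.1 <= x) ->
  (forall th : R, - (pi / 2) <= th <= pi / 2 ->
    maxs k0 k (pdot ^~ th) <= maxs w0 w (pdot ^~ th)) ->
  cint (- (pi / 2)) (pi / 2) (fun th => maxs k0 k (pdot ^~ th)) <=
  plen w0 w + w0.1 + x.
Proof.
move=> kx kw; have [wx|xw] := leP w0.1 x.
  exact: (@half_prefix k0 k x w [::] w0).
pose v : pt := (x, w0.2).
have vs : v \in [:: v] by rewrite mem_head.
apply: le_trans; first apply: (@tail_bound R k0 v w0 v k [::] w x vs erefl kx).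
  by move=> th hth; rewrite le_max kw ?orbT.
have := crofton_half v [::]; rewrite /=.
have -> : pdist v w0 = w0.1 - x.
  rewrite /pdist /pnorm /= subrr expr0n/= addr0 sqrtr_sqr.
  by rewrite ltr0_norm ?opprB// subr_lt0.
by lra.
Qed.

Let neg p : pt := (- p.1, - p.2).

Lemma maxs_neg p s th : maxs (neg p) (map neg s) (pdot ^~ th) = maxs p s (pdot ^~ (th + pi)).
Proof.
rewrite maxs_map; congr maxs; apply/funext => q.
by rewrite /pdot/= cosDpi sinDpi !mulrN !mulNr.
Qed.

Lemma plen_neg p s : plen (neg p) (map neg s) = plen p s.
Proof.
elim: s p => //= q s ih p; rewrite ih; congr (_ + _).
by rewrite /pdist /pnorm/=; congr Num.sqrt; ring.
Qed.

(** The left half circle becomes the right one under the point reflection [neg]. The two estimates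
    contain [w0.1] with opposite signs, so that only the extent [xr - xl] of [K] remains. *)
Lemma two_sided_bound (k0 w0 : pt) (k wa wb : seq pt) (xl xr : R) :
  (forall q, q \in k0 :: k -> q.1 <= xr) -> (forall q, q \in k0 :: k -> xl <= q.1) ->
  (forall th : R, - (pi / 2) <= th <= pi / 2 ->
    maxs k0 k (pdot ^~ th) <= maxs w0 wb (pdot ^~ th)) ->
  (forall th : R, - (pi / 2) <= th <= pi / 2 ->
    maxs k0 k (pdot ^~ (th + pi)) <= maxs w0 wa (pdot ^~ (th + pi))) ->
  cint (- (pi / 2)) (- (pi / 2) + pi *+ 2) (fun th => maxs k0 k (pdot ^~ th)) <=
  plen w0 wa + plen w0 wb + (xr - xl).
Proof.
move=> kr kl hb ha; have ph0 := pihalf_ge0 R; have p0 := pi_ge0 R.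
rewrite (@cint_split _ _ (pi / 2)); [|exact: continuous_hmax|lra|lra].
have -> : - (pi / 2) + pi *+ 2 = pi / 2 + pi :> R by lra.
have e : pi / 2 = - (pi / 2) + pi :> R by lra.
have -> : cint (pi / 2) (pi / 2 + pi) (fun th => maxs k0 k (pdot ^~ th)) =
    cint (- (pi / 2)) (pi / 2) (fun th => maxs k0 k (pdot ^~ (th + pi))).
  by rewrite [X in cint X]e cint_shift//; [exact: continuous_hmax|lra].
have h1 := half_bound kr hb.
have : cint (- (pi / 2)) (pi / 2) (fun th => maxs k0 k (pdot^~ (th + pi))) <=
    plen w0 wa + (neg w0).1 - xl.
  have := @half_bound (neg k0) (neg w0) (map neg k) (map neg wa) (- xl).
  rewrite plen_neg (eq_cint _ _ (maxs_neg k0 k)); apply.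
  - move=> q; rewrite -[neg k0 :: _]/(map neg (k0 :: k)) => /mapP[q' /kl h ->].
    by rewrite /= lerN2.
  - by move=> th hth; rewrite !maxs_neg; exact: ha.
by rewrite /neg/=; lra.
Qed.

End half_bound.

(** * Shortest polygons and points in convex position *)

Section tours.
Variable R : realType.
Local Notation pt := (R * R)%type.
Implicit Types (p q v w a b c d : pt) (s : seq pt) (t x : R).

Definition slen s : R := if s is p :: s' then plen p s' else 0.

(** Convex position, certified for each point by a direction in which it strictly beats all
    others. *)
Definition exposed s := forall p, p \in s ->
  exists t : R, forall q, q \in s -> q != p -> pdot q t < pdot p t.

Lemma plen_rcons p s q : plen p (rcons s q) = plen p s + pdist (last p s) q.
Proof. by rewrite -cats1 plen_cat /= addr0. Qed.

Lemma slen_rev s : slen (rev s) = slen s.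
Proof.
elim: s => // p s ih; rewrite rev_cons; case: s ih => // q s; rewrite rev_cons /= => ih.
rewrite -ih; case: (rev s) => [|r u] /=; first by rewrite pdistC.
by rewrite !plen_rcons last_rcons addrC pdistC.
Qed.

Lemma slen_remove s1 p s2 : slen (s1 ++ s2) <= slen (s1 ++ p :: s2).
Proof.
case: s1 => [|r s1] /=; case: s2 => [|q s2] /=; rewrite ?cats0//.
- by rewrite lerDr pdist_ge0.
- by rewrite plen_cat /= lerDl addr0 pdist_ge0.
- by rewrite !plen_cat /= lerD2l addrA lerD2r pdist_tri.
Qed.

(** Reversing a block changes only the two edges at its ends. *)
Lemma slen_reverse_segment s1 a s2 d s3 : s2 != [::] ->
  slen (s1 ++ a :: s2 ++ d :: s3) = slen (s1 ++ a :: rev s2 ++ d :: s3) +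
    (pdist a (head a s2) + pdist (last a s2) d - pdist a (last a s2) - pdist (head a s2) d).
Proof.
case: s2 => // b s2 _.
have key u : slen (s1 ++ a :: u) = slen (rcons s1 a) + plen a u.
  case: s1 => [|r s1] /=; first by rewrite add0r.
  by rewrite plen_cat /= plen_rcons addrA.
rewrite !key.
have [c [u e]] : exists c u, rev (b :: s2) = c :: u.
  by rewrite rev_cons; case: (rev s2) => [|c u]; [exists b, [::]|exists c, (rcons u b)].
have lu : last c u = b.
  by rewrite -(last_cons a) -e rev_cons last_rcons.
have cE : c = last a (b :: s2).
  by have := congr1 rev e; rewrite revK rev_cons => ->; rewrite last_rcons.
have lE : plen b s2 = plen c u.
  by rewrite -[plen b s2]/(slen (b :: s2)) -slen_rev e.
rewrite e /= !plen_cat /= lE lu cE /=; ring.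
Qed.

Lemma min_tour (p0 : pt) (z : seq pt) : exists y0 y, [/\
  forall t : R, maxs p0 z (pdot ^~ t) <= maxs y0 y (pdot ^~ t),
  plen y0 y <= plen p0 z, uniq (y0 :: y), exposed (y0 :: y) &
  forall s, perm_eq s (y0 :: y) -> plen y0 y <= slen s].
Proof.
pose valid y0 y := (forall t : R, maxs p0 z (pdot ^~ t) <= maxs y0 y (pdot ^~ t)) /\
  plen y0 y <= plen p0 z.
pose P n := `[< exists y0 y, size y = n /\ valid y0 y >].
have exP : exists n, P n.
  by exists (size z); apply/asboolP; exists p0, z; split.
have [n /asboolP[y0 [y [sy [vy1 vy2]]]] nmin] := ex_minnP exP.
have [s] := @maxs_ex R (seq pt) (y0 :: y) (permutations (y0 :: y)) (fun s => - slen s).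
rewrite inE mem_permutations => sperm smax.
have {}sperm : perm_eq s (y0 :: y) by case/predU1P: sperm => [->|].
have smin u : perm_eq u (y0 :: y) -> slen s <= slen u.
  move=> uy; rewrite -lerN2 -smax.
  by apply: (@maxs_ge _ _ _ _ (fun s => - slen s)); rewrite inE mem_permutations uy orbT.
case: s sperm smax smin => [|w0 w] sperm _ smin.
  by move: (perm_size sperm).
have sw : size w = n by have := perm_size sperm; rewrite /= sy => -[].
have hw t : maxs y0 y (pdot ^~ t) = maxs w0 w (pdot ^~ t).
  by apply/eqP; rewrite eq_le !maxs_mono// => q; rewrite (perm_mem sperm).
have lw : plen w0 w <= plen p0 z by apply: le_trans vy2; exact: (smin (y0 :: y)).
have strict s1 p s2 : w0 :: w = s1 ++ p :: s2 -> s1 ++ s2 != [::] ->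
    exists t : R, forall q, q \in s1 ++ s2 -> pdot q t < pdot p t.
  move=> wE; case e : (s1 ++ s2) => [//|u0 u] _.
  have su : size u = n.-1.
    have := congr1 size wE; have := congr1 size e.
    by rewrite /= !size_cat /= sw => h; rewrite addnS h => -[->].
  have n0 : (0 < n)%N.
    have := congr1 size wE; have := congr1 size e.
    by rewrite /= !size_cat /= sw => h; rewrite addnS h => -[->].
  have lu : plen u0 u <= plen w0 w.
    have := slen_remove s1 p s2; rewrite -wE e; exact.
  have /existsNP[t /negP] : ~ (forall t : R, maxs p0 z (pdot ^~ t) <= maxs u0 u (pdot ^~ t)).
    move=> hu; have : P n.-1.
      by apply/asboolP; exists u0, u; split => //; split => //; exact: le_trans lw.
    by move/nmin; rewrite -ltnS prednK// ltnn.
  rewrite -ltNge => ht; exists t => q qu.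
  have {}qu : pdot q t <= maxs u0 u (pdot ^~ t).
    exact: (@maxs_ge _ _ u0 u (pdot ^~ t)).
  have := vy1 t; rewrite hw; have [r rw ->] := maxs_ex w0 w (pdot ^~ t).
  have [->|rp] := eqVneq r p; first by lra.
  have : pdot r t <= maxs u0 u (pdot ^~ t).
    apply: (@maxs_ge _ _ u0 u (pdot ^~ t)); rewrite -e.
    by move: rw; rewrite wE !mem_cat inE (negbTE rp).
  by lra.
have notin s1 p s2 : w0 :: w = s1 ++ p :: s2 -> p \notin s1 ++ s2.
  move=> wE; apply/negP => ps; have [|t ht] := strict _ _ _ wE.
    by case: (s1 ++ s2) ps.
  by have := ht _ ps; rewrite ltxx.
exists w0, w; split => //.
- by move=> t; rewrite -hw.
- have us s1 s2 : w0 :: w = s1 ++ s2 -> uniq s2.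
    elim: s2 s1 => // p s2 ih s1 wE; rewrite cons_uniq (ih (rcons s1 p)) ?cat_rcons// andbT.
    by have := notin _ _ _ wE; rewrite mem_cat negb_or => /andP[].
  exact: (us [::]).
- move=> p pw; have [s1 [s2 wE]] : exists s1 s2, w0 :: w = s1 ++ p :: s2.
    by case/splitPr: pw => s1 s2; exists s1, s2.
  have sub : forall q, q \in w0 :: w -> q != p -> q \in s1 ++ s2.
    by move=> q; rewrite wE !mem_cat inE => /or3P[->//|/eqP ->|->]; rewrite ?eqxx// orbT.
  have [e|ne] := eqVneq (s1 ++ s2) [::].
    by exists 0 => q qw qp; have := sub q qw qp; rewrite e.
  by have [t ht] := strict _ _ _ wE ne; exists t => q qw qp; apply: ht; exact: sub.
- by move=> u uw; apply: smin; rewrite (perm_trans uw).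
Qed.

(** Twice the signed area of the triangle [a b c]. *)
Definition orient a b c : R := (b.1 - a.1) * (c.2 - a.2) - (b.2 - a.2) * (c.1 - a.1).

(** The defect in the Cauchy-Schwarz inequality for [a - b] and [b - c] is the square of
    [orient a b c]. *)
Lemma plen_dist_strict a b c : orient a b c != 0 -> pdist a c < pdist a b + pdist b c.
Proof.
move=> o; have [u0 v0] := (pdist_ge0 a b, pdist_ge0 b c).
rewrite -(@ltr_pXn2r _ 2)// ?nnegrE ?addr_ge0 ?pdist_ge0//.
have ua := sqr_pnorm (psub a b); have vb := sqr_pnorm (psub b c).
have wc := sqr_pnorm (psub a c); rewrite -!/(pdist _ _) /= in ua vb wc.
rewrite sqrrD wc ua vb.
have h : ((a.1 - b.1) * (b.1 - c.1) + (a.2 - b.2) * (b.2 - c.2)) < pdist a b * pdist b c.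
  apply: (le_lt_trans (ler_norm _)).
  rewrite -(@ltr_pXn2r _ 2)// ?nnegrE ?mulr_ge0//.
  rewrite real_normK ?num_real// exprMn ua vb.
  have : 0 < orient a b c ^+ 2 by rewrite lt_def sqr_ge0 sqrf_eq0 o.
  by rewrite /orient; nra.
by move: h; rewrite -mulr_natl; nra.
Qed.

(** With [orient_sum], this is the affine dependence of four points of the plane; the signs of its
    coefficients tell which points are convex combinations of the others. *)
Lemma orient_bary a b c d t : orient b c d * pdot a t - orient a c d * pdot b t +
  orient a b d * pdot c t - orient a b c * pdot d t = 0.
Proof. by rewrite /orient /pdot; ring. Qed.

Lemma orient_sum a b c d : orient b c d - orient a c d + orient a b d - orient a b c = 0.
Proof. by rewrite /orient; ring. Qed.

Section quad.
Variable s : seq pt.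
Hypothesis exps : exposed s.

Lemma exposed_no_comb a b c d (x y z : R) : a \in s -> b \in s -> c \in s -> d \in s ->
  b != a -> c != a -> d != a -> 0 <= x -> 0 <= y -> 0 <= z -> 0 < x + y + z ->
  (forall t, (x + y + z) * pdot a t = x * pdot b t + y * pdot c t + z * pdot d t) -> False.
Proof.
move=> ha hb hc hd ba ca da x0 y0 z0 xyz0 e.
have [t ht] := exps ha; have := e t.
have {ba hb}hb := ht _ hb ba; have {ca hc}hc := ht _ hc ca; have {da hd}hd := ht _ hd da.
set A := pdot a t in hb hc hd *.
have h1 : x * (A - pdot b t) >= 0 by rewrite mulr_ge0// subr_ge0 ltW.
have h2 : y * (A - pdot c t) >= 0 by rewrite mulr_ge0// subr_ge0 ltW.
have h3 : z * (A - pdot d t) >= 0 by rewrite mulr_ge0// subr_ge0 ltW.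
move=> E.
have e1 : x * (A - pdot b t) = 0 by lra.
have e2 : y * (A - pdot c t) = 0 by lra.
have e3 : z * (A - pdot d t) = 0 by lra.
move: e1 e2 e3 => /eqP; rewrite mulf_eq0 subr_eq0 (gt_eqF hb) orbF => /eqP x_0.
move=> /eqP; rewrite mulf_eq0 subr_eq0 (gt_eqF hc) orbF => /eqP y_0.
move=> /eqP; rewrite mulf_eq0 subr_eq0 (gt_eqF hd) orbF => /eqP z_0.
by lra.
Qed.

(** If the first sign were wrong, the affine dependence would make [b] a convex combination of the
    other three points; if the second were wrong, it would make [a] one. *)
Lemma quad_pos a b c d : a \in s -> b \in s -> c \in s -> d \in s ->
  uniq [:: a; b; c; d] -> 0 < orient a b d -> orient a b c < 0 ->
  orient b c d < 0 /\ 0 < orient a c d.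
Proof.
move=> ha hb hc hd; rewrite /= !inE !negb_or -!andbA => /and5P[ab ac ad bc /and3P[bd cd _]].
move=> hC hD; have es := orient_sum a b c d; have eb := orient_bary a b c d.
split.
  rewrite ltNge; apply/negP => hA.
  apply: (@exposed_no_comb b a c d (orient b c d) (orient a b d) (- orient a b c)) => //.
  - by rewrite eq_sym.
  - by rewrite eq_sym.
  - exact: ltW.
  - by rewrite oppr_ge0 ltW.
  - by lra.
  - by move=> t; have := eb t; rewrite (_ : orient b c d + orient a b d - orient a b c = orient a c d); lra.
rewrite ltNge; apply/negP => hB.
apply: (@exposed_no_comb a b c d (- orient a c d) (orient a b d) (- orient a b c)) => //.
- by rewrite eq_sym.
- by rewrite eq_sym.
- by rewrite eq_sym.
- by rewrite oppr_ge0.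
- exact: ltW.
- by rewrite oppr_ge0 ltW.
- by lra.
- by move=> t; have := eb t; rewrite (_ : - orient a c d + orient a b d - orient a b c = - orient b c d); lra.
Qed.

Lemma orient_rot a b c : orient a b c = orient b c a.
Proof. by rewrite /orient; ring. Qed.

Lemma opposite_signs (x y : R) : x * y < 0 -> x < 0 < y \/ y < 0 < x.
Proof.
move=> xy; have [x0|x0|x0] := ltgtP x 0; last by rewrite x0 mul0r ltxx in xy.
  by left; rewrite -(nmulr_rlt0 _ x0) xy.
by right; rewrite -(pmulr_rlt0 _ x0) xy.
Qed.

Lemma opposite_frac (x y : R) : x < 0 < y \/ y < 0 < x -> 0 < x / (x - y) <= 1.
Proof.
move=> [/andP[x0 y0]|/andP[y0 x0]].
  rewrite -opprB invrN mulrN -mulNr ltr_pdivlMr ?ler_pdivrMr ?mul0r ?mul1r; try lra.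
by rewrite ltr_pdivlMr ?ler_pdivrMr ?mul0r ?mul1r; lra.
Qed.

(** Four exposed points are in convex position, so if the line [a b] separates [c] from [d], then
    [a b] and [c d] are the diagonals and separation is mutual. *)
Lemma quad_sign a b c d : a \in s -> b \in s -> c \in s -> d \in s ->
  uniq [:: a; b; c; d] -> orient a b c * orient a b d < 0 ->
  orient a c d < 0 < orient b c d \/ orient b c d < 0 < orient a c d.
Proof.
move=> ha hb hc hd u /opposite_signs[/andP[h1 h2]|/andP[h1 h2]].
  by right; have [-> ->] := quad_pos ha hb hc hd u h2 h1.
left; have [] := quad_pos ha hb hd hc _ h2 h1.
  by move: u; rewrite /= !inE !negb_or -!andbA => /and5P[-> -> -> -> /and3P[-> cd _]]; rewrite eq_sym cd.
have -> : orient b d c = - orient b c d by rewrite /orient; ring.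
have -> : orient a d c = - orient a c d by rewrite /orient; ring.
by rewrite oppr_lt0 oppr_gt0 => -> ->.
Qed.

(** The segments [a b] and [c d] meet in a point [x]. The triangle inequalities for [a c] and [b d]
    through [x] add up to the claim, and the first one is strict because [a], [x], [c] are not
    collinear. *)
Lemma quad_cross a b c d : a \in s -> b \in s -> c \in s -> d \in s ->
  uniq [:: a; b; c; d] -> orient a b c * orient a b d < 0 ->
  pdist a c + pdist b d < pdist a b + pdist c d.
Proof.
move=> ha hb hc hd u hCD; have hAB := quad_sign ha hb hc hd u hCD.
have es := orient_sum a b c d; have hDC := opposite_signs hCD.
set A := orient b c d in hAB es *; set B := orient a c d in hAB es *.
set C := orient a b d in hDC hCD es *; set D := orient a b c in hDC hCD es *.
(* Parameters of the crossing point along [a b] and along [c d]. *)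
pose l := B / (B - A); pose m := D / (D - C).
have /andP[l_gt0 l1] : 0 < l <= 1 by exact: opposite_frac.
have /andP[m_gt0 m1] : 0 < m <= 1 by exact: opposite_frac.
have l01 : 0 <= l <= 1 by rewrite ltW.
have m01 : 0 <= m <= 1 by rewrite ltW.
have := pdist_between a b l01; have := pdist_between c d m01 => /=.
set x := (a.1 + _, _).
have xE : (c.1 + m * (d.1 - c.1), c.2 + m * (d.2 - c.2)) = x.
  have CDE : D - C = - (B - A) by lra.
  have BAn0 : B - A != 0 by case: hAB => /andP[? ?]; [rewrite lt_eqF//|rewrite gt_eqF//]; lra.
  have k1 : (B - A) * (c.1 - a.1) = B * (b.1 - a.1) + D * (d.1 - c.1).
    by rewrite /A /B /D /orient; ring.
  have k2 : (B - A) * (c.2 - a.2) = B * (b.2 - a.2) + D * (d.2 - c.2).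
    by rewrite /A /B /D /orient; ring.
  have {}k1 : c.1 = a.1 + (B * (b.1 - a.1) + D * (d.1 - c.1)) / (B - A).
    by rewrite -k1 mulrAC mulfV// mul1r; ring.
  have {}k2 : c.2 = a.2 + (B * (b.2 - a.2) + D * (d.2 - c.2)) / (B - A).
    by rewrite -k2 mulrAC mulfV// mul1r; ring.
  rewrite /x /l /m CDE invrN; congr (_, _); first by rewrite {1}k1; ring.
  by rewrite {1}k2; ring.
rewrite xE => e1 e2.
have := pdist_tri b x d; have : pdist a c < pdist a x + pdist x c.
  apply: plen_dist_strict; rewrite (_ : orient a x c = l * D).
    apply: mulf_neq0; first exact: lt0r_neq0.
    by case: hDC => /andP[? ?]; [exact: ltr0_neq0|exact: lt0r_neq0].
  by rewrite /x /D /orient /=; ring.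
by rewrite (pdistC x c) (pdistC b x); lra.
Qed.

(** If the points were collinear, with [c] at the coordinate [l] on the line from [a] to [b], the
    middle one of the three would be a convex combination of the other two. *)
Lemma exposed_not_collinear a b c : a \in s -> b \in s -> c \in s ->
  uniq [:: a; b; c] -> orient a b c != 0.
Proof.
move=> ha hb hc; rewrite /= !inE !negb_or -!andbA => /and4P[ab ac bc _].
apply/eqP => o.
pose n := (b.1 - a.1) ^+ 2 + (b.2 - a.2) ^+ 2.
have n0 : 0 < n.
  rewrite lt_def /n addr_ge0 ?sqr_ge0// andbT paddr_eq0 ?sqr_ge0// !sqrf_eq0 !subr_eq0.
  apply: contraNN ab => /andP[/eqP e1 /eqP e2].
  by apply/eqP; case: (a) e1 e2 => ? ? /= <- <-; case: (b).
pose l := ((c.1 - a.1) * (b.1 - a.1) + (c.2 - a.2) * (b.2 - a.2)) / n.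
have nl : n * l = (c.1 - a.1) * (b.1 - a.1) + (c.2 - a.2) * (b.2 - a.2).
  by rewrite /l mulrC divfK// gt_eqF.
have cE t : pdot c t = (1 - l) * pdot a t + l * pdot b t.
  apply: (mulfI (lt0r_neq0 n0)).
  have -> : n * ((1 - l) * pdot a t + l * pdot b t) = n * pdot a t + (n * l) * (pdot b t - pdot a t).
    by ring.
  rewrite nl; apply/eqP; rewrite -subr_eq0; apply/eqP.
  have -> : n * pdot c t - (n * pdot a t + ((c.1 - a.1) * (b.1 - a.1) + (c.2 - a.2) * (b.2 - a.2)) *
      (pdot b t - pdot a t)) = orient a b c * ((b.1 - a.1) * sin t - (b.2 - a.2) * cos t).
    by rewrite /n /orient /pdot; ring.
  by rewrite o mul0r.
have [l0|l0] := leP l 0.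
  apply: (@exposed_no_comb a c b b 1 (- l) 0) => //; rewrite ?[_ == a]eq_sym ?oppr_ge0//; first by lra.
  by move=> t; have := cE t; lra.
have [l1|l1] := leP l 1.
  apply: (@exposed_no_comb c a b b (1 - l) l 0) => //; try lra.
  by move=> t; have := cE t; lra.
have cb : c != b by rewrite eq_sym.
apply: (@exposed_no_comb b c a a 1 (l - 1) 0) => //; try lra.
by move=> t; have := cE t; lra.
Qed.

End quad.

End tours.

(** * Absence of crossings in shortest tours; rotations and mirror images *)

Section planar.
Variable R : realType.
Local Notation pt := (R * R)%type.
Implicit Types (p q v w a b c d : pt) (s : seq pt) (t x : R).

Definition tour s :=
  [/\ uniq s, exposed s & forall u, perm_eq u s -> slen s <= slen u].

Lemma tour_perm s u : perm_eq u s -> slen u = slen s -> tour s -> tour u.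
Proof.
move=> us lus [us1 us2 us3]; split.
- by rewrite (perm_uniq us).
- move=> p; rewrite (perm_mem us) => /us2[t ht]; exists t => q.
  by rewrite (perm_mem us); exact: ht.
- by move=> v vu; rewrite lus us3// (perm_trans vu).
Qed.

Lemma tour_rev s : tour s -> tour (rev s).
Proof. by apply: tour_perm; [rewrite perm_rev|exact: slen_rev]. Qed.

Lemma slen_map (f : pt -> pt) s : (forall p q, pdist (f p) (f q) = pdist p q) ->
  slen (map f s) = slen s.
Proof.
move=> hf; case: s => //= p s; elim: s p => //= q s ih p.
by rewrite hf ih.
Qed.

Lemma tour_map (f g : pt -> pt) s : cancel f g -> cancel g f ->
  (forall p q, pdist (f p) (f q) = pdist p q) ->
  (forall t, exists t', forall p, pdot p t = pdot (f p) t') ->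
  tour s -> tour (map f s).
Proof.
move=> fK gK hf tf [s1 s2 s3]; have fI := can_inj fK; split.
- by rewrite (map_inj_uniq fI).
- move=> _ /mapP[p ps ->]; have [t ht] := s2 p ps; have [t' ht'] := tf t.
  exists t' => _ /mapP[q qs ->] qp; rewrite -!ht'; apply: ht => //.
  by apply: contraNN qp => /eqP ->.
- move=> u us; rewrite slen_map//.
  have hg p q : pdist (g p) (g q) = pdist p q by rewrite -[in RHS](gK p) -[in RHS](gK q) hf.
  rewrite -(slen_map u hg); apply: s3.
  by rewrite -(mapK fK s); exact: perm_map.
Qed.

Lemma sign_change (T : eqType) (f : T -> R) (s : seq T) (x y : T) :
  (forall z, z \in s -> f z != 0) -> x \in s -> y \in s -> 0 < f x -> f y < 0 ->
  exists (s1 : seq T) (a b : T) (s2 : seq T), s = s1 ++ a :: b :: s2 /\ f a * f b < 0.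
Proof.
elim: s x y => // z [|z' s] ih x y fn0 xs ys fx fy.
  move: xs ys; rewrite !inE => /eqP xz /eqP yz.
  by move: (lt_trans fy fx); rewrite xz yz ltxx.
have [h|h] := ltP (f z * f z') 0.
  by exists [::], z, z', s.
have fz0 : f z != 0 by rewrite fn0// mem_head.
have fz'0 : f z' != 0 by rewrite fn0// !inE eqxx orbT.
have {}h : 0 < f z * f z' by rewrite lt_def mulf_neq0.
have [x' [x's fx']] : exists x' : T, x' \in z' :: s /\ 0 < f x'.
  move: xs; rewrite inE => /predU1P[e|xs]; last by exists x.
  by exists z'; rewrite mem_head; move: h; rewrite -e pmulr_rgt0.
have [y' [y's fy']] : exists y' : T, y' \in z' :: s /\ f y' < 0.
  move: ys; rewrite inE => /predU1P[e|ys]; last by exists y.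
  by exists z'; rewrite mem_head; move: h; rewrite -e nmulr_rgt0.
have [|s1 [a [b [s2 [-> ab]]]]] := ih x' y' _ x's y's fx' fy'.
  by move=> w ws; rewrite fn0// inE ws orbT.
by exists (z :: s1), a, b, s2.
Qed.

(** Otherwise [p] lies beyond the line [B T2], with [T1] on its other side, so some edge [a b] of
    [P] crosses this line. By convex position the line [a b] then separates [B] from [T2], so some
    edge [c d] of [B :: Q] crosses it, and the two edges are crossing diagonals. Reversing the block
    from [b] to [c] would shorten the tour. *)
Lemma separation (P Q : seq pt) (B T1 T2 p : pt) (th : R) : tour (P ++ B :: Q) ->
  T1 \in P -> T2 \in Q -> T1.2 = T2.2 -> B.2 < T2.2 -> T1.1 < T2.1 ->
  (forall q, q \in P ++ B :: Q -> B.2 <= q.2 <= T2.2) ->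
  p \in P -> 0 <= cos th -> pdot p th <= maxs B Q (pdot ^~ th).
Proof.
move=> [us es ms] T1P T2Q e12 BT T12 strip pP cth; rewrite leNgt; apply/negP => hp.
set s := P ++ B :: Q in us es ms strip.
have sP q : q \in P -> q \in s by move=> h; rewrite mem_cat h.
have sQ q : q \in B :: Q -> q \in s by move=> h; rewrite mem_cat h orbT.
have dPQ q r : q \in P -> r \in B :: Q -> q != r.
  move=> qP rQ; apply/eqP => e; move: us; rewrite /s cat_uniq => /and3P[_ /hasPn h _].
  by have := h _ rQ; rewrite -e qP.
have BQ : B \in B :: Q by rewrite mem_head.
have TQ : T2 \in B :: Q by rewrite inE T2Q orbT.
have BT2 : B != T2 by apply/eqP => e; move: BT; rewrite e ltxx.
pose f := orient B T2.
have fn0 q : q \in P -> f q != 0.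
  move=> qP; apply: (exposed_not_collinear es (sQ _ BQ) (sQ _ TQ) (sP _ qP)).
  by rewrite /= !inE negb_or BT2 !(eq_sym _ q) !dPQ.
have fT1 : 0 < f T1.
  have -> : f T1 = (T2.2 - B.2) * (T2.1 - T1.1) by rewrite /f /orient e12; ring.
  by rewrite mulr_gt0// subr_gt0.
have fp : f p < 0.
  have /andP[pB pT] := strip p (sP _ pP).
  have h1 := @maxs_ge _ _ B Q (pdot ^~ th) B BQ.
  have h2 := @maxs_ge _ _ B Q (pdot ^~ th) T2 TQ.
  (* The gains of [p] over [B] and over [T2] in direction [th] are weighted by the heights of [p]
     below [T2] and above [B]; their vertical parts cancel. *)
  have : 0 < - cos th * f p.
    have -> : - cos th * f p = (T2.2 - p.2) * (pdot p th - pdot B th) +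
        (p.2 - B.2) * (pdot p th - pdot T2 th).
      by rewrite /f /orient /pdot; ring.
    have [e|ne] := eqVneq p.2 B.2.
      by rewrite e subrr mul0r addr0 mulr_gt0 ?subr_gt0//; exact: le_lt_trans hp.
    rewrite ltr_wpDl//; first by rewrite mulr_ge0 ?subr_ge0// ltW// (le_lt_trans h1).
    by rewrite mulr_gt0 ?subr_gt0 ?(le_lt_trans h2)// lt_def ne.
  have [->|cn0] := eqVneq (cos th) 0; first by rewrite oppr0 mul0r ltxx.
  by rewrite nmulr_rgt0// oppr_lt0 lt_def cn0.
have [P1 [a [b [P2 [PE fab]]]]] := sign_change fn0 T1P pP fT1 fp.
have aP : a \in P by rewrite PE mem_cat mem_head orbT.
have bP : b \in P by rewrite PE mem_cat !inE eqxx !orbT.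
have ab : a != b.
  apply/eqP => e; move: us; rewrite /s PE e -catA cat_uniq => /and3P[_ _].
  by rewrite /= inE eqxx.
pose g := orient a b.
have gBT : g B * g T2 < 0.
  have u4 : uniq [:: B; T2; a; b].
    by rewrite /= !inE !negb_or BT2 ab !(eq_sym _ a) !(eq_sym _ b) !dPQ.
  have /opposite_signs := fab.
  have := quad_sign es (sQ _ BQ) (sQ _ TQ) (sP _ aP) (sP _ bP) u4 fab.
  rewrite /g -!(orient_rot _ a b) => -[] /andP[h1 h2] _; last by rewrite pmulr_rlt0.
  by rewrite nmulr_rlt0.
have gn0 q : q \in B :: Q -> g q != 0.
  move=> qQ; apply: (exposed_not_collinear es (sP _ aP) (sP _ bP) (sQ _ qQ)).
  by rewrite /= !inE negb_or ab !dPQ.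
have [Q1 [c [d [Q2 [QE gcd]]]]] : exists s1 a b s2, B :: Q = s1 ++ a :: b :: s2 /\ g a * g b < 0.
  have [/andP[h1 h2]|/andP[h1 h2]] := opposite_signs gBT.
    exact: (sign_change gn0 TQ BQ h2 h1).
  exact: (sign_change gn0 BQ TQ h2 h1).
have cQ : c \in B :: Q by rewrite QE mem_cat mem_head orbT.
have dQ : d \in B :: Q by rewrite QE mem_cat !inE eqxx !orbT.
have cd : c != d.
  apply/eqP => e; move: us; rewrite /s QE e catA cat_uniq => /and3P[_ _].
  by rewrite /= inE eqxx.
have u4 : uniq [:: a; b; c; d] by rewrite /= !inE !negb_or ab cd !dPQ.
have := quad_cross es (sP _ aP) (sP _ bP) (sQ _ cQ) (sQ _ dQ) u4 gcd.
pose m := b :: P2 ++ Q1 ++ [:: c].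
have sE : s = P1 ++ a :: m ++ d :: Q2.
  by rewrite /s QE PE /m -!catA /= -!catA.
have := @slen_reverse_segment R P1 a m d Q2 isT; rewrite -sE.
have -> : last a m = c by rewrite /m /= !last_cat.
rewrite /=; have : slen s <= slen (P1 ++ a :: rev m ++ d :: Q2).
  apply: ms; rewrite sE perm_cat2l perm_cons perm_cat2r.
  by rewrite perm_rev.
by rewrite /m /=; lra.
Qed.

(** The rotation by [- a]: direction [t] for the image is direction [t + a] for the original. *)
Definition rot (a : R) p : pt := (pdot p a, pdot p (a + pi / 2)).

Lemma pdot_rot (a : R) p t : pdot (rot a p) t = pdot p (t + a).
Proof. by rewrite /rot /pdot /= cosDpihalf sinDpihalf cosD sinD; ring. Qed.

Lemma rotK (a : R) : cancel (rot a) (rot (- a)).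
Proof.
move=> p; rewrite /rot !pdot_rot addNr addrAC addNr add0r.
rewrite /pdot cos0 sin0 cos_pihalf sin_pihalf !mulr0 !mulr1 addr0 add0r.
by case: p.
Qed.

Lemma pdist_rot (a : R) p q : pdist (rot a p) (rot a q) = pdist p q.
Proof.
rewrite /pdist /pnorm /=; congr Num.sqrt.
rewrite /pdot cosDpihalf sinDpihalf -[RHS]mul1r -(cos2Dsin2 a); ring.
Qed.

Lemma tour_rot (a : R) s : tour s -> tour (map (rot a) s).
Proof.
apply: (@tour_map _ (rot (- a))) => [|p|p q|t]; first exact: rotK.
- by have := rotK (- a) p; rewrite opprK.
- exact: pdist_rot.
- by exists (t - a) => p; rewrite pdot_rot subrK.
Qed.

Definition mirror p : pt := (- p.1, p.2).

Lemma mirrorK : involutive mirror.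
Proof. by case=> x y; rewrite /mirror/= opprK. Qed.

Lemma pdot_mirror p t : pdot (mirror p) t = pdot p (pi - t).
Proof. by rewrite /pdot /= cosB sinB cospi sinpi; ring. Qed.

Lemma pdist_mirror p q : pdist (mirror p) (mirror q) = pdist p q.
Proof. by rewrite /pdist /pnorm /=; congr Num.sqrt; ring. Qed.

Lemma tour_mirror s : tour s -> tour (map mirror s).
Proof.
apply: (@tour_map _ mirror) => [||p q|t]; try exact: mirrorK.
- exact: pdist_mirror.
- by exists (pi - t) => p; rewrite pdot_mirror subKr.
Qed.

Lemma slen_split (P Q : seq pt) (B : pt) :
  slen (P ++ B :: Q) = plen B (rev P) + plen B Q.
Proof.
have -> : plen B (rev P) = slen (rcons P B) by rewrite -slen_rev rev_rcons.
case: P => [|r P] /=; first by rewrite add0r.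
by rewrite plen_cat /= plen_rcons addrA.
Qed.

(** The starting angle makes the circle split into the halves where the cosine is nonnegative and
    nonpositive. *)
Definition circ (f : R -> R) := cint (- (pi / 2)) (- (pi / 2) + pi *+ 2) f.

Lemma circ_shift (f : R -> R) (a : R) : continuous f -> (forall t, f (t + pi *+ 2) = f t) ->
  - (pi *+ 2) <= a <= pi *+ 2 -> circ (fun t => f (t + a)) = circ f.
Proof.
move=> cf pf /andP[a1 a2]; have p0 := pi_ge0 R.
have p2 : 0 <= pi *+ 2 :> R by rewrite mulrn_wge0.
rewrite /circ -cint_shift//; last by rewrite lerDl.
rewrite addrAC; have [a0|a0] := leP 0 a.
  by rewrite -(@cint_periodic _ _ (- (pi / 2)) _ f cf p2 pf)//; lra.
by rewrite (@cint_periodic _ _ _ (- (pi / 2)) f cf p2 pf)//; lra.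
Qed.

Lemma circ_mirror (f : R -> R) : continuous f -> circ (fun t => f (pi - t)) = circ f.
Proof.
move=> cf; have p0 := pi_ge0 R; rewrite /circ.
pose g t := f (t + pi); set b := - (pi / 2) + pi *+ 2.
have cg : continuous g.
  move=> t; apply: (continuous_comp (f := fun t => t + pi) (g := f)); last exact: cf.
  by apply: cvgD; [exact: cvg_id|exact: cvg_cst].
have ab : - (pi / 2) <= b by rewrite /b lerDl mulrn_wge0.
rewrite (@eq_cint _ _ _ _ (fun t => g (- t))); last by move=> t; rewrite /g addrC.
rewrite -cint_opp// opprK -cint_shift//; last by rewrite /b; lra.
by congr cint; rewrite /b; lra.
Qed.

Lemma pdot_periodic p t : pdot p (t + pi *+ 2) = pdot p t.
Proof. by rewrite /pdot cosD2pi sinD2pi. Qed.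

Lemma circ_rot (k0 : pt) (k : seq pt) (a : R) : - (pi *+ 2) <= a <= pi *+ 2 ->
  circ (fun t => maxs (rot a k0) (map (rot a) k) (pdot ^~ t)) =
  circ (fun t => maxs k0 k (pdot ^~ t)).
Proof.
move=> ha; rewrite -[RHS](circ_shift _ _ ha).
- congr circ; apply/funext => t; rewrite maxs_map; congr maxs; apply/funext => p /=.
  exact: pdot_rot.
- exact: continuous_hmax.
- by move=> t; congr maxs; apply/funext => p; exact: pdot_periodic.
Qed.

Lemma circ_map_mirror (k0 : pt) (k : seq pt) :
  circ (fun t => maxs (mirror k0) (map mirror k) (pdot ^~ t)) =
  circ (fun t => maxs k0 k (pdot ^~ t)).
Proof.
rewrite -[RHS]circ_mirror; last exact: continuous_hmax.
congr circ; apply/funext => t; rewrite maxs_map; congr maxs; apply/funext => p /=.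
exact: pdot_mirror.
Qed.

End planar.

(** * The planar inequality *)

Section planar_bound.
Variable R : realType.
Local Notation pt := (R * R)%type.
Implicit Types (p q v w : pt) (s : seq pt) (t x : R).

(** The largest difference [pdot (y i) t - pdot (y j) t] over [i <= j] is [MA t], over [j <= i] it
    is [MC t]. A half turn exchanges them, so they agree at some [c], where the full width is
    attained by a pair with the highest vertex before the lowest and by a pair with the lowest
    before the highest. If the lowest vertex of the first pair comes no later than the highest of
    the second, it lies between two highest ones; if not, the latter lies between two lowest ones,
    and a half turn exchanges high and low. *)
Lemma flip (s : seq pt) : s != [::] -> exists (t : R) (i m j : nat),
  [/\ 0 <= t <= pi *+ 2, (i <= m <= j)%N, (j < size s)%N &
  forall p, p \in s -> pdot (nth (0, 0) s m) t <= pdot p t /\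
    pdot p t <= pdot (nth (0, 0) s i) t /\ pdot p t <= pdot (nth (0, 0) s j) t].
Proof.
move=> sn0; pose n := size s; pose y k := nth (0, 0) s k.
have n0 : (0 < n)%N by rewrite lt0n size_eq0.
pose prs := allpairs (fun a b : nat => (a, b)) (iota 0 n) (iota 0 n).
pose A := seq.filter (fun ij : nat * nat => (ij.1 <= ij.2)%N) prs.
pose C := seq.filter (fun ij : nat * nat => (ij.2 <= ij.1)%N) prs.
have memA i j : ((i, j) \in (0, 0)%N :: A) = [&& (i <= j)%N, (i < n)%N & (j < n)%N].
  rewrite inE mem_filter /=.
  have -> : ((i, j) \in prs) = (i < n)%N && (j < n)%N.
    apply/allpairsP/andP => [[[i' j'] /= [h1 h2 [-> ->]]]|[h1 h2]].
      by move: h1 h2; rewrite !mem_iota !add0n.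
    by exists (i, j); rewrite /= !mem_iota !add0n.
  by rewrite xpair_eqE; case: i => [|i]//=; case: j => [|j]//=; rewrite n0.
have memC i j : ((i, j) \in (0, 0)%N :: C) = [&& (j <= i)%N, (i < n)%N & (j < n)%N].
  rewrite inE mem_filter /=.
  have -> : ((i, j) \in prs) = (i < n)%N && (j < n)%N.
    apply/allpairsP/andP => [[[i' j'] /= [h1 h2 [-> ->]]]|[h1 h2]].
      by move: h1 h2; rewrite !mem_iota !add0n.
    by exists (i, j); rewrite /= !mem_iota !add0n.
  by rewrite xpair_eqE; case: i => [|i]//=; case: j => [|j]//=; rewrite n0.
pose psi (ij : nat * nat) t := pdot (y ij.1) t - pdot (y ij.2) t.
pose MA t := maxs (0, 0)%N A (psi ^~ t); pose MC t := maxs (0, 0)%N C (psi ^~ t).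
have cpsi ij : continuous (psi ij).
  by move=> t; apply: cvgB; exact: continuous_pdot.
have cMA : continuous MA by apply: maxs_continuous.
have cMC : continuous MC by apply: maxs_continuous.
have psipi i j t : psi (i, j) (t + pi) = psi (j, i) t.
  by rewrite /psi /pdot /= cosDpi sinDpi; ring.
have MApi t : MA (t + pi) = MC t.
  apply/eqP; rewrite eq_le; apply/andP; split; apply: maxs_le => -[i j].
    rewrite memA psipi => h; apply: (@maxs_ge _ _ _ C (psi ^~ t)).
    by rewrite memC; case/and3P: h => -> -> ->.
  rewrite memC -psipi => h; apply: (@maxs_ge _ _ _ A (psi ^~ (t + pi))).
  by rewrite memA; case/and3P: h => -> -> ->.
have MCpi t : MC (t + pi) = MA t.
  apply/eqP; rewrite eq_le; apply/andP; split; apply: maxs_le => -[i j].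
    rewrite memC psipi => h; apply: (@maxs_ge _ _ _ A (psi ^~ t)).
    by rewrite memA; case/and3P: h => -> -> ->.
  rewrite memA -psipi => h; apply: (@maxs_ge _ _ _ C (psi ^~ (t + pi))).
  by rewrite memC; case/and3P: h => -> -> ->.
have [c] : exists2 c, c \in `[0, pi] & (fun t => MA t - MC t) c = 0.
  apply: IVT; first exact: pi_ge0.
    by apply: continuous_subspaceT => t; apply: cvgB; [exact: cMA|exact: cMC].
  have e : MA pi - MC pi = - (MA 0 - MC 0) by rewrite -[pi]add0r MApi MCpi opprB.
  rewrite e ge_min le_max oppr_le0 oppr_ge0 orbC.
  by case: (lerP 0 (MA 0 - MC 0)) => [_|/ltW ->]; rewrite ?orbT.
rewrite in_itv/= => /andP[c0 cpi] /eqP; rewrite subr_eq0 => /eqP MAC.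
have all_le i j : (i < n)%N -> (j < n)%N -> psi (i, j) c <= MA c.
  move=> h1 h2; have [ij|ji] := leqP i j.
    by apply: (@maxs_ge _ _ _ A (psi ^~ c)); rewrite memA ij h1 h2.
  by rewrite MAC; apply: (@maxs_ge _ _ _ C (psi ^~ c)); rewrite memC (ltnW ji) h1 h2.
have [[i m] /=] := maxs_ex (0, 0)%N A (psi ^~ c); rewrite memA -/(MA c) => /and3P[im hi hm] e1.
have [[i' m'] /=] := maxs_ex (0, 0)%N C (psi ^~ c); rewrite memC -/(MC c) -MAC => /and3P[mi' hi' hm'] e2.
have lo k p : (k < n)%N -> p \in s -> (exists2 l, (l < n)%N & psi (l, k) c = MA c) -> pdot (y k) c <= pdot p c.
  move=> hk ps [l hl e]; have := all_le l (index p s) hl; rewrite index_mem => /(_ ps).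
  by rewrite -e /psi /= /y nth_index// lerD2l lerN2.
have up k p : (k < n)%N -> p \in s -> (exists2 l, (l < n)%N & psi (k, l) c = MA c) -> pdot p c <= pdot (y k) c.
  move=> hk ps [l hl e]; have := all_le (index p s) l; rewrite index_mem => /(_ ps hl).
  by rewrite -e /psi /= /y nth_index// lerD2r.
have p0 := pi_ge0 R.
have [mi|im'] := leqP m i'.
  exists c, i, m, i'; rewrite im mi; split => //; first by rewrite c0; lra.
  move=> p ps; split; first by apply: lo => //; exists i.
  by split; apply: up => //; [exists m|exists m'].
exists (c + pi), m', i', m; rewrite mi' (ltnW im'); split => //; first by apply/andP; split; lra.
have e k p : p \in s -> pdot p (c + pi) = - pdot p c.
  by move=> _; rewrite /pdot cosDpi sinDpi; ring.
move=> p ps; rewrite /pdot !cosDpi !sinDpi !mulrN -!opprD !lerN2 -!/(pdot _ _).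
split; first by apply: up => //; exists m'.
by split; apply: lo => //; [exists i'|exists i].
Qed.

(** The extent of [K] along the first axis is attained by two of its points, hence is at most
    [d]. *)
Lemma planar_bound_frame (k0 : pt) (k P Q : seq pt) (B : pt) (d : R) :
  (forall p q, p \in k0 :: k -> q \in k0 :: k -> pdist p q <= d) ->
  (forall t : R, - (pi / 2) <= t <= pi / 2 ->
    maxs k0 k (pdot ^~ t) <= maxs B Q (pdot ^~ t)) ->
  (forall t : R, - (pi / 2) <= t <= pi / 2 ->
    maxs k0 k (pdot ^~ (t + pi)) <= maxs B (rev P) (pdot ^~ (t + pi))) ->
  circ (fun t => maxs k0 k (pdot ^~ t)) <= slen (P ++ B :: Q) + d.
Proof.
move=> kd hr hl.
have [p pk ep] := maxs_ex k0 k fst; have [q qk eq] := maxs_ex k0 k (fun p => - p.1).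
have h1 r : r \in k0 :: k -> r.1 <= p.1 by rewrite -ep; exact: maxs_ge.
have h2 r : r \in k0 :: k -> q.1 <= r.1.
  by move=> rk; rewrite -lerN2 -eq; exact: (@maxs_ge _ _ k0 k (fun p => - p.1)).
apply: (le_trans (two_sided_bound h1 h2 hr hl)); rewrite slen_split lerD2l.
apply: le_trans (kd p q pk qk); have := @pdot_bound R (psub p q) 1 0.
by rewrite /= mulr0 mulr1 addr0; apply; rewrite expr1n expr0n/= addr0.
Qed.

(** On the right half circle this is [separation]; on the left it is [separation] for the reversed
    and mirrored tour, in which [T1] and [T2] exchange their roles. *)
Lemma planar_tour (k0 : pt) (k P Q : seq pt) (B T1 T2 : pt) (d : R) : tour (P ++ B :: Q) ->
  T1 \in P -> T2 \in Q -> T1.2 = T2.2 -> B.2 < T2.2 -> T1.1 < T2.1 ->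
  (forall q, q \in P ++ B :: Q -> B.2 <= q.2 <= T2.2) ->
  (forall p q, p \in k0 :: k -> q \in k0 :: k -> pdist p q <= d) ->
  (forall t : R, forall p, p \in k0 :: k -> exists2 q, q \in P ++ B :: Q & pdot p t <= pdot q t) ->
  circ (fun t => maxs k0 k (pdot ^~ t)) <= slen (P ++ B :: Q) + d.
Proof.
move=> tr T1P T2Q e12 BT T12 strip kd hk.
apply: planar_bound_frame kd _ _ => t ht; apply: maxs_le => p pk.
  have [q qs /le_trans] := hk t p pk; apply.
  move: qs; rewrite mem_cat => /orP[qP|qQ]; last exact: (@maxs_ge _ _ B Q (pdot ^~ t)).
  by apply: (separation tr T1P T2Q) => //; exact: cos_ge0_pihalf.
have [q qs /le_trans] := hk (t + pi) p pk; apply.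
move: qs; rewrite mem_cat inE orbA orbC => /orP[qQ|qP]; last first.
  apply: (@maxs_ge _ _ B (rev P) (pdot ^~ (t + pi))).
  by rewrite inE mem_rev orbC.
have trm : tour (map (@mirror R) (rev Q) ++ mirror B :: map (@mirror R) (rev P)).
  rewrite -map_cons -map_cat; apply: tour_mirror.
  by have := tour_rev tr; rewrite rev_cat rev_cons cat_rcons.
have := @separation R _ _ _ (mirror T2) (mirror T1) (mirror q) (- t) trm.
rewrite maxs_map pdot_mirror opprK (_ : _ \o _ = pdot ^~ (pi + t)); last first.
  by apply/funext => r; rewrite /= pdot_mirror opprK.
rewrite addrC; apply => //=.
- by apply: map_f; rewrite mem_rev.
- by apply: map_f; rewrite mem_rev.
- by rewrite e12.
- by rewrite ltrN2.
- move=> r; rewrite -map_cons -map_cat => /mapP[r' r's ->] /=; rewrite e12; apply: strip.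
  by move: r's; rewrite !mem_cat !inE !mem_rev => /or3P[->|->|->]; rewrite ?orbT.
- by apply: map_f; rewrite mem_rev.
- by rewrite cosN; exact: cos_ge0_pihalf.
Qed.

Lemma mem_take_nth s (i m : nat) : (i < m)%N -> (m <= size s)%N -> nth (0, 0) s i \in take m s.
Proof.
move=> im ms; rewrite -(nth_take _ im); apply: mem_nth.
by rewrite size_take; case: ifP => // _; exact: leq_trans im ms.
Qed.

Lemma mem_drop_nth s (j m : nat) : (m < j)%N -> (j < size s)%N -> nth (0, 0) s j \in drop m.+1 s.
Proof.
move=> mj js; rewrite -(subnKC mj) -nth_drop; apply: mem_nth.
by rewrite size_drop ltn_sub2r// (leq_ltn_trans mj).
Qed.

Theorem planar_bound (k0 z0 : pt) (k z : seq pt) (d : R) :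
  (forall p q, p \in k0 :: k -> q \in k0 :: k -> pdist p q <= d) ->
  (forall t : R, maxs k0 k (pdot ^~ t) <= maxs z0 z (pdot ^~ t)) ->
  circ (fun t => maxs k0 k (pdot ^~ t)) <= plen z0 z + d.
Proof.
move=> kd kz; have p0 := pi_ge0 R.
have [y0 [y [zy yz uy ey my]]] := min_tour z0 z.
have {}kz t : maxs k0 k (pdot ^~ t) <= maxs y0 y (pdot ^~ t) by apply: le_trans (zy t).
apply: (@le_trans _ _ (plen y0 y + d)); last by rewrite lerD2r.
have ty : tour (y0 :: y) by split.
have kdr (a : R) p q : p \in rot a k0 :: map (rot a) k -> q \in rot a k0 :: map (rot a) k -> pdist p q <= d.
  rewrite -map_cons => /mapP[p' p'k ->] /mapP[q' q'k ->].
  by rewrite pdist_rot; exact: kd.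
(* One or two vertices are treated directly; the general argument needs a third one to exclude
   collinearity. *)
have [|s2] := leqP (size y) 1.
  case: y {my ey} uy zy yz kz ty => [|y1 [|//]] uy zy yz kz ty _.
    rewrite -[plen y0 [::]]/(slen ([::] ++ y0 :: [::])).
    by apply: planar_bound_frame kd _ _ => t _; exact: kz.
  (* The single edge is turned to the positive first axis, so that [y0] alone dominates on the left
     half circle. *)
  have [a /andP[a1 a2] ya] := polar (psub y1 y0).
  rewrite -(@circ_rot _ _ _ a); last by apply/andP; split; lra.
  have -> : plen y0 [:: y1] = slen ([::] ++ rot a y0 :: [:: rot a y1]).
    by rewrite /= pdist_rot.
  have kr t : maxs (rot a k0) (map (rot a) k) (pdot ^~ t) <= maxs y0 [:: y1] (pdot ^~ (t + a)).
    rewrite maxs_map (_ : _ \o _ = pdot ^~ (t + a)) ?kz//.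
    by apply/funext => r; rewrite /= pdot_rot.
  apply: planar_bound_frame (@kdr a) _ _ => t ht.
    apply: (le_trans (kr t)); rewrite !maxs_cons !maxs_nil !pdot_rot//.
  apply: (le_trans (kr _)); rewrite maxs_cons !maxs_nil pdot_rot ge_max lexx/=.
  have -> : pdot y1 (t + pi + a) = pdot y0 (t + pi + a) + pdot (psub y1 y0) (t + pi + a).
    by rewrite /pdot /=; ring.
  rewrite gerDl ya /pdot /= -!mulrA -mulrDr mulr_ge0_le0 ?pnorm_ge0//.
  have -> : cos a * cos (t + pi + a) + sin a * sin (t + pi + a) = - cos t.
    by rewrite -cosB opprD addrCA addrC subrr add0r; rewrite -cosN opprK addrC addrC cosDpi.
  by rewrite oppr_le0; exact: cos_ge0_pihalf.
have [//|t [i [m [j [/andP[t0 t2] /andP[im mj] js hs]]]]] := @flip (y0 :: y).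
(* This rotation makes the direction found by [flip] vertical. *)
pose a := t - pi / 2.
rewrite -(@circ_rot _ _ _ a); last by apply/andP; split; rewrite /a; lra.
pose s := map (rot a) (y0 :: y).
have ss : size s = size (y0 :: y) by rewrite size_map.
have ts : tour s by exact: tour_rot.
have lenE : plen y0 y = slen s.
  rewrite -[plen y0 y]/(slen (y0 :: y)) /s slen_map//; exact: pdist_rot.
have nthE l : (l < size s)%N -> nth (0, 0) s l = rot a (nth (0, 0) (y0 :: y) l).
  by move=> ls; rewrite (nth_map (0, 0))// -ss.
have rot2 p : (rot a p).2 = pdot p t by rewrite /rot /= /a subrK.
have {}hs p : p \in s -> (nth (0, 0) s m).2 <= p.2 /\ p.2 <= (nth (0, 0) s i).2 /\ p.2 <= (nth (0, 0) s j).2.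
  move=> /mapP[p' p's ->]; rewrite !nthE ?ss//; [|lia|lia].
  by rewrite !rot2; exact: hs.
have hks u p : p \in rot a k0 :: map (rot a) k -> exists2 q, q \in s & pdot p u <= pdot q u.
  rewrite -map_cons => /mapP[p' p'k ->]; rewrite pdot_rot.
  have [q qy e] := maxs_ex y0 y (pdot ^~ (u + a)).
  exists (rot a q); first exact: map_f.
  rewrite pdot_rot -e; apply: le_trans (kz _); exact: (@maxs_ge _ _ k0 k (pdot ^~ (u + a))).
have mem_s l : (l < size s)%N -> nth (0, 0) s l \in s by move=> h; exact: mem_nth.
clearbody s.
have [si sm sj] : [/\ (i < size s)%N, (m < size s)%N & (j < size s)%N] by split; rewrite ss; lia.
set B := nth (0, 0) s m in hs.
set T1 := nth (0, 0) s i in hs; set T2 := nth (0, 0) s j in hs.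
have [us es ms] := ts.
have T12 : T1.2 = T2.2.
  have [_ [_ h1]] := hs T1 (mem_s i si); have [_ [h2 _]] := hs T2 (mem_s j sj).
  by apply/eqP; rewrite eq_le h1 h2.
(* Equal heights would make all vertices collinear, against convex position of at least three
   points. *)
have BT : B.2 < T2.2.
  have [_ [_ h]] := hs B (mem_s m sm); rewrite lt_def {}h andbT.
  apply/eqP => e.
  have flat p : p \in s -> p.2 = B.2.
    by move=> ps; have [h1 [_ h2]] := hs p ps; apply/eqP; rewrite eq_le h1 -e h2.
  have := @exposed_not_collinear R s es (nth (0, 0) s 0) (nth (0, 0) s 1) (nth (0, 0) s 2).
  have [h0 h1 h2] : [/\ (0 < size s)%N, (1 < size s)%N & (2 < size s)%N] by split; rewrite ss /=; lia.
  rewrite !mem_s// => /(_ isT isT isT); rewrite /= !inE !negb_or !nth_uniq//= => /(_ isT).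
  by rewrite /orient !flat ?mem_s// !subrr mulr0 mul0r subrr eqxx.
have im' : (i < m)%N.
  rewrite ltn_neqAle im andbT; apply/eqP => e; move: BT; rewrite -T12 /T1 e ltxx //.
have mj' : (m < j)%N.
  rewrite ltn_neqAle mj andbT; apply/eqP => e; move: BT; rewrite /T2 -e ltxx //.
have sE : s = take m s ++ B :: drop m.+1 s.
  by rewrite -drop_nth ?cat_take_drop// ss; lia.
have T1P : T1 \in take m s by apply: mem_take_nth => //; rewrite ss; lia.
have T2Q : T2 \in drop m.+1 s by apply: mem_drop_nth => //; rewrite ss.
have strip q : q \in take m s ++ B :: drop m.+1 s -> B.2 <= q.2 <= T2.2.
  by rewrite -sE => /hs[-> [_ ->]].
have T12n : T1.1 != T2.1.
  apply/eqP => e; have : T1 = T2 by case: (T1) (T2) e T12 => ? ? [? ?] /= -> ->.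
  by move/eqP; rewrite /T1 /T2 nth_uniq ?ss//; lia.
rewrite lenE sE.
have [lt12|] := ltP T1.1 T2.1.
  apply: (@planar_tour _ _ _ _ B T1 T2 d) => //; first by rewrite -sE.
    exact: kdr.
  by move=> u p /(hks u); rewrite -sE.
rewrite le_eqVlt eq_sym (negbTE T12n)/= => lt21.
rewrite -circ_map_mirror.
have -> : slen (take m s ++ B :: drop m.+1 s) =
    slen (map (@mirror R) (take m s) ++ mirror B :: map (@mirror R) (drop m.+1 s)).
  by rewrite -map_cons -map_cat slen_map//; exact: pdist_mirror.
apply: (@planar_tour _ _ _ _ (mirror B) (mirror T1) (mirror T2) d) => //=.
- by rewrite -map_cons -map_cat -sE; exact: tour_mirror.
- exact: map_f.
- exact: map_f.
- by rewrite ltrN2.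
- by move=> q; rewrite -map_cons -map_cat => /mapP[q' /strip h ->].
- move=> p q; rewrite -map_cons => /mapP[p' p'k ->] /mapP[q' q'k ->].
  by rewrite pdist_mirror; exact: kdr p'k q'k.
- move=> u p; rewrite -map_cons => /mapP[p' p'k ->]; rewrite pdot_mirror.
  have [q qs h] := hks (pi - u) p' p'k; exists (mirror q); last by rewrite pdot_mirror.
  by rewrite -map_cons -map_cat -sE; exact: map_f.
Qed.

End planar_bound.

(** * Lebesgue measure on tuples *)

Section tuple_measure.
Variable R : realType.
Local Notation RR := (measurableTypeR R).
Local Open Scope ereal_scope.

Definition cons_tuple n (xt : RR * n.-tuple RR) : n.+1.-tuple RR :=
  [the n.+1.-tuple RR of xt.1 :: xt.2].

Lemma measurable_cons_tuple n : measurable_fun setT (@cons_tuple n).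
Proof. by apply: measurable_cons; [exact: measurable_fst|exact: measurable_snd]. Qed.

Definition tuple_box n (k : nat) : set (n.-tuple RR) :=
  [set t | forall i, (`|tnth t i| <= k%:R)%R].
Arguments tuple_box : clear implicits.

Lemma measurable_tuple_box n k : measurable (tuple_box n k).
Proof.
have -> : tuple_box n k = \bigcap_(i in [set: 'I_n]) ((@tnth n RR ^~ i) @^-1` `[- k%:R, k%:R]%classic)%R.
  apply/seteqP; split => [t h i _|t h i] /=; first by rewrite in_itv/= -ler_norml; exact: h.
  by have := h i I; rewrite /= in_itv/= -ler_norml.
apply: fin_bigcap_measurable => // i _; rewrite -[X in measurable X]setTI.
by apply: measurable_tnth.
Qed.

(* Boxes having finite measure is what makes the next product measure sigma-finite. *)
Record bounded_measure n := BoundedMeasure {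
  bmeas :> {measure set (n.-tuple RR) -> \bar R};
  bmeas_box : forall k, bmeas (tuple_box n k) < +oo }.

Definition bmfun n (m : bounded_measure n) : set (n.-tuple RR) -> \bar R := bmeas m.

HB.instance Definition _ n (m : bounded_measure n) := Measure.copy (bmfun m) (bmeas m).

Lemma bmeas_sigma_finite n (m : bounded_measure n) : sigma_finite setT (bmfun m).
Proof.
exists (tuple_box n); last by move=> k; split; [exact: measurable_tuple_box|exact: bmeas_box].
apply/esym/seteqP; split => // t _.
exists (Num.truncn (\sum_(i < n) `|tnth t i|)%R).+1 => // i.
apply: ltW; apply: le_lt_trans (truncnS_gt _).
by rewrite (bigD1 i)//= lerDl sumr_ge0.
Qed.

HB.instance Definition _ n (m : bounded_measure n) :=
  Measure_isSigmaFinite.Build _ _ _ (bmfun m) (bmeas_sigma_finite m).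

Definition dirac0 : {measure set (0.-tuple RR) -> \bar R} :=
  dirac ([tuple] : 0.-tuple RR).

Lemma dirac0_box k : dirac0 (tuple_box 0 k) < +oo.
Proof. by rewrite /dirac0 /= /dirac /= ltry. Qed.

Definition step_measure n (m : bounded_measure n) : {measure set (n.+1.-tuple RR) -> \bar R} :=
  measure_function_pushforward__canonical__measure_function_Measure
    (@lebesgue_measure R \x bmfun m) (@measurable_cons_tuple n).

Lemma step_measure_box n (m : bounded_measure n) k : step_measure m (tuple_box n.+1 k) < +oo.
Proof.
have mE : step_measure m (tuple_box n.+1 k) =
    (@lebesgue_measure R \x bmfun m) (`[- k%:R, k%:R]%classic `*` tuple_box n k)%R.
  rewrite /step_measure /= /pushforward; congr (_ _).
  apply/seteqP; split => -[x t] /=.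
    move=> h; split => [|i]; first by have := h ord0; rewrite in_itv/= -ler_norml.
    by have := h (lift ord0 i); rewrite /cons_tuple tnthS.
  move=> [h1 h2] i; case: (unliftP ord0 i) => [j ->|->]; last by move: h1; rewrite in_itv/= -ler_norml.
  by rewrite /cons_tuple tnthS; exact: h2.
rewrite mE product_measure1E//; last exact: measurable_tuple_box.
apply: lte_mul_pinfty => //; last exact: bmeas_box.
by rewrite [X in X \is a _]lebesgue_measure_itv/=; case: ifPn.
Qed.

Fixpoint tuple_bounded n : bounded_measure n :=
  match n with
  | 0 => BoundedMeasure dirac0_box
  | n'.+1 => BoundedMeasure (@step_measure_box n' (tuple_bounded n'))
  end.

(** Built one coordinate at a time, so that integration against it unfolds into the iterated
    integral behind [vol]. *)
Definition leb n : set (n.-tuple RR) -> \bar R := bmfun (tuple_bounded n).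
Arguments leb : clear implicits.

HB.instance Definition _ n := SigmaFiniteMeasure.copy (leb n) (bmfun (tuple_bounded n)).

Lemma integral_leb0 (f : 0.-tuple RR -> \bar R) : measurable_fun [set: 0.-tuple RR] f ->
  (forall t, 0 <= f t) -> \int[leb 0]_t f t = f [tuple].
Proof. by move=> mf f0; rewrite [LHS]integral_dirac//= diracT mul1e. Qed.

Lemma integral_lebS n (f : n.+1.-tuple RR -> \bar R) : measurable_fun [set: n.+1.-tuple RR] f ->
  (forall t, 0 <= f t) ->
  \int[leb n.+1]_t f t = \int[lebesgue_measure]_x \int[leb n]_t f (cons_tuple (x, t)).
Proof.
move=> mf f0.
rewrite [LHS](ge0_integral_pushforward (@measurable_cons_tuple n)
   (@lebesgue_measure R \x leb n))// preimage_setT.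
rewrite fubini_tonelli1//=.
by apply: measurableT_comp => //; exact: measurable_cons_tuple.
Qed.

(** This order of integration serves maps that move the head by an amount depending on the tail. *)
Lemma integral_lebS_swap n (f : n.+1.-tuple RR -> \bar R) : measurable_fun [set: n.+1.-tuple RR] f ->
  (forall t, 0 <= f t) ->
  \int[leb n.+1]_t f t = \int[leb n]_t \int[lebesgue_measure]_x f (cons_tuple (x, t)).
Proof.
move=> mf f0.
rewrite [LHS](ge0_integral_pushforward (@measurable_cons_tuple n)
   (@lebesgue_measure R \x leb n))// preimage_setT.
rewrite fubini_tonelli2//=.
by apply: measurableT_comp => //; exact: measurable_cons_tuple.
Qed.

End tuple_measure.
Arguments leb : clear implicits.

(** * Affine substitutions on the line *)

Section affine_substitution.
Variable R : realType.
Local Notation RR := (measurableTypeR R).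
Implicit Types a b : R.

Definition affine a b : RR -> RR := fun x => a * x + b.

Lemma measurable_affine a b : measurable_fun setT (affine a b).
Proof. by apply: measurable_funD => //; exact: measurable_funM. Qed.

Definition affine_measure (a : {nonneg R}) b c : {measure set RR -> \bar R} :=
  mscale a (measure_function_pushforward__canonical__measure_function_Measure
    (@lebesgue_measure R) (measurable_affine c b)).

(** By uniqueness of Lebesgue measure, comparison on half-open intervals suffices; a negative [a]
    moves the closed end to the left. *)
Lemma lebesgue_measure_affine a b : a != 0 -> forall A : set RR, measurable A ->
  lebesgue_measure A = affine_measure (NngNum (normr_ge0 a)) b a A.
Proof.
move=> a0; apply: lebesgue_measure_unique => X [[p q] _ <-] /=.
rewrite /mscale /= /pushforward /= lebesgue_measure_itv /= lte_fin.
have [apos|aneg] := ltP 0 a.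
  have -> : affine a b @^-1` `]p, q]%classic = `](p - b) / a, (q - b) / a]%classic.
    apply/seteqP; split => x /=; rewrite /affine !in_itv/= ltr_pdivrMr// ler_pdivlMr//;
      rewrite ltrBlDr lerBrDr [x * a]mulrC; by [].
  rewrite lebesgue_measure_itv /= lte_fin ltr_pM2r ?invr_gt0// ltrD2r.
  case: ifPn => _; last by rewrite mule0.
  by rewrite -!EFinD -EFinM gtr0_norm// -mulrBl mulrCA divff ?gt_eqF// mulr1; congr (_%:E); ring.
have {}aneg : a < 0 by rewrite lt_neqAle a0.
have -> : affine a b @^-1` `]p, q]%classic = `[(q - b) / a, (p - b) / a[%classic.
  apply/seteqP; split => x /=; rewrite /affine !in_itv/= ltr_ndivlMr// ler_ndivrMr//;
    rewrite ltrBlDr lerBrDr [x * a]mulrC; by rewrite andbC.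
rewrite lebesgue_measure_itv /= lte_fin ltr_nM2r ?invr_lt0// ltrD2r.
case: ifPn => _; last by rewrite mule0.
by rewrite -!EFinD -EFinM ltr0_norm//; congr (_%:E); field.
Qed.

Lemma integral_affine a b (f : RR -> \bar R) : a != 0 -> measurable_fun setT f ->
  (forall x, 0 <= f x)%E ->
  (\int[lebesgue_measure]_x f x = `|a|%:E * \int[lebesgue_measure]_x f (affine a b x))%E.
Proof.
move=> a0 mf f0; rewrite (eq_measure_integral (affine_measure (NngNum (normr_ge0 a)) b a)).
  rewrite ge0_integral_mscale//=; congr (_ * _)%E.
  by rewrite [LHS](ge0_integral_pushforward (measurable_affine a b))// preimage_setT.
by move=> A mA _; exact: lebesgue_measure_affine.
Qed.

End affine_substitution.

(** * Row vectors, their integrals, and volume-preserving maps *)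

Section row_vectors.
Variable R : realType.
Local Notation RR := (measurableTypeR R).
Implicit Types a b c s x y z : R.

Definition hdv n (w : 'rV[R]_n.+1) : R := w ord0 ord0.
Definition tlv n (w : 'rV[R]_n.+1) : 'rV[R]_n := \row_i w ord0 (lift ord0 i).
Definition consv n x (v : 'rV[R]_n) : 'rV[R]_n.+1 :=
  \row_i oapp (v ord0) x (unlift ord0 i).

Lemma hd_consv n x (v : 'rV[R]_n) : hdv (consv x v) = x.
Proof. by rewrite /hdv mxE unlift_none. Qed.

Lemma consv_lift n x (v : 'rV[R]_n) i : consv x v ord0 (lift ord0 i) = v ord0 i.
Proof. by rewrite mxE liftK. Qed.

Lemma tl_consv n x (v : 'rV[R]_n) : tlv (consv x v) = v.
Proof. by apply/rowP => i; rewrite mxE consv_lift. Qed.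

Lemma consv_eta n (w : 'rV[R]_n.+1) : consv (hdv w) (tlv w) = w.
Proof.
apply/rowP => i; case: (unliftP ord0 i) => [j ->|->]; first by rewrite consv_lift mxE.
exact: hd_consv.
Qed.

Lemma consvD n x y (u v : 'rV[R]_n) : consv x u + consv y v = consv (x + y) (u + v).
Proof.
apply/rowP => i; rewrite mxE.
by case: (unliftP ord0 i) => [j ->|->]; [rewrite !consv_lift mxE|rewrite -!/(hdv _) !hd_consv].
Qed.

Lemma consvZ n a x (u : 'rV[R]_n) : a *: consv x u = consv (a * x) (a *: u).
Proof.
apply/rowP => i; rewrite mxE.
by case: (unliftP ord0 i) => [j ->|->]; [rewrite !consv_lift mxE|rewrite -!/(hdv _) !hd_consv].
Qed.

Lemma consv0 n : consv 0 (0 : 'rV[R]_n) = 0.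
Proof. by rewrite -[RHS](scale0r (consv 0 0)) consvZ scale0r mul0r. Qed.

Lemma hdvD n (u v : 'rV[R]_n.+1) : hdv (u + v) = hdv u + hdv v.
Proof. by rewrite /hdv mxE. Qed.

Lemma hdvZ n a (u : 'rV[R]_n.+1) : hdv (a *: u) = a * hdv u.
Proof. by rewrite /hdv mxE. Qed.

Lemma tlvD n (u v : 'rV[R]_n.+1) : tlv (u + v) = tlv u + tlv v.
Proof. by apply/rowP => i; rewrite !mxE. Qed.

Lemma tlvZ n a (u : 'rV[R]_n.+1) : tlv (a *: u) = a *: tlv u.
Proof. by apply/rowP => i; rewrite !mxE. Qed.

Definition dotv n (u v : 'rV[R]_n) : R := \sum_i u ord0 i * v ord0 i.
Definition enorm n (u : 'rV[R]_n) : R := Num.sqrt (dotv u u).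

Lemma dotv_consv n x y (u v : 'rV[R]_n) : dotv (consv x u) (consv y v) = x * y + dotv u v.
Proof.
rewrite /dotv big_ord_recl -!/(hdv _) !hd_consv; congr (_ + _).
by apply: eq_bigr => i _; rewrite !consv_lift.
Qed.

Lemma dotvE n (u v : 'rV[R]_n.+1) : dotv u v = hdv u * hdv v + dotv (tlv u) (tlv v).
Proof. by rewrite -dotv_consv !consv_eta. Qed.

Lemma dotvC n (u v : 'rV[R]_n) : dotv u v = dotv v u.
Proof. by apply: eq_bigr => i _; rewrite mulrC. Qed.

Lemma dotvDl n (u v w : 'rV[R]_n) : dotv (u + v) w = dotv u w + dotv v w.
Proof. by rewrite /dotv -big_split /=; apply: eq_bigr => i _; rewrite mxE mulrDl. Qed.

Lemma dotvZl n a (u w : 'rV[R]_n) : dotv (a *: u) w = a * dotv u w.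
Proof. by rewrite /dotv mulr_sumr; apply: eq_bigr => i _; rewrite mxE mulrA. Qed.

Lemma dotvDr n (u v w : 'rV[R]_n) : dotv u (v + w) = dotv u v + dotv u w.
Proof. by rewrite dotvC dotvDl !(dotvC _ u). Qed.

Lemma dotvZr n a (u w : 'rV[R]_n) : dotv u (a *: w) = a * dotv u w.
Proof. by rewrite dotvC dotvZl (dotvC _ u). Qed.

Lemma dotvBl n (u v w : 'rV[R]_n) : dotv (u - v) w = dotv u w - dotv v w.
Proof. by rewrite dotvDl -scaleN1r dotvZl mulN1r. Qed.

Lemma dotvBr n (u v w : 'rV[R]_n) : dotv u (v - w) = dotv u v - dotv u w.
Proof. by rewrite dotvC dotvBl !(dotvC u). Qed.

Lemma dot0v n (w : 'rV[R]_n) : dotv 0 w = 0.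
Proof. by rewrite -(scale0r 0) dotvZl mul0r. Qed.

Lemma dotv_ge0 n (u : 'rV[R]_n) : 0 <= dotv u u.
Proof. by apply: sumr_ge0 => i _; rewrite -expr2 sqr_ge0. Qed.

Lemma enorm_ge0 n (u : 'rV[R]_n) : 0 <= enorm u. Proof. exact: sqrtr_ge0. Qed.

Lemma sqr_enorm n (u : 'rV[R]_n) : enorm u ^+ 2 = dotv u u.
Proof. by rewrite sqr_sqrtr// dotv_ge0. Qed.

Lemma dotv_eq0 n (u : 'rV[R]_n) : dotv u u = 0 -> u = 0.
Proof.
move=> /eqP; rewrite psumr_eq0 => [/allP h|i _]; last by rewrite -expr2 sqr_ge0.
apply/rowP => i; apply/eqP; have := h i (mem_index_enum _).
by rewrite /= mulf_eq0 orbb mxE.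
Qed.

Lemma enorm_eq0 n (u : 'rV[R]_n) : enorm u = 0 -> u = 0.
Proof. by move=> u0; apply: dotv_eq0; rewrite -sqr_enorm u0 expr0n. Qed.

Lemma enorm0 n : enorm (0 : 'rV[R]_n) = 0.
Proof. by rewrite /enorm dot0v sqrtr0. Qed.

Lemma enormZ n a (u : 'rV[R]_n) : enorm (a *: u) = `|a| * enorm u.
Proof.
by rewrite /enorm dotvZl dotvZr mulrA -expr2 sqrtrM ?sqr_ge0// sqrtr_sqr.
Qed.

Lemma enormN n (u : 'rV[R]_n) : enorm (- u) = enorm u.
Proof. by rewrite -scaleN1r enormZ normrN normr1 mul1r. Qed.

Definition e0 n : 'rV[R]_n.+1 := consv 1 0.

Definition rowt n (t : n.-tuple RR) : 'rV[R]_n := \row_i tnth t i.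
Definition tupv n (v : 'rV[R]_n) : n.-tuple RR := [tuple v ord0 i | i < n].

Lemma tupvK n : cancel (@tupv n) (@rowt n).
Proof. by move=> v; apply/rowP => i; rewrite mxE tnth_mktuple. Qed.

Lemma rowt_cons n x (t : n.-tuple RR) : rowt (cons_tuple (x, t)) = consv x (rowt t).
Proof.
apply/rowP => i; rewrite mxE; case: (unliftP ord0 i) => [j ->|->].
  by rewrite /cons_tuple tnthS consv_lift mxE.
by rewrite -/(hdv _) hd_consv.
Qed.

(** Measurability is read on tuples, where the product sigma-algebra and [leb] live. *)
Definition vmeas n d (U : measurableType d) (f : 'rV[R]_n -> U) :=
  measurable_fun [set: n.-tuple RR] (fun t => f (rowt t)).

Definition vmap n m (T : 'rV[R]_n -> 'rV[R]_m) :=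
  forall i, vmeas (fun v => T v ord0 i : RR).

Lemma vmeas_coord n i : vmeas (fun v : 'rV[R]_n => v ord0 i : RR).
Proof.
rewrite /vmeas (_ : (fun t => _) = (fun t => tnth t i)); first exact: measurable_tnth.
by apply/funext => t; rewrite mxE.
Qed.

Lemma measurable_tupv d (X : measurableType d) n (T : X -> 'rV[R]_n) :
  (forall i, measurable_fun setT (fun p : X => T p ord0 i : RR)) ->
  measurable_fun setT (fun p : X => tupv (T p)).
Proof.
move=> h; apply/measurable_fun_tnthP => i.
rewrite (_ : _ \o _ = (fun p : X => T p ord0 i)) //.
by apply/funext => x /=; rewrite tnth_mktuple.
Qed.

Lemma measurable_vcomp d' (X : measurableType d') n (T : X -> 'rV[R]_n) d
    (U : measurableType d) (f : 'rV[R]_n -> U) :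
  (forall i, measurable_fun setT (fun p : X => T p ord0 i : RR)) -> vmeas f ->
  measurable_fun setT (fun p : X => f (T p)).
Proof.
move=> /measurable_tupv mT mf.
rewrite (_ : (fun p : X => _) = (fun t => f (rowt t)) \o (fun p : X => tupv (T p))).
  exact: measurableT_comp.
by apply/funext => x /=; rewrite tupvK.
Qed.

Lemma vmeas_comp n m (T : 'rV[R]_n -> 'rV[R]_m) d (U : measurableType d) (f : 'rV[R]_m -> U) :
  vmap T -> vmeas f -> vmeas (fun v => f (T v)).
Proof. by move=> mT mf; exact: (measurable_vcomp (T := fun t : n.-tuple RR => T (rowt t)) mT mf). Qed.

Lemma vmap_consv n (f : 'rV[R]_n -> R) m (T : 'rV[R]_n -> 'rV[R]_m) :
  vmeas (f : 'rV[R]_n -> RR) -> vmap T -> vmap (fun v => consv (f v) (T v)).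
Proof.
move=> mf mT i; case: (unliftP ord0 i) => [j ->|->].
  by rewrite (_ : (fun v => _) = (fun v => T v ord0 j))//; apply/funext => v; rewrite consv_lift.
rewrite (_ : (fun v => _) = f)//; apply/funext => v.
by rewrite -/(hdv _) hd_consv.
Qed.

Lemma vmap_tlv n : vmap (@tlv n).
Proof.
move=> i; rewrite (_ : (fun v => _) = (fun v : 'rV[R]_n.+1 => v ord0 (lift ord0 i))).
  exact: vmeas_coord.
by apply/funext => v; rewrite mxE.
Qed.

Lemma vmap_comp n m k (T : 'rV[R]_n -> 'rV[R]_m) (S : 'rV[R]_m -> 'rV[R]_k) :
  vmap T -> vmap S -> vmap (S \o T).
Proof. by move=> mT mS i; exact: (vmeas_comp mT (mS i)). Qed.

Lemma vmeas_hdv n : vmeas (@hdv n : _ -> RR).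
Proof. exact: vmeas_coord. Qed.

Definition vint n (f : 'rV[R]_n -> \bar R) : \bar R := (\int[leb R n]_t f (rowt t))%E.

Lemma vint_cons n (f : 'rV[R]_n.+1 -> \bar R) : vmeas f -> (forall v, 0 <= f v)%E ->
  vint f = (\int[lebesgue_measure]_x vint (fun v => f (consv x v)))%E.
Proof.
move=> mf f0; rewrite /vint integral_lebS//.
by apply: eq_integral => x _; apply: eq_integral => t _; rewrite rowt_cons.
Qed.

Lemma vint_cons_swap n (f : 'rV[R]_n.+1 -> \bar R) : vmeas f -> (forall v, 0 <= f v)%E ->
  vint f = vint (fun v => (\int[lebesgue_measure]_x f (consv x v))%E).
Proof.
move=> mf f0; rewrite /vint integral_lebS_swap//.
by apply: eq_integral => x _; apply: eq_integral => t _; rewrite rowt_cons.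
Qed.

Lemma vint0 (f : 'rV[R]_0 -> \bar R) : vmeas f -> (forall v, 0 <= f v)%E -> vint f = f 0.
Proof.
move=> mf f0; rewrite /vint integral_leb0//; congr (f _); apply/rowP; by case.
Qed.

Lemma eq_vint n (f g : 'rV[R]_n -> \bar R) : f =1 g -> vint f = vint g.
Proof. by move=> fg; congr vint; apply/funext. Qed.

Definition mpres n (T : 'rV[R]_n -> 'rV[R]_n) := vmap T /\
  forall f : 'rV[R]_n -> \bar R, vmeas f -> (forall v, 0 <= f v)%E ->
    vint (fun v => f (T v)) = vint f.

Lemma mpres_id n : mpres (@id 'rV[R]_n).
Proof. by split => // i; exact: vmeas_coord. Qed.

Lemma mpres_comp n (T S : 'rV[R]_n -> 'rV[R]_n) : mpres T -> mpres S -> mpres (S \o T).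
Proof.
move=> [mT hT] [mS hS]; split => [|f mf f0]; first exact: vmap_comp.
by rewrite (hT (fun v => f (S v)))// ?hS//; exact: vmeas_comp.
Qed.

(** Tonelli with the head outermost: each slice with fixed head is preserved. *)
Lemma mpres_fiber n (T : R -> 'rV[R]_n -> 'rV[R]_n) : (forall x, mpres (T x)) ->
  vmap (fun w => T (hdv w) (tlv w)) -> mpres (fun w => consv (hdv w) (T (hdv w) (tlv w))).
Proof.
move=> hT mT; have mT' : vmap (fun w : 'rV_n.+1 => consv (hdv w) (T (hdv w) (tlv w))).
  by apply: vmap_consv => //; exact: vmeas_hdv.
split => // f mf f0; rewrite vint_cons//; last exact: (vmeas_comp mT' mf).
rewrite vint_cons//; apply: eq_integral => x _.
under eq_vint do rewrite hd_consv tl_consv.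
rewrite ((hT x).2 (fun v => f (consv x v)))//; apply: vmeas_comp mf.
by apply: vmap_consv; [exact: measurable_cst|move=> i; exact: vmeas_coord].
Qed.

Lemma mpres_lift n (T : 'rV[R]_n -> 'rV[R]_n) : mpres T ->
  mpres (fun w => consv (hdv w) (T (tlv w))).
Proof.
move=> hT; apply: (mpres_fiber (T := fun=> T)) => //.
by apply: (vmap_comp (@vmap_tlv n)); case: hT.
Qed.

(** Tonelli with the tail outermost: for a fixed tail the head undergoes an affine map with slope of
    modulus 1. *)
Lemma mpres_head n a (l : 'rV[R]_n -> R) : `|a| = 1 -> vmeas (l : _ -> RR) ->
  mpres (fun w => consv (a * hdv w + l (tlv w)) (tlv w)).
Proof.
move=> a1 ml; have mT : vmap (fun w : 'rV_n.+1 => consv (a * hdv w + l (tlv w)) (tlv w)).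
  apply: vmap_consv; last exact: vmap_tlv.
  apply: measurable_funD; first by apply: measurable_funM => //; exact: vmeas_hdv.
  exact: (vmeas_comp (@vmap_tlv n) ml).
split => // f mf f0; rewrite vint_cons_swap//; last exact: (vmeas_comp mT mf).
rewrite vint_cons_swap//; apply: eq_vint => v.
rewrite [RHS](integral_affine (a := a) (l v))//.
- by rewrite a1 mul1e; apply: eq_integral => x _; rewrite hd_consv tl_consv.
- by rewrite -normr_gt0 a1.
- apply: (measurable_vcomp (T := fun x : RR => consv x v)) => //.
  move=> i; case: (unliftP ord0 i) => [j ->|->].
    under [X in measurable_fun _ X]funext do rewrite consv_lift.
    exact: measurable_cst.
  under [X in measurable_fun _ X]funext do rewrite -/(hdv _) hd_consv.
  exact: measurable_id.
Qed.

End row_vectors.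

(** * Linear isometries and their transitivity on spheres *)

Section rotations.
Variable R : realType.
Local Notation RR := (measurableTypeR R).
Implicit Types a b c s x y z : R.

(** Volume preservation is part of the notion: it is proved for explicit generators and inherited by
    composition. Reflections are allowed. *)
Definition rotv n (T : 'rV[R]_n -> 'rV[R]_n) :=
  [/\ forall a u v, T (a *: u + v) = a *: T u + T v,
      forall u v, dotv (T u) (T v) = dotv u v & mpres T].

Lemma rotv_id n : rotv (@id 'rV[R]_n).
Proof. by split => //; exact: mpres_id. Qed.

Lemma rotv_comp n (T S : 'rV[R]_n -> 'rV[R]_n) : rotv T -> rotv S -> rotv (S \o T).
Proof.
move=> [lT dT pT] [lS dS pS]; split => [a u v|u v|]/=; first by rewrite lT lS.
  by rewrite dS dT.
exact: mpres_comp.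
Qed.

Lemma rotv_lift n (T : 'rV[R]_n -> 'rV[R]_n) : rotv T ->
  rotv (fun w => consv (hdv w) (T (tlv w))).
Proof.
move=> [lT dT pT]; split => [a u v|u v|]; last exact: mpres_lift.
  by rewrite hdvD hdvZ tlvD tlvZ lT consvZ consvD.
by rewrite dotv_consv dT -dotvE.
Qed.

Lemma rotv_flip n : rotv (fun w : 'rV[R]_n.+1 => consv (- hdv w) (tlv w)).
Proof.
split => [a u v|u v|].
- by rewrite hdvD hdvZ tlvD tlvZ consvZ consvD opprD mulrN.
- by rewrite dotv_consv mulrNN -dotvE.
have := @mpres_head R n (-1) (fun=> 0) (normrN1 _) (@measurable_cst _ _ _ _ _ _).
rewrite (_ : (fun w => _) = (fun w : 'rV[R]_n.+1 => consv (- hdv w) (tlv w)))//.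
by apply/funext => w; rewrite mulN1r addr0.
Qed.

Lemma mpres_shear0 n c :
  mpres (fun w : 'rV[R]_n.+2 => consv (hdv w + c * hdv (tlv w)) (tlv w)).
Proof.
have := @mpres_head R n.+1 1 (fun v => c * hdv v) (normr1 _).
rewrite (_ : (fun w => _) = (fun w : 'rV[R]_n.+2 => consv (hdv w + c * hdv (tlv w)) (tlv w))).
  by apply; apply: measurable_funM => //; exact: vmeas_hdv.
by apply/funext => w; rewrite mul1r.
Qed.

Lemma mpres_shear1 n c :
  mpres (fun w : 'rV[R]_n.+2 => consv (hdv w) (consv (hdv (tlv w) + c * hdv w) (tlv (tlv w)))).
Proof.
apply: (@mpres_fiber R n.+1 (fun x v => consv (hdv v + c * x) (tlv v))) => [x|].
  have := @mpres_head R n 1 (fun v => c * x) (normr1 _) (@measurable_cst _ _ _ _ _ _).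
  rewrite (_ : (fun w => _) = (fun w : 'rV[R]_n.+1 => consv (hdv w + c * x) (tlv w)))//.
  by apply/funext => w; rewrite mul1r.
apply: vmap_consv; last exact: (vmap_comp (@vmap_tlv R n.+1) (@vmap_tlv R n)).
apply: measurable_funD; first exact: (vmeas_comp (@vmap_tlv R n.+1) (@vmeas_hdv R n)).
by apply: measurable_funM => //; exact: vmeas_hdv.
Qed.

Definition givens n c s (w : 'rV[R]_n.+2) : 'rV[R]_n.+2 :=
  consv (c * hdv w + s * hdv (tlv w)) (consv (c * hdv (tlv w) - s * hdv w) (tlv (tlv w))).

(* a plane rotation with s <> 0 is the product of three shears *)
Lemma mpres_givens n c s : s != 0 -> c ^+ 2 + s ^+ 2 = 1 -> mpres (@givens n c s).
Proof.
move=> s0 cs1; pose a := (1 - c) / s.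
have h0 := @mpres_shear0 n a; have h1 := @mpres_shear1 n (- s).
have := mpres_comp (mpres_comp h0 h1) h0.
rewrite (_ : _ \o _ = @givens n c s)//; apply/funext => w /=.
rewrite !(hd_consv, tl_consv) /givens; move: (hdv w) (hdv (tlv w)) => x y.
have as1 : a * s = 1 - c by rewrite /a divfK.
have ac : a * (1 + c) = s.
  apply: (mulfI s0); rewrite mulrA [s * a]mulrC as1 -expr2 -[in RHS](addKr (c ^+ 2) (s ^+ 2)) cs1; ring.
have yE : y + - s * (x + a * y) = c * y - s * x.
  by transitivity ((1 - a * s) * y - s * x); [ring|rewrite as1; ring].
rewrite yE; congr (consv _ _).
by transitivity ((1 - a * s) * x + a * (1 + c) * y); [ring|rewrite as1 ac; ring].
Qed.

Lemma rotv_givens n c s : s != 0 -> c ^+ 2 + s ^+ 2 = 1 -> rotv (@givens n c s).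
Proof.
move=> s0 cs1; split => [a u v|u v|]; last exact: mpres_givens.
  by rewrite /givens !(hdvD, hdvZ, tlvD, tlvZ) !(consvZ, consvD); congr (consv _ (consv _ _)); ring.
rewrite /givens !dotv_consv [in RHS]dotvE [in RHS](dotvE (tlv _)).
rewrite !addrA; congr (_ + _).
transitivity ((c ^+ 2 + s ^+ 2) * (hdv u * hdv v + hdv (tlv u) * hdv (tlv v))); first by ring.
by rewrite cs1 mul1r.
Qed.

Lemma givensK n c s (w : 'rV[R]_n.+2) : c ^+ 2 + s ^+ 2 = 1 -> givens c (- s) (givens c s w) = w.
Proof.
move=> cs1; rewrite /givens !(hd_consv, tl_consv) -[RHS]consv_eta -[in RHS](consv_eta (tlv w)).
by congr (consv _ (consv _ _)); rewrite -[RHS]mul1r -cs1; ring.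
Qed.

(** By induction the tail is brought to its own axis; one Givens rotation of the first two
    coordinates then absorbs its norm into the head. A vector already on the axis needs at most a
    change of sign. The map [S] back is built in parallel, so that two vectors of equal norm can be
    joined through the axis. *)
Lemma rotv_e0 n (x : 'rV[R]_n.+1) : exists T S, [/\ rotv T, rotv S,
  T x = enorm x *: e0 R n & S (enorm x *: e0 R n) = x].
Proof.
have flip m (w : 'rV[R]_m.+1) : tlv w = 0 -> exists T S, [/\ rotv T, rotv S,
    T w = enorm w *: e0 R m & S (enorm w *: e0 R m) = w].
  move=> w0; have nw : enorm w = `|hdv w| by rewrite /enorm dotvE w0 dot0v addr0 -expr2 sqrtr_sqr.
  rewrite nw /e0 consvZ mulr1 scaler0; have [h|h] := leP 0 (hdv w).
    by exists id, id; rewrite ger0_norm// -w0 consv_eta; split => //; exact: rotv_id.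
  exists (fun w => consv (- hdv w) (tlv w)), (fun w => consv (- hdv w) (tlv w)).
  rewrite ltr0_norm//; split; [exact: rotv_flip|exact: rotv_flip|by rewrite w0|].
  by rewrite hd_consv tl_consv opprK -w0 consv_eta.
elim: n x => [|n IH] x.
  by apply: flip; apply/rowP; case.
have [T [S [rT rS Tx Sx]]] := IH (tlv x).
have [q0|q0] := eqVneq (enorm (tlv x)) 0; first by apply: flip; exact: enorm_eq0.
have nx : enorm x ^+ 2 = hdv x ^+ 2 + enorm (tlv x) ^+ 2 by rewrite !sqr_enorm dotvE expr2.
set p := hdv x in nx *; set q := enorm (tlv x) in nx q0 Tx Sx *; set r := enorm x in nx *.
have r0 : r != 0.
  have : 0 < q ^+ 2 by rewrite lt_neqAle sqr_ge0 eq_sym expf_neq0.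
  apply: contraTneq => r0; move: nx; rewrite r0 expr0n /= => h.
  by rewrite -leNgt; have := sqr_ge0 p; lra.
have cs1 : (p / r) ^+ 2 + (q / r) ^+ 2 = 1.
  by rewrite !expr_div_n -mulrDl -nx divff// expf_neq0.
have s0 : q / r != 0 by rewrite mulf_neq0// invr_eq0.
have Gx : givens (p / r) (q / r) (consv p (T (tlv x))) = r *: e0 R n.+1.
  rewrite Tx /e0 !consvZ /givens !(hd_consv, tl_consv) !mulr1 !scaler0.
  have -> : p / r * q - q / r * p = 0 by ring.
  rewrite consv0; congr (consv _ _).
  transitivity ((p ^+ 2 + q ^+ 2) / r); first by ring.
  by rewrite -nx expr2 mulfK.
exists (@givens n (p / r) (q / r) \o (fun w => consv (hdv w) (T (tlv w)))).
exists ((fun w => consv (hdv w) (S (tlv w))) \o @givens n (p / r) (- (q / r))).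
split => //=.
- by apply: rotv_comp; [exact: rotv_lift|exact: rotv_givens].
- by apply: rotv_comp; [apply: rotv_givens; rewrite ?oppr_eq0 ?sqrrN|exact: rotv_lift].
by rewrite -Gx givensK// hd_consv tl_consv Tx Sx consv_eta.
Qed.

Lemma rotv_enorm n (T : 'rV[R]_n -> 'rV[R]_n) u : rotv T -> enorm (T u) = enorm u.
Proof. by move=> [_ dT _]; rewrite /enorm dT. Qed.

Lemma rotvZ n (T : 'rV[R]_n -> 'rV[R]_n) a u : rotv T -> T (a *: u) = a *: T u.
Proof.
move=> [lT _ _]; have T0 : T 0 = 0.
  by have := lT 1 0 0; rewrite !scale1r addr0 => /eqP; rewrite -subr_eq0 opprD addNKr oppr_eq0 => /eqP.
by rewrite -[a *: u]addr0 lT T0 addr0.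
Qed.

Lemma rotvD n (T : 'rV[R]_n -> 'rV[R]_n) u v : rotv T -> T (u + v) = T u + T v.
Proof. by move=> [lT _ _]; rewrite -[u]scale1r lT !scale1r. Qed.

Lemma rotvB n (T : 'rV[R]_n -> 'rV[R]_n) u v : rotv T -> T (u - v) = T u - T v.
Proof. by move=> rT; rewrite rotvD// -scaleN1r rotvZ// scaleN1r. Qed.

Lemma rotv_transitive n (x y : 'rV[R]_n.+1) : enorm x = enorm y ->
  exists2 T, rotv T & T x = y.
Proof.
move=> xy; have [T [_ [rT _ Tx _]]] := rotv_e0 x.
have [_ [S [_ rS _ Sy]]] := rotv_e0 y.
by exists (S \o T); [exact: rotv_comp|rewrite /= Tx xy Sy].
Qed.

Lemma hdv_le_enorm n (x : 'rV[R]_n.+1) : `|hdv x| <= enorm x.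
Proof. by rewrite -sqrtr_sqr ler_wsqrtr// dotvE expr2 lerDl dotv_ge0. Qed.

(** Once [y] is rotated to the first axis, the product reads a single coordinate of the image of
    [x]. *)
Lemma dotv_le n (x y : 'rV[R]_n.+1) : `|dotv x y| <= enorm x * enorm y.
Proof.
have [T [_ [rT _ Ty _]]] := rotv_e0 y; have [_ dT _] := rT.
rewrite -dT Ty dotvZr normrM ger0_norm ?enorm_ge0// mulrC ler_wpM2r ?enorm_ge0//.
rewrite -(rotv_enorm x rT) dotvE /e0 hd_consv tl_consv dotvC dot0v addr0 mulr1.
exact: hdv_le_enorm.
Qed.

Lemma enormD n (x y : 'rV[R]_n.+1) : enorm (x + y) <= enorm x + enorm y.
Proof.
rewrite -(ler_pXn2r (n := 2))// ?nnegrE ?addr_ge0 ?enorm_ge0// sqr_enorm sqrrD !sqr_enorm.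
rewrite dotvDl !dotvDr (dotvC y x).
have := dotv_le x y; rewrite ler_norml => /andP[_ h].
by rewrite [X in X <= _](_ : _ = dotv x x + dotv x y *+ 2 + dotv y y); [lra|ring].
Qed.

Lemma enormB n (x y : 'rV[R]_n.+1) : enorm (x - y) = enorm (y - x).
Proof. by rewrite -enormN opprB. Qed.

Lemma ler_enorm_dist n (x y : 'rV[R]_n.+1) : `|enorm x - enorm y| <= enorm (x - y).
Proof.
have h (u v : 'rV[R]_n.+1) : enorm u - enorm v <= enorm (u - v).
  by rewrite lerBlDr -[in X in X <= _](subrK v u) enormD.
by rewrite ler_norml h andbT lerNl opprB enormB h.
Qed.

End rotations.

(** * The layer cake formula *)

Section layer_cake.
Context d (T : measurableType d) (R : realType).
Variable m : {sigma_finite_measure set T -> \bar R}.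
Local Notation RR := (measurableTypeR R).
Local Open Scope ereal_scope.

(** Tonelli on the region [delta x <= r], with its indicator [I] as kernel. The moment recursion,
    the Gamma values, the radial integrals and the use of the Steiner formula are all instances of
    this exchange. *)
Lemma layer_cake (a delta : T -> RR) (w : RR -> RR) :
  measurable_fun setT a -> measurable_fun setT delta -> measurable_fun setT w ->
  (forall x, 0 <= a x)%R -> (forall r, 0 <= w r)%R ->
  \int[m]_x ((a x)%:E * \int[lebesgue_measure]_(r in `[delta x, +oo[) (w r)%:E) =
  \int[lebesgue_measure]_r ((w r)%:E * \int[m]_(x in [set x | (delta x <= r)%R]) (a x)%:E).
Proof.
move=> ma md mw a0 w0.
pose I (x : T) (r : R) : R := (delta x <= r)%R%:R.
have I0 x r : (0 <= I x r)%R by rewrite ler0n.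
have mI : measurable_fun setT (fun z : T * RR => I z.1 z.2).
  have -> : (fun z : T * RR => I z.1 z.2) = \1_[set z : T * RR | (delta z.1 <= z.2)%R].
    by apply/funext => z; rewrite /I indicE /=; congr (_%:R); congr nat_of_bool; apply/idP/idP;
      rewrite inE.
  apply: measurable_indic; rewrite -[X in measurable X]setTI.
  apply: measurable_fun_le => //; exact: measurableT_comp.
have mIl x : measurable_fun setT (fun r : RR => I x r).
  exact: (measurableT_comp mI (measurable_pair1 x)).
have mIr r : measurable_fun setT (fun x : T => I x r).
  exact: (measurableT_comp mI (measurable_pair2 r)).
transitivity (\int[m]_x \int[lebesgue_measure]_r (a x * (w r * I x r))%:E).
  apply: eq_integral => x _.
  under [RHS]eq_integral do rewrite EFinM.
  rewrite ge0_integralZl//=.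
  - congr (_ * _); rewrite integral_mkcond; apply: eq_integral => r _.
    rewrite patchE mem_setE in_itv/= andbT /I.
    by case: ifP => _; rewrite ?mulr1// mulr0.
  - by apply: measurableT_comp => //; exact: measurable_funM.
  - by move=> r _; rewrite lee_fin mulr_ge0.
  - by rewrite lee_fin.
transitivity (\int[lebesgue_measure]_r \int[m]_x (a x * (w r * I x r))%:E); last first.
  apply: eq_integral => r _.
  under eq_integral do rewrite mulrCA EFinM.
  rewrite ge0_integralZl//=.
  - congr (_ * _); rewrite [RHS]integral_mkcond; apply: eq_integral => x _.
    rewrite patchE /I; case: ifPn => [|]; rewrite /= ?inE/= ?notin_setE/=; first by move=> ->; rewrite mulr1.
    by move=> /negP/negbTE ->; rewrite mulr0.
  - by apply: measurableT_comp => //; exact: measurable_funM.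
  - by move=> x _; rewrite lee_fin mulr_ge0.
  - by rewrite lee_fin.
rewrite (fubini_tonelli (fun z : T * RR => (a z.1 * (w z.2 * I z.1 z.2))%:E))//=.
  apply: measurableT_comp => //; apply: measurable_funM; first exact: measurableT_comp.
  by apply: measurable_funM => //; exact: measurableT_comp.
by move=> z; rewrite lee_fin !mulr_ge0.
Qed.

End layer_cake.

(** * Moments of the Gaussian on the half line *)

Section gauss_moments.
Variable R : realType.
Local Notation RR := (measurableTypeR R).
Local Notation mu := (@lebesgue_measure R).

Definition g1 (x : R) : R := expR (- (x ^+ 2 / 2)).

Lemma g1_ge0 x : 0 <= g1 x. Proof. exact: expR_ge0. Qed.

Lemma continuous_g1 : continuous g1.
Proof.
move=> x; apply: (@continuous_comp _ _ _ (fun x : R => - (x ^+ 2 / 2)) expR); last exact: continuous_expR.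
by apply: cvgN; apply: cvgMl; exact: exprn_continuous.
Qed.

Lemma measurable_g1 : measurable_fun setT (g1 : RR -> RR).
Proof. exact: continuous_measurable_fun continuous_g1. Qed.

Lemma integral_g1 : (\int[mu]_x (g1 x)%:E = (Num.sqrt (pi *+ 2))%:E)%E.
Proof.
have s2 : 0 < Num.sqrt (2 : R) by rewrite sqrtr_gt0.
have mg : measurable_fun setT (fun x : RR => (g1 x)%:E).
  by apply: measurableT_comp => //; exact: measurable_g1.
rewrite (integral_affine (a := Num.sqrt 2) 0 _ mg) ?gt_eqF//; last by move=> x; rewrite lee_fin g1_ge0.
under eq_integral => x _.
  rewrite /affine addr0 /g1 exprMn sqr_sqrtr// mulrAC divff// mul1r -/(gauss_fun x); over.
by rewrite integralT_gauss gtr0_norm// -EFinM -sqrtrM// mulr_natl.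
Qed.

Lemma derive_g1 (x : R) : is_derive x 1 g1 (- (x * g1 x)).
Proof.
rewrite /g1; apply: is_derive_eq; rewrite /GRing.scale/= ; lra.
Qed.

End gauss_moments.

Section moments.
Variable R : realType.
Local Notation RR := (measurableTypeR R).
Local Notation mu := (@lebesgue_measure R).
Implicit Types r t x : R.

Lemma integral_cint a b (f : R -> R) : continuous f ->
  (\int[mu]_(x in `[a, b]) (f x)%:E = (cint a b f)%:E)%E.
Proof.
move=> cf; rewrite /cint /Rintegral fineK//.
by apply: integrable_fin_num => //; exact: continuous_integrable.
Qed.

Lemma integral_pow k r : 0 <= r ->
  (\int[mu]_(t in `[0%R, r]) (k.+1%:R * t ^+ k)%:E = (r ^+ k.+1)%:E)%E.
Proof.
move=> r0; have cp : continuous (fun t : R => k.+1%:R * t ^+ k).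
  by move=> t; apply: cvgMr; exact: exprn_continuous.
rewrite integral_cint//; congr (_%:E).
have dF t : is_derive t 1 (fun t : R => t ^+ k.+1) (k.+1%:R * t ^+ k).
  have := is_deriveX k.+1 (@is_derive_id _ _ t (1 : R)).
  by rewrite exprfctE /= /GRing.scale /= mulr1.
by rewrite (cint_FTC cp r0 dF) expr0n subr0.
Qed.


Lemma integral_tail_g1 r : 0 <= r ->
  (\int[mu]_(t in `[r, +oo[) (t * g1 t)%:E = (g1 r)%:E)%E.
Proof.
move=> r0; have cf : continuous (fun t : R => t * g1 t).
  by move=> t; apply: cvgM; [exact: cvg_id|exact: continuous_g1].
have dg t : is_derive t 1 (fun t => - g1 t) (t * g1 t).
  by have := derive_g1 t => ?; apply: is_derive_eq; rewrite opprK.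
rewrite (@ge0_continuous_FTC2y R (fun t => t * g1 t) (fun t => - g1 t) r 0).
- by rewrite -EFinB sub0r opprK.
- by move=> x rx; rewrite mulr_ge0 ?g1_ge0// (le_trans r0).
- exact: continuous_subspaceT.
- rewrite -oppr0; apply: cvgN.
  apply: (cvg_comp (fun x : R => x ^+ 2 / 2) (fun x => expR (- x))); last exact: cvgr_expR.
  apply/cvgryPge => A; near=> x; rewrite ler_pdivlMr//.
  have x1 : 1 <= x by near: x; apply: nbhs_pinfty_ge; exact: num_real.
  have xA : A * 2 <= x by near: x; apply: nbhs_pinfty_ge; exact: num_real.
  by rewrite expr2; nra.
- by move=> x _; have [] := dg x.
- apply: cvg_at_right_filter; apply: cvgN; exact: continuous_g1.
- by move=> x _; rewrite derive1E; have [_] := dg x.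
Unshelve. all: by end_near. Qed.

Lemma integral_tail_exp r : (\int[mu]_(t in `[r, +oo[) (expR (- t))%:E = (expR (- r))%:E)%E.
Proof.
have cf : continuous (fun t : R => expR (- t)).
  move=> t; apply: (@continuous_comp _ _ _ (fun x : R => - x) expR); last exact: continuous_expR.
  by apply: cvgN; exact: cvg_id.
have dg t : is_derive t 1 (fun t => - expR (- t)) (expR (- t)).
  by apply: is_derive_eq; rewrite /GRing.scale /=; ring.
rewrite (@ge0_continuous_FTC2y R (fun t => expR (- t)) (fun t => - expR (- t)) r 0).
- by rewrite -EFinB sub0r opprK.
- by move=> x rx; rewrite expR_ge0.
- exact: continuous_subspaceT.
- by rewrite -oppr0; apply: cvgN; exact: cvgr_expR.
- by move=> x _; have [] := dg x.
- apply: cvg_at_right_filter; apply: cvgN; exact: cf.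
- by move=> x _; rewrite derive1E; have [_] := dg x.
Qed.

(** The density whose tail integral from [r >= 0] is [g1 r], extended by 0 so as to be a nonnegative
    weight in [layer_cake]. *)
Definition rg1 r : R := Num.max r 0 * g1 r.

Lemma rg1_ge0 r : 0 <= rg1 r.
Proof. by rewrite mulr_ge0 ?g1_ge0// le_max lexx orbT. Qed.

Lemma measurable_rg1 : measurable_fun setT (rg1 : RR -> RR).
Proof. by apply: measurable_funM; [exact: measurable_maxr|exact: measurable_g1]. Qed.

Lemma rg1_pos r : 0 <= r -> rg1 r = r * g1 r.
Proof. by move=> r0; rewrite /rg1 (max_idPl r0). Qed.

Lemma rg1_neg r : r <= 0 -> rg1 r = 0.
Proof. by move=> r0; rewrite /rg1 (max_idPr r0) mul0r. Qed.

Lemma integral_tail_rg1 r : 0 <= r -> (\int[mu]_(t in `[r, +oo[) (rg1 t)%:E = (g1 r)%:E)%E.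
Proof.
move=> r0; rewrite -integral_tail_g1//; apply: eq_integral => t.
by rewrite inE/= in_itv/= andbT => rt; rewrite rg1_pos// (le_trans r0).
Qed.

Definition Jint k : \bar R := (\int[mu]_(r in `[0%R, +oo[) (r ^+ k * g1 r)%:E)%E.

(** The density on the positive axis whose integral up to [r >= 0] is [r ^+ k.+1]. *)
Definition pospow k t : R := k.+1%:R * t ^+ k * (0 <= t)%R%:R.

Lemma pospow_ge0 k t : 0 <= pospow k t.
Proof.
rewrite /pospow; have [t0|t0] := leP 0 t; last by rewrite /= mulr0n mulr0.
by rewrite /= mulr1n mulr1 mulr_ge0// exprn_ge0.
Qed.

Lemma measurable_ge0 : measurable_fun setT (fun t : RR => (0 <= t)%R%:R : RR).
Proof.
rewrite (_ : (fun t => _) = \1_`[0, +oo[%classic); first exact: measurable_indic.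
by apply/funext => t; rewrite indicE mem_setE in_itv/= andbT.
Qed.

Lemma measurable_pospow k : measurable_fun setT (pospow k : RR -> RR).
Proof.
apply: measurable_funM; last exact: measurable_ge0.
by apply: measurable_funM => //; exact: exprn_measurable.
Qed.

Lemma integral_pospow k (D : set R) r : 0 <= r -> (forall t, 0 <= t -> D t <-> t <= r) ->
  (\int[mu]_(t in D) (pospow k t)%:E = (r ^+ k.+1)%:E)%E.
Proof.
move=> r0 hD; rewrite -integral_pow// integral_mkcond [RHS]integral_mkcond.
apply: eq_integral => t _; rewrite !patchE /pospow mem_setE in_itv/=.
have [t0|t0] := leP 0 t; last by rewrite /= mulr0n mulr0; case: ifP.
rewrite /= mulr1n mulr1 /=; congr (if _ then _ else _).
by apply/idP/idP => [|tr]; rewrite inE hD.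
Qed.

Lemma Jint_pospow k : (k.+1%:R%:E * Jint k = \int[mu]_t ((pospow k t)%:E * (g1 t)%:E))%E.
Proof.
rewrite /Jint -ge0_integralZl//.
- rewrite integral_mkcond; apply: eq_integral => t _; rewrite patchE mem_setE in_itv/= andbT /pospow.
  by case: ifP => _ /=; rewrite -EFinM ?mulr1n ?mulr1 ?mulrA// mulr0n mulr0 mul0r.
- apply: measurable_funTS; apply: measurableT_comp => //; apply: measurable_funM; last exact: measurable_g1.
  exact: exprn_measurable.
- by move=> t /=; rewrite in_itv/= andbT => t0; rewrite lee_fin mulr_ge0 ?g1_ge0// exprn_ge0.
Qed.

(** An integration by parts in the form of an exchange of integrals: [g1 t] is a tail integral of
    [rg1], and [pospow k] integrates to [r ^+ k.+1] below [r]. *)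
Lemma Jint_rec k : (Jint k.+2 = k.+1%:R%:E * Jint k)%E.
Proof.
rewrite Jint_pospow.
transitivity (\int[mu]_t ((pospow k t)%:E * \int[mu]_(r in `[t, +oo[) (rg1 r)%:E))%E; last first.
  apply: eq_integral => t _; have [t0|t0] := leP 0 t; last first.
    by rewrite /pospow leNgt t0 /= mulr0n mulr0 !mul0e.
  by rewrite integral_tail_rg1.
rewrite (layer_cake (delta := id) mu (measurable_pospow k) _ measurable_rg1 (pospow_ge0 k) rg1_ge0)//.
rewrite /Jint integral_mkcond; apply: eq_integral => r _.
rewrite patchE mem_setE in_itv/= andbT; case: ifPn => r0; last first.
  by rewrite rg1_neg ?mul0e// ltW// ltNge.
rewrite (integral_pospow k r0)//= -EFinM; congr (_%:E).
rewrite rg1_pos// [in LHS]exprS; ring.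
Qed.

Lemma Jint0_fin : (Jint 0 < +oo)%E.
Proof.
apply: (@le_lt_trans _ _ (\int[mu]_t (g1 t)%:E)%E); last by rewrite integral_g1 ltry.
rewrite /Jint; under eq_integral do rewrite mul1r.
apply: ge0_subset_integral => //; last by move=> t _; rewrite lee_fin g1_ge0.
by apply: measurableT_comp => //; exact: measurable_g1.
Qed.

Lemma Jint1 : Jint 1 = 1%E.
Proof.
rewrite /Jint; under eq_integral do rewrite expr1.
by rewrite integral_tail_g1// /g1 expr0n mul0r oppr0 expR0.
Qed.

Lemma Jint_ge0 k : (0 <= Jint k)%E.
Proof.
apply: integral_ge0 => t /=; rewrite in_itv/= andbT => t0.
by rewrite lee_fin mulr_ge0 ?g1_ge0// exprn_ge0.
Qed.

Lemma Jint_fin k : (Jint k < +oo)%E.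
Proof.
have : (Jint k < +oo)%E /\ (Jint k.+1 < +oo)%E.
  elim: k => [|k [IH1 IH2]]; first by rewrite Jint1; split; [exact: Jint0_fin|exact: ltry].
  by split => //; rewrite Jint_rec lte_mul_pinfty.
by case.
Qed.

Definition Jm k : R := fine (Jint k).

Lemma JintE k : Jint k = (Jm k)%:E.
Proof. by rewrite fineK// ge0_fin_numE ?Jint_ge0// Jint_fin. Qed.

Lemma Jm_rec k : Jm k.+2 = k.+1%:R * Jm k.
Proof. by apply: EFin_inj; rewrite EFinM -!JintE Jint_rec. Qed.

Lemma Jm1 : Jm 1 = 1. Proof. by rewrite /Jm Jint1. Qed.

End moments.

(** * Gaussian moments as values of the Gamma function *)

Section gamma_moments.
Variable R : realType.
Local Notation RR := (measurableTypeR R).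
Local Notation mu := (@lebesgue_measure R).
Implicit Types r t x : R.

Lemma sqrt_powR k t : 0 <= t -> Num.sqrt t ^+ k = t `^ (k%:R / 2).
Proof. by move=> t0; rewrite -powR12_sqrt// -powR_mulrn ?powR_ge0// -powRrM mulrC. Qed.

(** Here [g1 t] is the tail integral of [exp (- r)] from [t^2 / 2]. After the exchange, the points
    below level [r] reach up to [sqrt (2 r)], and the power [k.+1] of this bound is the integrand of
    Gamma up to the factor in front. *)
Lemma Jint_Gamma k : (Jint R k.+2 = (Num.sqrt 2 ^+ k.+1)%:E *
  \int[mu]_(t in [set t : R | (0 < t)%R]) (powR t (k.+3%:R / 2 - 1) * expR (- t))%R%:E)%E.
Proof.
have md : measurable_fun setT (fun t : RR => t ^+ 2 / 2 : RR).
  by apply: measurable_funM => //; exact: exprn_measurable.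
have mw : measurable_fun setT (fun t : RR => expR (- t) : RR).
  by apply: measurableT_comp => //; exact: measurable_expR.
rewrite Jint_rec Jint_pospow.
transitivity (\int[mu]_t ((pospow k t)%:E * \int[mu]_(r in `[(t ^+ 2 / 2)%R, +oo[) (expR (- r))%:E))%E.
  by apply: eq_integral => t _; rewrite integral_tail_exp.
rewrite (layer_cake mu (measurable_pospow k) md mw (pospow_ge0 k))//.
have E (t : R) : 0 < t -> (k.+3%:R / 2 - 1 : R) = k.+1%:R / 2.
  by rewrite -[k.+3]addn2 natrD => _; field.
have mS : measurable [set t : RR | 0 < t].
  rewrite (_ : [set t : R | 0 < t] = `]0%R, +oo[%classic)//.
  by apply/seteqP; split => t /=; rewrite in_itv/= andbT.
have mf : measurable_fun [set t : RR | 0 < t]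
    (fun t => (t `^ (k.+3%:R / 2 - 1) * expR (- t))%:E).
  apply: measurable_funTS; apply: measurableT_comp => //; exact: measurable_funM.
have f0 t : (0 <= (t `^ (k.+3%:R / 2 - 1) * expR (- t))%:E)%E.
  by rewrite lee_fin mulr_ge0 ?powR_ge0 ?expR_ge0.
rewrite -(ge0_integralZl mu mS mf (fun t _ => f0 t)); last by rewrite lee_fin exprn_ge0// sqrtr_ge0.
rewrite [RHS]integral_mkcond; apply: eq_integral => t _; rewrite patchE; case: ifPn; rewrite ?notin_setE ?inE/=.
  move=> t0; have s0 : 0 <= Num.sqrt (2 * t) by exact: sqrtr_ge0.
  rewrite (integral_pospow k s0)/=.
    rewrite -!EFinM; congr (_%:E); rewrite (E _ t0) -sqrt_powR ?ltW// sqrtrM// exprMn; ring.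
  move=> r r0 /=; rewrite ler_pdivrMr// [t * 2]mulrC.
  have -> // : (r <= Num.sqrt (2 * t)) = (r ^+ 2 <= 2 * t).
  by rewrite -[in LHS](ger0_norm r0) -sqrtr_sqr ler_psqrt ?nnegrE ?sqr_ge0 ?mulr_ge0// ltW.
move=> /negP; rewrite -leNgt le_eqVlt => /predU1P[->|t0].
  rewrite (integral_pospow k (lexx 0))/= ?expr0n ?mule0// => r r0.
  rewrite ler_pdivrMr// mul0r; split => [r2|r2]; last by rewrite (le_anti (introT andP (conj r2 r0))) expr0n.
  by rewrite -[leLHS]ger0_norm// -sqrtr_sqr (le_anti (introT andP (conj r2 (sqr_ge0 r)))) sqrtr0.
rewrite (_ : [set r | _] = set0) ?integral_set0 ?mule0//.
rewrite -subset0 => r /= h; have := sqr_ge0 r; move: h; rewrite ler_pdivrMr//; lra.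
Qed.

Lemma Jm_Gamma k : Jm R k.+1 = Num.sqrt 2 ^+ k * Gamma (k.+2%:R / 2).
Proof.
case: k => [|k].
  rewrite Jm1 expr0 mul1r /Gamma divff// subrr.
  under eq_integral do rewrite powRr0 mul1r.
  rewrite (_ : [set t : R | 0 < t] = `]0%R, +oo[%classic); last first.
    by apply/seteqP; split => t /=; rewrite in_itv/= andbT.
  by rewrite integral_itv_obnd_cbnd ?integral_tail_exp ?oppr0 ?expR0//;
    apply: measurable_funTS; apply: measurableT_comp => //; apply: measurableT_comp => //; exact: measurable_expR.
rewrite /Gamma; set G := (X in fine X).
have G0 : (0 <= G)%E by apply: integral_ge0 => t _; rewrite lee_fin mulr_ge0 ?powR_ge0 ?expR_ge0.
have JG : Jint R k.+2 = ((Num.sqrt 2 ^+ k.+1)%:E * G)%E by exact: Jint_Gamma.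
rewrite /Jm JG; have s2 : 0 < Num.sqrt (2 : R) ^+ k.+1 by rewrite exprn_gt0// sqrtr_gt0.
have : G \is a fin_num.
  rewrite ge0_fin_numE// ltNge; apply/negP; rewrite leye_eq => /eqP Gy.
  by have := Jint_fin R k.+2; rewrite JG Gy gt0_muley ?lte_fin.
by move=> Gf; rewrite fineM.
Qed.

Lemma Jm_gt0 k : 0 < Jm R k.+1.
Proof.
have gt0 : 0 < Jm R 0.
  have : (\int[mu]_(r in `[0%R, 1%R]) (expR (- (1 / 2)))%:E <= Jint R 0)%E.
    rewrite /Jint; apply: (@le_trans _ _ (\int[mu]_(r in `[0%R, 1%R]) (r ^+ 0 * g1 r)%:E)%E).
      apply: ge0_le_integral => //.
      - apply: measurable_funTS; apply: measurableT_comp => //.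
        by apply: measurable_funM => //; exact: measurable_g1.
      move=> r; rewrite /= in_itv/= => /andP[r0 r1]; rewrite expr0 !mul1r lee_fin /g1 ler_expR lerN2.
      by rewrite ler_pdivrMr// mulVf// expr_le1.
    apply: ge0_subset_integral => //.
    - apply: measurable_funTS; apply: measurableT_comp => //.
      by apply: measurable_funM => //; exact: measurable_g1.
    - by move=> r _; rewrite lee_fin mul1r g1_ge0.
    - by move=> r /=; rewrite !in_itv/= => /andP[->].
  rewrite integral_cst//= lebesgue_measure_itv/= lte_fin ltr01 -EFinB subr0 mule1 JintE lee_fin.
  by apply: lt_le_trans; exact: expR_gt0.
have : 0 < Jm R k /\ 0 < Jm R k.+1.
  elim: k => [|k [IH1 IH2]]; first by rewrite Jm1; split.
  by split => //; rewrite Jm_rec mulr_gt0.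
by case.
Qed.

End gamma_moments.

(** * Gaussian integrals in space *)

Section gauss_space.
Variable R : realType.
Local Notation RR := (measurableTypeR R).
Local Notation mu := (@lebesgue_measure R).
Implicit Types a b c r s x y z : R.

Lemma vintZ n (k : \bar R) (f : 'rV[R]_n -> \bar R) : vmeas f -> (forall v, 0 <= f v)%E ->
  (0 <= k)%E -> (vint (fun v => k * f v) = k * vint f)%E.
Proof. by move=> mf f0 k0; rewrite /vint ge0_integralZl. Qed.

Lemma vintD n (f g : 'rV[R]_n -> \bar R) : vmeas f -> vmeas g -> (forall v, 0 <= f v)%E ->
  (forall v, 0 <= g v)%E -> (vint (fun v => f v + g v) = vint f + vint g)%E.
Proof. by move=> mf mg f0 g0; rewrite /vint ge0_integralD. Qed.

Lemma le_vint n (f g : 'rV[R]_n -> \bar R) : vmeas f -> vmeas g -> (forall v, 0 <= f v)%E ->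
  (forall v, f v <= g v)%E -> (vint f <= vint g)%E.
Proof.
move=> mf mg f0 fg; apply: ge0_le_integral => //.
Qed.

Lemma vint_ge0 n (f : 'rV[R]_n -> \bar R) : (forall v, 0 <= f v)%E -> (0 <= vint f)%E.
Proof. by move=> f0; apply: integral_ge0. Qed.

Lemma vmeasE n (f : 'rV[R]_n -> R) : vmeas (f : _ -> RR) -> vmeas (fun v => (f v)%:E).
Proof. by move=> mf; apply: measurableT_comp. Qed.

Lemma vmeas_consv_pair n d (U : measurableType d) (f : 'rV[R]_n.+1 -> U) : vmeas f ->
  measurable_fun setT (fun p : RR * n.-tuple RR => f (consv p.1 (rowt p.2))).
Proof.
move=> mf; rewrite (_ : (fun p => _) = (fun t => f (rowt t)) \o @cons_tuple R n).
  by apply: measurableT_comp => //; exact: measurable_cons_tuple.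
by apply/funext => -[x t] /=; rewrite rowt_cons.
Qed.

Lemma measurable_vint_cons n (f : 'rV[R]_n.+1 -> \bar R) : vmeas f -> (forall v, 0 <= f v)%E ->
  measurable_fun setT (fun x : RR => vint (fun v => f (consv x v))).
Proof.
move=> mf f0; have := measurable_fun_fubini_tonelli_F (m2 := leb R n) _ (vmeas_consv_pair mf).
by apply => p; exact: f0.
Qed.

Lemma vmap_cst n m (k : 'rV[R]_m) : vmap (fun _ : 'rV[R]_n => k).
Proof. by move=> i; exact: measurable_cst. Qed.

Lemma vmap_id n : vmap (@id 'rV[R]_n).
Proof. by move=> i; exact: vmeas_coord. Qed.

Lemma vmapD n m (S T : 'rV[R]_n -> 'rV[R]_m) : vmap S -> vmap T -> vmap (fun v => S v + T v).
Proof.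
move=> mS mT i; rewrite (_ : (fun v => _) = (fun v => S v ord0 i + T v ord0 i)).
  exact: (measurable_funD (mS i) (mT i)).
by apply/funext => v; rewrite mxE.
Qed.

Lemma vmapZ n m c (S : 'rV[R]_n -> 'rV[R]_m) : vmap S -> vmap (fun v => c *: S v).
Proof.
move=> mS i; rewrite (_ : (fun v => _) = (fun v => c * S v ord0 i)).
  by apply: measurable_funM => //; exact: mS.
by apply/funext => v; rewrite mxE.
Qed.

Lemma vmeas_dotv n m (S T : 'rV[R]_n -> 'rV[R]_m) : vmap S -> vmap T ->
  vmeas (fun v => dotv (S v) (T v) : RR).
Proof.
move=> mS mT; rewrite /vmeas /dotv; apply: measurable_sum => i.
by apply: measurable_funM; [exact: mS|exact: mT].
Qed.

Lemma vmeas_enorm n m (S : 'rV[R]_n -> 'rV[R]_m) : vmap S -> vmeas (fun v => enorm (S v) : RR).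
Proof.
move=> mS; apply: (measurableT_comp (f := Num.sqrt : RR -> RR)); last exact: vmeas_dotv.
exact: (continuous_measurable_fun (@sqrt_continuous R)).
Qed.

Lemma mpres_translate n (k : 'rV[R]_n) : mpres (fun v => v + k).
Proof.
elim: n k => [|n IH] k.
  rewrite (_ : (fun v => _) = id); first exact: mpres_id.
  by apply/funext => v; apply/rowP; case.
have h1 := mpres_lift (IH (tlv k)).
have := @mpres_head R n 1 (fun v => hdv k) (normr1 _) (@measurable_cst _ _ _ _ _ _).
move=> /(mpres_comp h1); rewrite (_ : _ \o _ = (fun v => v + k))//.
apply/funext => v /=; rewrite hd_consv tl_consv mul1r -[in RHS](consv_eta v) -[in RHS](consv_eta k).
by rewrite consvD.
Qed.

Lemma vint_scale n r (f : 'rV[R]_n -> \bar R) : 0 < r -> vmeas f -> (forall v, 0 <= f v)%E ->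
  (vint f = (r ^+ n)%:E * vint (fun v => f (r *: v)))%E.
Proof.
move=> r0; elim: n f => [|n IH] f mf f0.
  rewrite vint0// vint0//; first by rewrite mul1e scaler0.
  exact: (vmeas_comp (vmapZ r (@vmap_id 0)) mf).
have mfr : vmeas (fun v => f (r *: v)) by exact: (vmeas_comp (vmapZ r (@vmap_id _)) mf).
have mfx x : vmeas (fun v => f (consv x v)).
  by apply: (vmeas_comp _ mf); apply: vmap_consv; [exact: measurable_cst|exact: vmap_id].
rewrite vint_cons// (integral_affine 0 (lt0r_neq0 r0) (measurable_vint_cons mf f0)
  (fun x => vint_ge0 (fun v => f0 _))).
rewrite vint_cons// gtr0_norm//.
rewrite exprS EFinM -muleA; congr (_ * _)%E.
rewrite -(ge0_integralZl mu measurableT (measurable_vint_cons mfr (fun v => f0 _))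
  (fun x _ => vint_ge0 (fun v => f0 _))); last by rewrite lee_fin exprn_ge0// ltW.
apply: eq_integral => x _; rewrite /affine addr0 IH//.
by congr (_ * _)%E; apply: eq_vint => v; rewrite consvZ.
Qed.

Definition gs n (v : 'rV[R]_n) : R := expR (- (dotv v v / 2)).

Lemma gs_ge0 n (v : 'rV[R]_n) : 0 <= gs v. Proof. exact: expR_ge0. Qed.

Lemma gs_enorm n (v : 'rV[R]_n) : gs v = g1 (enorm v).
Proof. by rewrite /g1 sqr_enorm. Qed.

Lemma gs_consv n x (v : 'rV[R]_n) : gs (consv x v) = g1 x * gs v.
Proof. by rewrite /gs /g1 -expRD dotv_consv; congr expR; field. Qed.

Lemma vmeas_gs n : vmeas (@gs n : _ -> RR).
Proof.
have h : measurable_fun setT (fun t : n.-tuple RR => dotv (rowt t) (rowt t) : RR).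
  exact: (vmeas_dotv (@vmap_id n) (@vmap_id n)).
have h2 : measurable_fun setT (fun t : n.-tuple RR => - (dotv (rowt t) (rowt t) / 2) : RR).
  by apply: measurable_funN; apply: measurable_funM.
exact: (measurableT_comp (@measurable_expR R) h2).
Qed.

Definition c2pi : R := Num.sqrt (pi *+ 2).

Lemma c2pi_gt0 : 0 < c2pi.
Proof. by rewrite sqrtr_gt0 mulrn_wgt0// pi_gt0. Qed.

Lemma vint_prod n (f : R -> R) : measurable_fun setT (f : RR -> RR) -> (forall x, 0 <= f x) ->
  (vint (fun v : 'rV[R]_n.+1 => (f (hdv v) * gs (tlv v))%:E) =
    \int[mu]_x (f x)%:E * vint (fun v : 'rV[R]_n => (gs v)%:E))%E.
Proof.
move=> mf f0; have mg := vmeasE (@vmeas_gs n).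
rewrite vint_cons; first last.
- by move=> v; rewrite lee_fin mulr_ge0 ?gs_ge0.
- have h1 : measurable_fun setT (fun t : n.+1.-tuple RR => f (hdv (rowt t)) : RR).
    exact: (measurableT_comp mf (@vmeas_hdv R n)).
  have h2 : measurable_fun setT (fun t : n.+1.-tuple RR => gs (tlv (rowt t)) : RR).
    exact: (vmeas_comp (@vmap_tlv R n) (@vmeas_gs n)).
  exact: (vmeasE (f := fun v => f (hdv v) * gs (tlv v)) (measurable_funM h1 h2)).
have g0 : (0 <= vint (fun v : 'rV[R]_n => (gs v)%:E))%E.
  by apply: vint_ge0 => v; rewrite lee_fin gs_ge0.
have mfE : measurable_fun setT (fun x : RR => (f x)%:E) by exact: measurableT_comp.
rewrite -(ge0_integralZr mu measurableT mfE _ g0); last by move=> x _; rewrite lee_fin.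
apply: eq_integral => x _; rewrite -vintZ//; [|by move=> v; rewrite lee_fin gs_ge0|by rewrite lee_fin].
by apply: eq_vint => v; rewrite hd_consv tl_consv EFinM.
Qed.

Lemma vint_gs n : vint (fun v : 'rV[R]_n => (gs v)%:E) = (c2pi ^+ n)%:E.
Proof.
elim: n => [|n IH].
  rewrite vint0; last by move=> v; rewrite lee_fin gs_ge0.
    by rewrite /gs dot0v mul0r oppr0 expR0 expr0.
  exact: (vmeasE (@vmeas_gs 0)).
rewrite -[X in vint X](_ : (fun v => (g1 (hdv v) * gs (tlv v))%:E) = _); last first.
  by apply/funext => v; rewrite -gs_consv consv_eta.
by rewrite vint_prod ?IH ?integral_g1 ?exprS ?EFinM//; [exact: measurable_g1|exact: g1_ge0].
Qed.

Lemma integral_abs_g1 : (\int[mu]_x (`|x| * g1 x)%:E = 2%:E)%E.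
Proof.
rewrite ge0_symfun_integralT.
- rewrite (_ : [set x | _] = `[0%R, +oo[%classic); last first.
    by apply/seteqP; split => x /=; rewrite in_itv/= andbT.
  under eq_integral => x.
    rewrite inE/= in_itv/= andbT => x0; rewrite ger0_norm//; over.
  by rewrite integral_tail_g1// /g1 expr0n mul0r oppr0 expR0 mule1.
- by move=> x; rewrite mulr_ge0 ?g1_ge0.
- by move=> x; apply: cvgM; [exact: norm_continuous|exact: continuous_g1].
- by move=> x /=; rewrite normrN /g1 sqrrN.
Qed.

(** With [k] rotated to the first axis, the integral is [enorm k] times the one-dimensional integral
    2 of [|x| * g1 x], times the Gaussian mass of the other [n] coordinates. *)
Lemma vint_abs_dotv n (k : 'rV[R]_n.+1) :
  vint (fun v => (`|dotv k v| * gs v)%:E) = (2 * c2pi ^+ n * enorm k)%:E.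
Proof.
have mabs (l : 'rV[R]_n.+1) : vmeas (fun v => (`|dotv l v| * gs v)%:E).
  have h : measurable_fun setT (fun t : n.+1.-tuple RR => `|dotv l (rowt t)| : RR).
    apply: measurableT_comp => //; exact: (vmeas_dotv (vmap_cst l) (@vmap_id _)).
  exact: (vmeasE (f := fun v => `|dotv l v| * gs v) (measurable_funM h (@vmeas_gs _))).
have [T [_ [rT _ Tk _]]] := rotv_e0 k; have [_ dT [_ pT]] := rT.
transitivity (vint (fun v => (`|dotv (T k) v| * gs v)%:E)).
  rewrite -[RHS]pT//; last by move=> v; rewrite lee_fin mulr_ge0 ?gs_ge0.
  by apply: eq_vint => v; rewrite /gs !dT.
have -> : (fun v : 'rV_n.+1 => (`|dotv (T k) v| * gs v)%:E) =
    (fun v => ((enorm k * (`|hdv v| * g1 (hdv v))) * gs (tlv v))%:E).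
  apply/funext => v; rewrite Tk dotvZl /e0 dotvE hd_consv tl_consv dot0v addr0 mul1r.
  by rewrite normrM ger0_norm ?enorm_ge0// -[in gs v](consv_eta v) gs_consv; congr (_%:E); ring.
rewrite (@vint_prod n (fun x => enorm k * (`|x| * g1 x))); first last.
- by move=> x; rewrite !mulr_ge0 ?g1_ge0 ?enorm_ge0.
- apply: measurable_funM => //; apply: measurable_funM => //; exact: measurable_g1.
under eq_integral do rewrite EFinM.
have mabs1 : measurable_fun setT (fun x : RR => (`|x| * g1 x)%:E).
  apply: measurableT_comp => //; apply: measurable_funM => //; exact: measurable_g1.
rewrite (ge0_integralZl mu measurableT mabs1); last by rewrite lee_fin enorm_ge0.
  by rewrite integral_abs_g1 vint_gs -!EFinM; congr (_%:E); ring.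
by move=> x _; rewrite lee_fin mulr_ge0 ?g1_ge0.
Qed.

End gauss_space.

(** * Radial moments without polar coordinates *)

Section radial_moments.
Variable R : realType.
Local Notation RR := (measurableTypeR R).
Local Notation mu := (@lebesgue_measure R).
Implicit Types a b c r s : R.

Definition ball_moment n j r : \bar R :=
  vint (fun v : 'rV[R]_n => (enorm v ^+ j * (enorm v <= r)%R%:R)%:E).

Lemma measurable_natb d (T : measurableType d) (f g : T -> RR) :
  measurable_fun setT f -> measurable_fun setT g ->
  measurable_fun setT (fun x => (f x <= g x)%R%:R : RR).
Proof.
move=> mf mg; rewrite (_ : (fun x => _) = \1_[set x | f x <= g x]); last first.
  by apply/funext => z; rewrite indicE /=; congr (_%:R); congr nat_of_bool; apply/idP/idP; rewrite inE.
apply: measurable_indic; rewrite -[X in measurable X]setTI.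
exact: measurable_fun_le.
Qed.

Lemma integral_natb d (T : measurableType d) (m : {measure set T -> \bar R}) (f g : T -> R) (h : T -> R) :
  (\int[m]_(x in [set x | (f x <= g x)%R]) (h x)%:E = \int[m]_x (h x * (f x <= g x)%R%:R)%:E)%E.
Proof.
rewrite integral_mkcond; apply: eq_integral => x _; rewrite patchE.
case: ifPn => [|]; rewrite /= ?inE/= ?notin_setE/=; first by move=> ->; rewrite mulr1.
by move=> /negP/negbTE ->; rewrite mulr0.
Qed.

Lemma measurable_enormX n j : measurable_fun setT (fun t : n.-tuple RR => enorm (rowt t) ^+ j : RR).
Proof. exact: (measurableT_comp (@exprn_measurable R setT j) (vmeas_enorm (@vmap_id R n))). Qed.

Lemma measurable_ball_moment n j r :
  vmeas (fun v : 'rV[R]_n => enorm v ^+ j * (enorm v <= r)%R%:R : RR).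
Proof.
apply: measurable_funM; first exact: measurable_enormX.
by apply: measurable_natb => //; exact: (vmeas_enorm (@vmap_id R n)).
Qed.

Lemma ball_moment_scale n j r : 0 < r ->
  ball_moment n j r = ((r ^+ (n + j))%:E * ball_moment n j 1)%E.
Proof.
move=> r0; have mb := vmeasE (@measurable_ball_moment n j 1).
rewrite /ball_moment (vint_scale r0); first last.
- by move=> v; rewrite lee_fin mulr_ge0 ?exprn_ge0 ?enorm_ge0// ler0n.
- exact: (vmeasE (@measurable_ball_moment n j r)).
rewrite exprD EFinM -muleA; congr (_ * _)%E; rewrite -vintZ//; first last.
- by rewrite lee_fin exprn_ge0// ltW.
- by move=> v; rewrite lee_fin mulr_ge0 ?exprn_ge0 ?enorm_ge0// ler0n.
apply: eq_vint => v; rewrite -EFinM; congr (_%:E).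
by rewrite enormZ gtr0_norm// exprMn -mulrA -ler_pdivlMl// mulVf ?gt_eqF.
Qed.

Lemma ball_moment_ge0 n j r : (0 <= ball_moment n j r)%E.
Proof. by apply: vint_ge0 => v; rewrite lee_fin mulr_ge0 ?exprn_ge0 ?enorm_ge0// ler0n. Qed.

(** The layer cake formula in the radius: by homogeneity the moment of the ball of radius [r] is
    [r ^+ (n + j)] times that of the unit ball, which leaves a moment of [rg1]. *)
Lemma vint_enormX_gs n j : vint (fun v : 'rV[R]_n => (enorm v ^+ j * gs v)%:E) =
  (ball_moment n j 1 * Jint R (n + j).+1)%E.
Proof.
have me := vmeas_enorm (@vmap_id R n).
transitivity (\int[leb R n]_t ((enorm (rowt t) ^+ j)%:E *
    \int[mu]_(r in `[enorm (rowt t), +oo[) (rg1 r)%:E))%E.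
  by apply: eq_integral => t _; rewrite EFinM gs_enorm integral_tail_rg1 ?enorm_ge0.
rewrite (layer_cake (leb R n) (@measurable_enormX n j) me (@measurable_rg1 R) _ (@rg1_ge0 R)); last first.
  by move=> t; rewrite exprn_ge0// enorm_ge0.
rewrite /Jint -ge0_integralZl//; first last.
- exact: ball_moment_ge0.
- by move=> r; rewrite /= in_itv/= andbT => r0; rewrite lee_fin mulr_ge0 ?g1_ge0// exprn_ge0.
- apply: measurable_funTS; apply: measurableT_comp => //; apply: measurable_funM; last exact: measurable_g1.
  exact: exprn_measurable.
rewrite [RHS]integral_mkcond; apply: eq_integral => r _.
rewrite patchE mem_setE in_itv/= andbT; case: ifPn => r0; last first.
  by rewrite rg1_neg ?mul0e// ltW// ltNge.
move: r0; rewrite le_eqVlt => /predU1P[<-|r0].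
  by rewrite rg1_neg// mul0e expr0n mul0r mule0.
rewrite integral_natb -/(vint (fun v : 'rV[R]_n => (enorm v ^+ j * (enorm v <= r)%R%:R)%:E)).
rewrite -/(ball_moment n j r) (ball_moment_scale n j r0) muleA [RHS]muleC -EFinM; congr (_%:E * _)%E.
by rewrite rg1_pos ?ltW// mulrAC -exprS.
Qed.

Lemma integral_unit_tail (x : R) : 0 <= x ->
  (\int[mu]_(r in `[x, +oo[) (((0 < r)%R && (r <= 1)%R)%:R)%:E = (Num.max (1 - x) 0)%:E)%E.
Proof.
move=> x0; transitivity (\int[mu]_(r in `[x, +oo[) (\1_`]0%R, 1%R]%classic r)%:E)%E.
  by apply: eq_integral => r _; rewrite indicE mem_setE in_itv.
rewrite integral_indic//; have [x1|x1] := ltP x 1; last first.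
  have -> : Num.max (1 - x) 0 = 0 by apply/max_idPr; rewrite subr_le0.
  apply/eqP; rewrite eq_le measure_ge0 andbT.
  apply: (@le_trans _ _ (mu [set 1%R])); last by rewrite lebesgue_measure_set1.
  apply: le_measure; rewrite ?inE//.
    exact: measurableI.
  move=> r [/=]; rewrite !in_itv/= andbT => /andP[_ r1] xr.
  by apply/eqP; rewrite eq_le r1 (le_trans x1 xr).
have -> : Num.max (1 - x) 0 = 1 - x by apply/max_idPl; rewrite subr_ge0 ltW.
have [->|xp] := eqVneq x 0.
  rewrite (_ : _ `&` _ = `]0%R, 1%R]%classic); last first.
    apply/seteqP; split => r /=; first by case.
    by rewrite !in_itv/= andbT => /andP[h1 h2]; rewrite h1 h2 ltW.
  by rewrite [LHS]lebesgue_measure_itv/= lte_fin ltr01 -EFinB.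
rewrite (_ : _ `&` _ = `[x, 1%R]%classic); last first.
  apply/seteqP; split => r /=; rewrite !in_itv/= ?andbT; first by move=> [/andP[_ ->] ->].
  by move=> /andP[h1 h2]; rewrite h1 h2 andbT; split => //; apply: lt_le_trans h1; rewrite lt_neqAle eq_sym xp.
by rewrite [LHS]lebesgue_measure_itv/= lte_fin x1 -EFinB.
Qed.

(** The volume of the ball of radius [r], integrated over [0 < r <= 1], is on the one hand the
    integral of [1 - |v|] over the unit ball, on the other hand, by homogeneity, the volume of the
    unit ball divided by [n + 1]. *)
Lemma ball_moment01 n :
  (ball_moment n 0 1 = ball_moment n 1 1 + (n.+1%:R^-1)%:E * ball_moment n 0 1)%E.
Proof.
(* The radius 0 is left out because [ball_moment_scale] asks for a positive factor. *)
pose w r : R := ((0 < r)%R && (r <= 1)%R)%:R.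
have mw : measurable_fun setT (w : RR -> RR).
  rewrite (_ : w = \1_`]0%R, 1%R]%classic); first exact: measurable_indic.
  by apply/funext => r; rewrite indicE mem_setE in_itv.
have w0 r : 0 <= w r by rewrite ler0n.
have me := vmeas_enorm (@vmap_id R n).
have mm : vmeas (fun v : 'rV[R]_n => Num.max (1 - enorm v) 0 : RR).
  by apply: measurable_maxr => //; exact: measurable_funB.
have -> : ((n.+1%:R^-1)%:E * ball_moment n 0 1 = vint (fun v : 'rV[R]_n => (Num.max (1 - enorm v) 0)%:E))%E.
  transitivity (\int[leb R n]_t (1%:E * \int[mu]_(r in `[enorm (rowt t), +oo[) (w r)%:E))%E; last first.
    by apply: eq_integral => t _; rewrite mul1e integral_unit_tail// enorm_ge0.
  rewrite (layer_cake (leb R n) _ me mw)//.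
  transitivity (\int[mu]_r (ball_moment n 0 1 * (r ^+ n * w r)%:E))%E; last first.
    apply: eq_integral => r _.
    rewrite integral_natb [X in _ = (_ * X)%E](_ : _ = ball_moment n 0 r)//.
    have [r0|r0] := ltP 0 r; last by rewrite /w ltNge r0/= mulr0 mule0 mul0e.
    by rewrite (ball_moment_scale n 0 r0) addn0 muleA [LHS]muleC -EFinM mulrC.
  rewrite ge0_integralZl//; first last.
  - exact: ball_moment_ge0.
  - move=> r _; rewrite /w lee_fin; have [r0|] := ltP 0 r; last by rewrite mulr0.
    by rewrite mulr_ge0// exprn_ge0// ltW.
  - apply: measurableT_comp => //; apply: measurable_funM => //; exact: exprn_measurable.
  rewrite muleC; congr (_ * _)%E.
  have cX k : continuous (fun r : R => r ^+ k) by exact: exprn_continuous.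
  have cE : n.+1%:R * cint 0 1 (fun r : R => r ^+ n) = 1.
    rewrite -cintZ//; apply: EFin_inj; rewrite -integral_cint ?integral_pow ?expr1n//.
    by move=> r; apply: cvgMr; exact: cX.
  have -> : n.+1%:R^-1 = cint 0 1 (fun r : R => r ^+ n) :> R.
    by apply: (mulfI (_ : n.+1%:R != 0)); rewrite ?cE ?mulfV// pnatr_eq0.
  rewrite -integral_cint// -integral_itv_obnd_cbnd; last first.
    by apply: measurable_funTS; apply: measurableT_comp => //; exact: exprn_measurable.
  rewrite [LHS]integral_mkcond; apply: eq_integral => r _; rewrite patchE mem_setE in_itv/= /w.
  by case: ifP => _; rewrite ?mulr1// mulr0.
rewrite /ball_moment -vintD//.
- apply: eq_vint => v; rewrite -EFinD; congr (_%:E); rewrite expr0 expr1 mul1r.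
  have [h|h] := leP (enorm v) 1; last by rewrite mulr0 add0r; apply/esym/max_idPr; rewrite subr_le0 ltW.
  by rewrite mulr1 (max_idPl _) ?subr_ge0// addrC subrK.
- exact: (vmeasE (@measurable_ball_moment n 1 1)).
- exact: (vmeasE mm).
- by move=> v; rewrite lee_fin mulr_ge0 ?exprn_ge0 ?enorm_ge0// ler0n.
- by move=> v; rewrite lee_fin le_max lexx orbT.
Qed.

(** The total Gaussian mass determines the volume of the unit ball, [ball_moment01] then gives its
    first moment, and the recursion for [Jm] turns the ratio into the stated one. *)
Lemma vint_enorm_gs n : vint (fun v : 'rV[R]_n.+2 => (enorm v * gs v)%:E) =
  (c2pi R ^+ n.+2 * Jm R n.+2 / Jm R n.+1)%:E.
Proof.
have B0E : (ball_moment n.+2 0 1 * (Jm R n.+3)%:E = (c2pi R ^+ n.+2)%:E)%E.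
  rewrite -JintE -vint_gs -[n.+3]/(n.+2.+1) -[in Jint _ _](addn0 n.+2) -vint_enormX_gs.
  by apply: eq_vint => v; rewrite expr0 mul1r.
have B1E : (vint (fun v : 'rV[R]_n.+2 => (enorm v * gs v)%:E) =
    ball_moment n.+2 1 1 * (Jm R n.+4)%:E)%E.
  rewrite -JintE -[n.+4]/(n.+3.+1) -[in Jint _ _](addn1 n.+2) -vint_enormX_gs.
  by apply: eq_vint => v; rewrite expr1.
have := ball_moment01 n.+2; rewrite B1E; move: B0E.
have := ball_moment_ge0 n.+2 0 1; have := ball_moment_ge0 n.+2 1 1.
case: (ball_moment n.+2 0 1) => [b0| |] //; last first.
  by move=> _ _; rewrite gt0_mulye// lte_fin Jm_gt0.
case: (ball_moment n.+2 1 1) => [b1| |] //.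
move=> _ _ [b0E] [b01]; rewrite -EFinM; congr (_%:E).
rewrite -b0E (Jm_rec R n.+1) (Jm_rec R n.+2).
have J1 := Jm_gt0 R n; have n3 : n.+3%:R != 0 :> R by rewrite pnatr_eq0.
have -> : b1 = b0 * (n.+2%:R / n.+3%:R).
  have -> : b1 = b0 - n.+3%:R^-1 * b0 by rewrite [X in X - _]b01 addrK.
  have -> : n.+2%:R = n.+3%:R - 1 :> R by rewrite -[n.+3]addn1 natrD addrK.
  by field.
by field; rewrite gt_eqF//= -natrD pnatr_eq0.
Qed.

End radial_moments.

(** * Finite nets of compact sets and of the sphere *)

Section nets.
Variable R : realType.
Local Notation RR := (measurableTypeR R).
Implicit Types (e r : R).

Lemma edistE n (x y : 'rV[R]_n) : edist x y = enorm (x - y).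
Proof. by congr Num.sqrt; apply: eq_bigr => i _; rewrite !mxE expr2. Qed.

Lemma enorm_le_sum n (x : 'rV[R]_n) : enorm x <= \sum_i `|x ord0 i|.
Proof.
elim: n x => [|n IH] x; first by rewrite /enorm /dotv !big_ord0 sqrtr0.
rewrite big_ord_recl; have := IH (tlv x).
under eq_bigr do rewrite mxE.
set s := \sum_(i < n) _ => h; have s0 : 0 <= s by exact: sumr_ge0.
rewrite -(ler_pXn2r (n := 2))// ?nnegrE ?enorm_ge0 ?addr_ge0// sqr_enorm dotvE.
have : dotv (tlv x) (tlv x) <= s ^+ 2.
  by rewrite -sqr_enorm ler_pXn2r ?nnegrE ?enorm_ge0.
rewrite sqrrD real_normK ?num_real// -/(hdv x) expr2 => h2.
have := mulr_ge0 (normr_ge0 (hdv x)) s0; lra.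
Qed.

Lemma ball_enorm n (x y : 'rV[R]_n) e : ball x e y -> enorm (x - y) <= n%:R * e.
Proof.
move=> -[_ xy]; apply: le_trans (enorm_le_sum _) _.
rewrite [leRHS]mulr_natl -[n in _ *+ n](card_ord n) -sumr_const; apply: ler_sum => i _.
by rewrite !mxE; exact: ltW (xy ord0 i).
Qed.

Lemma enorm_continuous n : continuous (@enorm R n.+1).
Proof.
move=> x; apply/(@cvgrPdist_le _ _ _ (nbhs x) (nbhs_filter x)) => e epos.
have d0 : 0 < e / n.+1%:R by rewrite divr_gt0.
near=> y; apply: (le_trans (ler_enorm_dist _ _)).
rewrite -[leRHS](divfK (_ : n.+1%:R != 0)) ?pnatr_eq0// mulrC; apply: ball_enorm.
by near: y; exact: nbhsx_ballx.
Unshelve. all: by end_near. Qed.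

Lemma compact_net n (K : set 'rV[R]_n.+1) e : compact K -> K !=set0 -> 0 < e ->
  exists k0 k, (forall q, q \in k0 :: k -> K q) /\
    forall y, K y -> exists2 q, q \in k0 :: k & enorm (y - q) <= e.
Proof.
rewrite compact_cover => cK [k0 Kk0] epos.
have d0 : 0 < e / n.+1%:R by rewrite divr_gt0.
have [|y Ky|D DK KD] := cK _ K (fun y => (ball y (e / n.+1%:R))^°).
- by move=> y _; exact: open_interior.
- by exists y => //; exact: nbhsx_ballx.
exists k0, (finmap.enum_fset D); split => [q|y Ky].
  by rewrite in_cons => /predU1P[->//|/DK]; rewrite inE.
have [q Dq qy] := KD y Ky; exists q; first by rewrite in_cons Dq orbT.
have /ball_enorm := interior_subset qy; rewrite enormB.
by rewrite mulrC divfK// pnatr_eq0.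
Qed.

Lemma sphere_net n e : 0 < e -> exists s : seq 'rV[R]_n.+1, (forall q, q \in s -> enorm q = 1) /\
    forall y, enorm y = 1 -> exists2 q, q \in s & enorm (y - q) <= e.
Proof.
move=> epos; have [||k0 [k [h1 h2]]] := @compact_net n [set x | enorm x = 1] e _ _ epos.
- apply: (@subclosed_compact _ _ [set v : 'rV[R]_n.+1 | forall i, `[(-1), 1]%classic (v ord0 i)]).
  + rewrite (_ : [set x | _] = @enorm R n.+1 @^-1` [set 1])//.
    apply: closed_comp; last exact: closed_eq.
    by move=> x _; exact: enorm_continuous.
  + have := @rV_compact R n.+1 (fun=> `[(-1), 1]%classic) (fun=> @segment_compact R (-1) 1).
    by rewrite /=.
  + move=> x /= x1 i; rewrite in_itv/= -ler_norml -x1.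
    rewrite -sqrtr_sqr ler_wsqrtr// /dotv (bigD1 i)//= expr2 lerDl.
    by apply: sumr_ge0 => j _; rewrite -expr2 sqr_ge0.
- by exists (e0 R n); rewrite /= /e0 /enorm dotv_consv dot0v addr0 mulr1 sqrtr1.
by exists (k0 :: k).
Qed.

End nets.

(** * Gaussian expectations of real functions *)

Section gaussian_expectation.
Variable R : realType.
Local Notation RR := (measurableTypeR R).
Local Notation mu := (@lebesgue_measure R).
Implicit Types c r : R.

(** Not normalised: the constant 1 has expectation [c2pi R ^+ n]. *)
Definition gE n (f : 'rV[R]_n -> R) : R :=
  \int[leb R n]_t (f (rowt t) * gs (rowt t)).

Definition gI n (f : 'rV[R]_n -> R) : Prop := vmeas (f : _ -> RR) /\
  (leb R n).-integrable setT (EFin \o (fun t => f (rowt t) * gs (rowt t))).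

Lemma gI_meas n (f : 'rV[R]_n -> R) : gI f -> vmeas (f : _ -> RR). Proof. by case. Qed.

Lemma gED n (f h : 'rV[R]_n -> R) : gI f -> gI h -> gE (fun v => f v + h v) = gE f + gE h.
Proof.
move=> [_ fI] [_ hI]; rewrite /gE -(RintegralD measurableT fI hI).
by congr Rintegral; apply/funext => t; rewrite mulrDl.
Qed.

Lemma gEZ n c (f : 'rV[R]_n -> R) : gI f -> gE (fun v => c * f v) = c * gE f.
Proof.
move=> [_ fI]; rewrite /gE -(RintegralZl c measurableT fI).
by congr Rintegral; apply/funext => t; rewrite mulrA.
Qed.

Lemma gI_D n (f h : 'rV[R]_n -> R) : gI f -> gI h -> gI (fun v => f v + h v).
Proof.
move=> [mf fI] [mh hI]; split; first exact: (measurable_funD mf mh).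
have := integrableD measurableT fI hI.
by congr integrable; apply/funext => t /=; rewrite -EFinD mulrDl.
Qed.

Lemma gI_Z n c (f : 'rV[R]_n -> R) : gI f -> gI (fun v => c * f v).
Proof.
move=> [mf fI]; split; first exact: (measurable_funM (@measurable_cst _ _ _ _ _ c) mf).
have := integrableZl measurableT c fI.
by congr integrable; apply/funext => t /=; rewrite -EFinM mulrA.
Qed.

Lemma le_gE n (f h : 'rV[R]_n -> R) : gI f -> gI h -> (forall v, f v <= h v) -> gE f <= gE h.
Proof.
move=> [_ fI] [_ hI] fh; apply: (le_Rintegral measurableT fI hI) => t _.
by rewrite ler_wpM2r ?gs_ge0.
Qed.

Lemma eq_gE n (f h : 'rV[R]_n -> R) : f =1 h -> gE f = gE h.
Proof. by move=> fh; congr gE; apply/funext. Qed.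

Lemma gI_dom n (f h : 'rV[R]_n -> R) : vmeas (f : _ -> RR) -> gI h ->
  (forall v, `|f v| <= h v) -> gI f.
Proof.
move=> mf [_ hI] fh; split => //; apply: (le_integrable measurableT _ _ hI).
  by apply: measurableT_comp => //; exact: (measurable_funM mf (@vmeas_gs R n)).
move=> t _ /=; rewrite lee_fin !normrM ler_wpM2r//.
by apply: le_trans (fh _) _; exact: ler_norm.
Qed.

Lemma gE_vint n (f : 'rV[R]_n -> R) : gI f -> (gE f)%:E = vint (fun v => (f v * gs v)%:E).
Proof. by move=> [_ fI]; rewrite /gE /Rintegral fineK//; exact: integrable_fin_num. Qed.

Lemma gI_vint n (f : 'rV[R]_n -> R) : vmeas (f : _ -> RR) ->
  (vint (fun v => (`|f v| * gs v)%:E) < +oo)%E -> gI f.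
Proof.
move=> mf fy; split => //; apply/integrableP; split.
  by apply: measurableT_comp => //; exact: (measurable_funM mf (@vmeas_gs R n)).
move: fy; rewrite /vint; under eq_integral do rewrite -(ger0_norm (gs_ge0 _)) -normrM.
by [].
Qed.

Lemma gI_cst n c : gI (fun _ : 'rV[R]_n => c).
Proof.
apply: gI_vint; first exact: measurable_cst.
under eq_vint do rewrite EFinM.
rewrite vintZ; first by rewrite vint_gs -EFinM ltry.
- exact: (vmeasE (@vmeas_gs R n)).
- by move=> v; rewrite lee_fin gs_ge0.
- by rewrite lee_fin.
Qed.

Lemma gE_cst n c : gE (fun _ : 'rV[R]_n => c) = c * c2pi R ^+ n.
Proof.
have -> : gE (fun _ : 'rV[R]_n => c) = c * gE (fun _ : 'rV[R]_n => 1).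
  by rewrite -gEZ; [apply: eq_gE => v; rewrite mulr1|exact: gI_cst].
congr (_ * _); apply: EFin_inj; rewrite gE_vint -?vint_gs; last exact: gI_cst.
by apply: eq_vint => v; rewrite mul1r.
Qed.

Lemma gI_enorm n : gI (@enorm R n.+2).
Proof.
apply: gI_vint; first exact: (vmeas_enorm (@vmap_id R _)).
under eq_vint do rewrite ger0_norm ?enorm_ge0//.
by rewrite vint_enorm_gs ltry.
Qed.

Lemma gE_enorm n : gE (@enorm R n.+2) = c2pi R ^+ n.+2 * Jm R n.+2 / Jm R n.+1.
Proof. by apply: EFin_inj; rewrite gE_vint ?vint_enorm_gs//; exact: gI_enorm. Qed.

Lemma vmeas_abs_dotv n (k : 'rV[R]_n) : vmeas (fun v => `|dotv k v| : RR).
Proof.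
by apply: measurableT_comp => //; exact: (vmeas_dotv (vmap_cst k) (@vmap_id R _)).
Qed.

Lemma gI_abs_dotv n (k : 'rV[R]_n.+1) : gI (fun v => `|dotv k v|).
Proof.
apply: gI_vint; first exact: vmeas_abs_dotv.
under eq_vint do rewrite normr_id.
by rewrite vint_abs_dotv ltry.
Qed.

Lemma gE_abs_dotv n (k : 'rV[R]_n.+1) : gE (fun v => `|dotv k v|) = 2 * c2pi R ^+ n * enorm k.
Proof. by apply: EFin_inj; rewrite gE_vint ?vint_abs_dotv//; exact: gI_abs_dotv. Qed.

Lemma gI_rotv n (f : 'rV[R]_n -> R) T : rotv T -> gI f -> gI (fun v => f (T v)).
Proof.
move=> [lT dT [mT pT]] [mf fI]; apply: gI_vint; first exact: (vmeas_comp mT mf).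
have h : measurable_fun setT (fun t : n.-tuple RR => `|f (rowt t)| : RR) by apply: measurableT_comp.
have pE := pT _ (vmeasE (f := fun v => `|f v| * gs v) (measurable_funM h (@vmeas_gs R n))).
have -> : vint (fun v => (`|f (T v)| * gs v)%:E) = vint (fun v => (`|f (T v)| * gs (T v))%:E).
  by apply: eq_vint => v; rewrite /gs dT.
rewrite pE; last by move=> v; rewrite lee_fin mulr_ge0 ?gs_ge0.
move/integrableP : fI => [_]; rewrite /vint; apply: le_lt_trans; rewrite le_eqVlt; apply/orP; left.
by apply/eqP; apply: eq_integral => t _; rewrite /= normrM (ger0_norm (gs_ge0 _)).
Qed.

(** Since [mpres] concerns nonnegative functions, [f] is written as [(f + |f|) - |f|]. *)
Lemma gE_rotv n (f : 'rV[R]_n -> R) T : rotv T -> gI f -> gE (fun v => f (T v)) = gE f.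
Proof.
move=> rT fI; have [lT dT [mT pT]] := rT.
have pos (h : 'rV[R]_n -> R) : gI h -> (forall v, 0 <= h v) -> gE (fun v => h (T v)) = gE h.
  move=> hI h0; apply: EFin_inj; rewrite !gE_vint//; last exact: gI_rotv.
  rewrite -[RHS]pT; first by apply: eq_vint => v; rewrite /gs dT.
    exact: (vmeasE (f := fun v => h v * gs v) (measurable_funM (gI_meas hI) (@vmeas_gs R n))).
  by move=> v; rewrite lee_fin mulr_ge0 ?gs_ge0.
have mf := gI_meas fI.
have absI : gI (fun v => `|f v|).
  case: fI => _ fI; apply: gI_vint; first exact: measurableT_comp.
  move/integrableP : fI => [_]; rewrite /vint; apply: le_lt_trans; rewrite le_eqVlt; apply/orP; left.
  by apply/eqP; apply: eq_integral => t _; rewrite /= normr_id normrM (ger0_norm (gs_ge0 _)).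
have sI := gI_D fI absI; have nI := gI_Z (-1) absI.
have fE v : f v = (f v + `|f v|) + -1 * `|f v| by rewrite mulN1r addrK.
transitivity (gE (fun v => (f (T v) + `|f (T v)|) + -1 * `|f (T v)|)); first by apply: eq_gE => v.
rewrite gED; [|exact: (gI_rotv rT sI)|exact: (gI_rotv rT nI)].
rewrite gEZ; last exact: (gI_rotv rT absI).
rewrite (pos _ sI); last by move=> v; have := ler_norm (- f v); rewrite normrN; lra.
rewrite (pos _ absI)//.
by rewrite -gEZ// -gED//; apply: eq_gE => v.
Qed.

End gaussian_expectation.

(** * The Steiner polynomial under a Gaussian integral *)

Section steiner.
Variable R : realType.
Local Notation RR := (measurableTypeR R).
Local Notation mu := (@lebesgue_measure R).
Implicit Types c r s : R.

Lemma rV_nth_cons n x (l : seq R) :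
  \row_(i < n.+1) nth 0 (x :: l) i = consv x (\row_(i < n) nth 0 l i).
Proof.
apply/rowP => i; rewrite mxE; case: (unliftP ord0 i) => [j ->|->]; first by rewrite consv_lift mxE.
by rewrite -/(hdv _) hd_consv.
Qed.

Lemma iter_int_vint n (f : 'rV[R]_n -> \bar R) : vmeas f -> (forall v, 0 <= f v)%E ->
  iter_int n (fun l => f (\row_(i < n) nth 0 l i)) = vint f.
Proof.
elim: n f => [|n IH] f mf f0.
  by rewrite vint0//=; congr f; apply/rowP; case.
rewrite vint_cons//=; apply: eq_integral => x _.
transitivity (iter_int n (fun l => f (consv x (\row_(i < n) nth 0 l i)))).
  by congr iter_int; apply/funext => l; rewrite rV_nth_cons.
rewrite (IH (fun v => f (consv x v)))//.
by apply: (vmeas_comp _ mf); apply: vmap_consv; [exact: measurable_cst|exact: vmap_id].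
Qed.

Section dist.
Variables (n : nat) (K : set 'rV[R]_n.+1).
Hypotheses (cK : compact K) (K0 : K !=set0).

Let edist_set x := [set edist y x | y in K].

Let lb0 x : lbound (edist_set x) 0.
Proof. by move=> _ [y _ <-]; rewrite edistE enorm_ge0. Qed.

Let nonempty_set x : edist_set x !=set0.
Proof. by case: K0 => y Ky; exists (edist y x), y. Qed.

Lemma dist_set_le x y : K y -> dist_set K x <= enorm (y - x).
Proof.
move=> Ky; apply: ge_inf; first by exists 0; exact: lb0.
by exists y => //; rewrite edistE.
Qed.

Lemma dist_set_ge x r : (forall y, K y -> r <= enorm (y - x)) -> r <= dist_set K x.
Proof.
move=> h; apply: lb_le_inf; first exact: nonempty_set.
by move=> _ [y Ky <-]; rewrite edistE; exact: h.
Qed.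

Lemma dist_set_ge0 x : 0 <= dist_set K x.
Proof. by apply: dist_set_ge => y _; exact: enorm_ge0. Qed.

Lemma vmeas_maxs (T : eqType) (x0 : T) l (f : T -> 'rV[R]_n.+1 -> R) :
  (forall x, vmeas (f x : _ -> RR)) -> vmeas (fun v => maxs x0 l (fun x => f x v) : RR).
Proof.
move=> mf; elim: l => [|x l IH].
  by under [X in vmeas X]funext do rewrite maxs_nil; exact: mf.
rewrite (_ : (fun v => _) = (fun v => Num.max (f x v) (maxs x0 l (f^~ v)))).
  by apply: measurable_maxr => //; exact: mf.
by apply/funext => v; rewrite maxs_head.
Qed.

(** A pointwise limit of the distances to finite nets of [K] of mesh [1 / (m + 1)], each a minimum
    of finitely many measurable functions. *)
Lemma vmeas_dist_set : vmeas (dist_set K : _ -> RR).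
Proof.
have net m : exists k : 'rV[R]_n.+1 * seq 'rV[R]_n.+1, (forall q, q \in k.1 :: k.2 -> K q) /\
    forall y, K y -> exists2 q, q \in k.1 :: k.2 & enorm (y - q) <= m.+1%:R^-1.
  have m0 : 0 < m.+1%:R^-1 :> R by rewrite invr_gt0.
  by have [k0 [k hk]] := compact_net cK K0 m0; exists (k0, k).
have [k hk] := choice net.
pose h m v := - maxs (k m).1 (k m).2 (fun q => - enorm (q - v)).
have mh m : vmeas (h m : _ -> RR).
  have mq (q : 'rV[R]_n.+1) : vmeas (fun v => - enorm (q - v) : RR).
    have := vmapD (vmap_cst q) (vmapZ (-1) (@vmap_id R n.+1)).
    move=> /vmeas_enorm mqv; apply: measurable_funN; move: mqv; congr measurable_fun.
    by apply/funext => t; rewrite scaleN1r.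
  exact: (measurable_funN (vmeas_maxs (k m).1 (k m).2 mq)).
apply: (measurable_fun_cvg mh) => t _; set v := rowt t.
apply/cvgrPdist_le => e e0.
near=> m; have [hK hnet] := hk m.
have dh : dist_set K v <= h m v.
  rewrite /h lerNr; apply: maxs_le => q qk; rewrite lerN2; apply: dist_set_le; exact: hK.
have hd : h m v <= dist_set K v + m.+1%:R^-1.
  rewrite -lerBlDr; apply: dist_set_ge => y Ky; have [q qk yq] := hnet y Ky.
  rewrite lerBlDr; apply: (@le_trans _ _ (enorm (q - v))).
    by rewrite /h lerNl; exact: (maxs_ge (fun q => - enorm (q - v)) qk).
  have -> : q - v = (q - y) + (y - v) by rewrite addrA subrK.
  apply: le_trans (enormD _ _) _.
  by rewrite [leRHS]addrC lerD2r enormB.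
rewrite ler0_norm ?subr_le0// opprB lerBlDl (le_trans hd)// lerD2l.
by apply: ltW; near: m; exact: (near_infty_natSinv_lt (PosNum e0)).
Unshelve. all: by end_near. Qed.

Variables (W : 'I_n.+2 -> R).
Hypothesis hW : quermass K W.

Lemma vol_parallel r : 0 <= r ->
  vint (fun v => (((dist_set K v <= r)%R)%:R)%:E) =
    (\sum_(k < n.+2) 'C(n.+1, k)%:R * W k * r ^+ k)%:E.
Proof.
move=> r0; rewrite -hW// /vol.
have m1 : vmeas (fun v => (dist_set K v <= r)%R%:R : RR).
  by apply: measurable_natb => //; exact: vmeas_dist_set.
rewrite -(iter_int_vint (vmeasE m1)); last by move=> v; rewrite lee_fin ler0n.
congr iter_int; apply/funext => l; congr (_%:E); rewrite indicE; congr (_%:R); congr nat_of_bool.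
by apply/idP/idP; rewrite inE.
Qed.

Lemma integral_sum_Jint m (a : 'I_m -> R) :
  (\int[mu]_(r in `[0%R, +oo[) (\sum_(k < m) a k * (r ^+ k.+1 * g1 r))%:E =
   (\sum_(k < m) a k * Jm R k.+1)%:E)%E.
Proof.
have I k : mu.-integrable `[0%R, +oo[ (fun r => (r ^+ k * g1 r)%:E).
  apply/integrableP; split.
    apply: measurable_funTS; apply: measurableT_comp => //; apply: measurable_funM; last exact: measurable_g1.
    exact: exprn_measurable.
  apply: le_lt_trans (Jint_fin R k); rewrite le_eqVlt; apply/orP; left; apply/eqP.
  apply: eq_integral => r; rewrite inE/= in_itv/= andbT => r0.
  by rewrite ger0_norm// mulr_ge0 ?g1_ge0// exprn_ge0.
under eq_integral do rewrite -sumEFin.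
rewrite integral_sum//.
  rewrite -sumEFin; apply: eq_bigr => k _; under eq_integral do rewrite EFinM.
  by rewrite integralZl// EFinM -JintE.
by move=> k; exact: (integrableZl _ (a k) (I k.+1)).
Qed.

(** For [s > 0], the distance from [v] to the shrunken body [K / s]. *)
Definition dists s (v : 'rV[R]_n.+1) := dist_set K (s *: v) / s.

(** As [g1] is the tail integral of [rg1], the layer cake formula leads to the volumes of the
    parallel bodies of radius [s * r], rescaled by [s ^+ n.+1]; the Steiner polynomial is then
    integrated term by term. *)
Lemma vint_dists s : 0 < s -> vint (fun v => (g1 (dists s v))%:E) =
  (\sum_(k < n.+2) ('C(n.+1, k)%:R * W k * s ^+ k / s ^+ n.+1) * Jm R k.+1)%:E.
Proof.
move=> s0; have md : vmeas (dists s : _ -> RR).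
  apply: measurable_funM => //.
  exact: (vmeas_comp (vmapZ s (@vmap_id R _)) vmeas_dist_set).
have d0 v : 0 <= dists s v by rewrite divr_ge0 ?dist_set_ge0// ltW.
transitivity (\int[leb R n.+1]_t (1%:E * \int[mu]_(r in `[dists s (rowt t), +oo[) (rg1 r)%:E))%E.
  by apply: eq_integral => t _; rewrite mul1e integral_tail_rg1.
rewrite (layer_cake (leb R n.+1) _ md (@measurable_rg1 R) _ (@rg1_ge0 R))//.
rewrite -integral_sum_Jint [RHS]integral_mkcond; apply: eq_integral => r _.
rewrite patchE mem_setE in_itv/= andbT; case: ifPn => r0; last first.
  by rewrite rg1_neg ?mul0e// ltW// ltNge.
rewrite integral_natb; under [in LHS]eq_integral do rewrite mul1r.
rewrite -/(vint (fun v => ((dists s v <= r)%R%:R)%:E)).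
have sn0 : s ^+ n.+1 != 0 by rewrite expf_neq0 ?gt_eqF.
have -> : vint (fun v => ((dists s v <= r)%R%:R)%:E) =
    ((\sum_(k < n.+2) 'C(n.+1, k)%:R * W k * (s * r) ^+ k) / s ^+ n.+1)%:E.
  have := vol_parallel (mulr_ge0 (ltW s0) r0); rewrite (vint_scale s0); first last.
  - by move=> v; rewrite lee_fin ler0n.
  - apply: vmeasE; apply: measurable_natb => //; exact: vmeas_dist_set.
  have -> : vint (fun v => ((dist_set K (s *: v) <= s * r)%R%:R)%:E) =
      vint (fun v => ((dists s v <= r)%R%:R)%:E).
    by apply: eq_vint => v; rewrite /dists ler_pdivrMr// [r * s]mulrC.
  move=> E; rewrite mulrC EFinM -E muleA -EFinM mulVf// mul1e//.
rewrite -EFinM; congr (_%:E); rewrite rg1_pos// mulr_suml mulr_sumr; apply: eq_bigr => k _.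
by rewrite exprMn [r ^+ _.+1]exprS; ring.
Qed.

End dist.
End steiner.

(** * Comparison of first-order coefficients *)

Section first_order.
Variable R : realType.
Local Notation RR := (measurableTypeR R).
Implicit Types a : nat -> R.

Lemma le0_small (x B : R) : (forall t, 0 < t -> t <= 1 -> x <= B * t) -> x <= 0.
Proof.
move=> h; rewrite leNgt; apply/negP => x0.
have B1 : 0 < `|B| + 1 by rewrite ltr_wpDl.
have q0 : 0 < x / (2 * (`|B| + 1)) by rewrite divr_gt0// mulr_gt0.
have t0 : 0 < Num.min 1 (x / (2 * (`|B| + 1))) by rewrite lt_min ltr01.
have := h _ t0; rewrite ge_min lexx /= => /(_ isT); apply/negP; rewrite -ltNge.
apply: (@le_lt_trans _ _ (`|B| * (x / (2 * (`|B| + 1))))).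
  apply: (@le_trans _ _ (`|B| * Num.min 1 (x / (2 * (`|B| + 1))))).
    by rewrite ler_wpM2r ?ler_norm// ltW.
  by rewrite ler_wpM2l// ge_min lexx orbT.
rewrite mulrA ltr_pdivrMr ?mulr_gt0//; have := normr_ge0 B; nra.
Qed.

(** As [t] tends to 0 the lower bound gives [c <= a 0]; this cancels the constant term of the upper
    bound, after which the terms of first order can be compared. *)
Lemma first_order_le m a (c h C : R) :
  (forall t, 0 < t -> t <= 1 -> c <= \sum_(j < m.+2) a j * t ^+ j /\
     \sum_(j < m.+2) a j * t ^+ j <= c + t * h + t ^+ 2 * C) -> a 1%N <= h.
Proof.
pose A := \sum_(j < m) `|a j.+2|.
have A0 : 0 <= A by exact: sumr_ge0.
have sE t : 0 < t -> t <= 1 ->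
    `|\sum_(j < m.+2) a j * t ^+ j - (a 0%N + a 1%N * t)| <= A * t ^+ 2.
  move=> t0 t1; rewrite !big_ord_recl /= expr0 mulr1 expr1 /bump/=.
  rewrite (_ : forall x y z : R, x + (y + z) - (x + y) = z); last by move=> x y z; ring.
  apply: le_trans (ler_norm_sum _ _ _) _; rewrite /A mulr_suml; apply: ler_sum => j _.
  rewrite normrM ler_wpM2l// normrX (gtr0_norm t0) /bump /= !add1n.
  rewrite -addn2 exprD; apply: ler_piMl; first by rewrite exprn_ge0// ltW.
  by apply: exprn_ile1 => //; exact: ltW.
move=> H; have c0 : c - a 0%N <= 0.
  apply: (le0_small (B := `|a 1%N| + A)) => t t0 t1.
  have [h1 _] := H t t0 t1; have := sE t t0 t1; rewrite ler_norml => /andP[_ h2].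
  have h3 : A * t ^+ 2 <= A * t by rewrite ler_wpM2l// expr2 ler_piMl// ltW.
  have h4 : a 1%N * t <= `|a 1%N| * t by rewrite ler_wpM2r ?ler_norm// ltW.
  by rewrite mulrDl; lra.
rewrite -subr_le0; apply: (le0_small (B := A + C)) => t t0 t1.
have [_ h1] := H t t0 t1; have := sE t t0 t1; rewrite ler_norml => /andP[h2 _].
rewrite -(ler_pM2r t0) -mulrA -expr2; nra.
Qed.

Lemma expR_le_quad (u : R) : expR u <= 1 + u + u ^+ 2 * expR `|u|.
Proof.
have [u0|u0] := leP 0 u.
  rewrite ger0_norm//; have e0 := expR_gt0 u.
  have h : expR u - 1 <= u * expR u.
    have : 1 - u <= expR (- u) by exact: expR_ge1Dx.
    by rewrite expRN -(ler_pM2r e0) mulVf ?gt_eqF// mulrBl mul1r; lra.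
  have : u * (expR u - 1) <= u * (u * expR u) by rewrite ler_wpM2l.
  by rewrite expr2; lra.
rewrite ltr0_norm//; set v := - u; have v0 : 0 < v by rewrite oppr_gt0.
have -> : u = - v by rewrite opprK.
have h1 := expR_ge1Dx v; have e0 := expR_gt0 v.
rewrite expRN sqrrN.
have h2 : (expR v)^-1 <= (1 + v)^-1 by rewrite lef_pV2 ?posrE//; lra.
apply: le_trans h2 _; rewrite -[leLHS]mul1r ler_pdivrMr; last by lra.
have : v ^+ 2 <= v ^+ 2 * expR v by rewrite ler_peMr ?sqr_ge0//; lra.
set w := v ^+ 2 * expR v; have := sqr_ge0 v; nra.
Qed.

(** A wider Gaussian dominates: [x^2 <= exp (2 x)], and completing the square in
    [(c + 2) x - x^2 / 2] leaves the constant [exp ((c + 2)^2)] times the Gaussian at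
    [v / sqrt 2]. *)
Lemma gI_enorm_exp n c : 0 <= c -> gI (fun v : 'rV[R]_n.+2 => enorm v ^+ 2 * expR (c * enorm v)).
Proof.
move=> c0; have me := vmeas_enorm (@vmap_id R n.+2).
have mf : vmeas (fun v : 'rV[R]_n.+2 => enorm v ^+ 2 * expR (c * enorm v) : RR).
  have h1 : measurable_fun setT (fun t : n.+2.-tuple RR => c * enorm (rowt t) : RR).
    by apply: measurable_funM.
  have h2 : measurable_fun setT (fun t : n.+2.-tuple RR => expR (c * enorm (rowt t)) : RR).
    exact: (measurableT_comp (@measurable_expR R) h1).
  exact: (measurable_funM (@measurable_enormX R n.+2 2) h2).
apply: gI_vint => //; have r0 : 0 < (Num.sqrt (2 : R))^-1 by rewrite invr_gt0 sqrtr_gt0.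
have mg := vmeasE (@vmeas_gs R n.+2).
have g0 (v : 'rV[R]_n.+2) : (0 <= (gs v)%:E)%E by rewrite lee_fin gs_ge0.
have := vint_scale r0 mg g0; rewrite vint_gs => E.
have mgr : vmeas (fun v : 'rV[R]_n.+2 => (gs ((Num.sqrt (2 : R))^-1 *: v))%:E).
  exact: (vmeas_comp (vmapZ _ (@vmap_id R _)) mg).
have fin : (vint (fun v : 'rV[R]_n.+2 => (gs ((Num.sqrt (2 : R))^-1 *: v))%:E) < +oo)%E.
  have : (0 <= vint (fun v : 'rV[R]_n.+2 => (gs ((Num.sqrt (2 : R))^-1 *: v))%:E))%E.
    by apply: vint_ge0 => v.
  move: E; case: (vint _) => [z _ _|E _|//]; first exact: ltry.
  by move: E; rewrite gt0_muley// lte_fin exprn_gt0.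
apply: (@le_lt_trans _ _ ((expR ((c + 2) ^+ 2))%:E *
    vint (fun v : 'rV[R]_n.+2 => (gs ((Num.sqrt (2 : R))^-1 *: v))%:E))%E); last first.
  by rewrite lte_mul_pinfty ?lee_fin ?expR_ge0.
rewrite -vintZ//; apply: le_vint.
- have h : measurable_fun setT (fun t : n.+2.-tuple RR =>
    `|enorm (rowt t) ^+ 2 * expR (c * enorm (rowt t))| : RR) by apply: measurableT_comp.
  exact: (vmeasE (f := fun v => `|enorm v ^+ 2 * expR (c * enorm v)| * gs v) (measurable_funM h (@vmeas_gs R _))).
- apply: (vmeasE (f := fun v => expR ((c + 2) ^+ 2) * gs ((Num.sqrt (2 : R))^-1 *: v))).
  apply: measurable_funM => //; exact: (vmeas_comp (vmapZ _ (@vmap_id R _)) (@vmeas_gs R _)).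
- by move=> v; rewrite lee_fin mulr_ge0 ?gs_ge0.
move=> v; rewrite -EFinM lee_fin ger0_norm; last by rewrite mulr_ge0 ?sqr_ge0 ?expR_ge0.
set x := enorm v; have x0 : 0 <= x by exact: enorm_ge0.
rewrite !gs_enorm enormZ -/x gtr0_norm// /g1 exprMn exprVn [Num.sqrt 2 ^+ 2]sqr_sqrtr//.
have x2 : x ^+ 2 <= expR (2 * x).
  rewrite mulr_natl mulr2n expRD -expr2 ler_pXn2r ?nnegrE ?expR_ge0//.
  by apply: le_trans (expR_ge1Dx x); rewrite lerDr.
apply: (@le_trans _ _ (expR (2 * x) * expR (c * x) * expR (- (x ^+ 2 / 2)))).
  by apply: ler_wpM2r; rewrite ?expR_ge0//; apply: ler_wpM2r; rewrite ?expR_ge0.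
rewrite -!expRD ler_expR; have := sqr_ge0 (x / 2 - (c + 2)); rewrite !sqrrD !sqrrN => h.
have : 0 <= (x / 2) ^+ 2 by exact: sqr_ge0.
nra.
Qed.

End first_order.

(** * The quermassintegral of index one below the top against a Gaussian mean of the support
    function *)

Section mean_width.
Variable R : realType.
Local Notation RR := (measurableTypeR R).
Implicit Types c s t : R.

Lemma g1_le (x y : R) : 0 <= x -> x <= y -> g1 y <= g1 x.
Proof.
move=> x0 xy; rewrite /g1 ler_expR lerN2 ler_pM2r ?invr_gt0//.
by rewrite ler_pXn2r ?nnegrE// (le_trans x0).
Qed.

(* The Steiner polynomial, integrated against Gaussians of width [s -> oo]; its second
   coefficient in [1 / s] is compared with that of [\int exp (- |v|^2 / 2 + H v / s)]. *)
Lemma steiner_gauss n (K : set 'rV[R]_n.+2) (W : 'I_n.+3 -> R) (H : 'rV[R]_n.+2 -> R) c :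
  compact K -> K !=set0 -> quermass K W -> vmeas (H : _ -> RR) -> 0 <= c ->
  (forall v, `|H v| <= c * enorm v) -> (forall y v, K y -> dotv y v <= H v) ->
  n.+2%:R * W (inord n.+1) * Jm R n.+2 <= gE H.
Proof.
move=> cK K0 hW mH c0 Hc KH.
(* For [0 < t <= 1], [t ^+ 2 * E2 v] bounds the second-order remainder of [exp (t * H v)], by
   [expR_le_quad]. *)
pose E2 (v : 'rV[R]_n.+2) := c ^+ 2 * (enorm v ^+ 2 * expR (c * enorm v)).
have E2I : gI E2 by apply: gI_Z; exact: gI_enorm_exp.
have HI : gI H by apply: (gI_dom mH (gI_Z c (@gI_enorm R n)) Hc).
have I1 : gI (fun _ : 'rV[R]_n.+2 => 1 : R) by exact: gI_cst.
(* The polynomial is taken in [t = 1 / s], so the indices of the Steiner formula are reversed and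
   [a 1] carries the wanted quermassintegral. *)
pose a (j : nat) : R := 'C(n.+2, n.+2 - j)%:R * W (inord (n.+2 - j)) * Jm R (n.+2 - j).+1.
have -> : n.+2%:R * W (inord n.+1) * Jm R n.+2 = a 1%N by rewrite /a subSS subn0 binSn.
have [k0 Kk0] := K0.
apply: (@first_order_le R n.+1 a (c2pi R ^+ n.+2) (gE H) (gE E2)) => t t0 t1.
set s := t^-1; have s0 : 0 < s by rewrite invr_gt0.
have tE (i N : nat) : (i <= N)%N -> s ^+ (N - i) = t ^+ i * s ^+ N.
  by move=> iN; rewrite -[in RHS](subnKC iN) exprD mulrA -exprMn mulfV ?gt_eqF// expr1n mul1r.
have sum_E : vint (fun v => (g1 (dists K s v))%:E) = (\sum_(j < n.+3) a j * t ^+ j)%:E.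
  rewrite (vint_dists cK K0 hW s0); congr (_%:E).
  rewrite (reindex_inj rev_ord_inj) /=; apply: eq_bigr => j _.
  have jn : (j <= n.+2)%N by rewrite -ltnS.
  rewrite /a subSS; have -> : rev_ord j = inord (n.+2 - j).
    by apply: val_inj; rewrite /= subSS inordK// ltnS leq_subr.
  by rewrite (tE _ _ jn) mulrA mulfK; [ring|rewrite expf_neq0// gt_eqF].
have md : vmeas (dists K s : _ -> RR).
  apply: measurable_funM => //.
  exact: (vmeas_comp (vmapZ s (@vmap_id R _)) (vmeas_dist_set cK K0)).
have mgd : vmeas (fun v => (g1 (dists K s v))%:E).
  by apply: vmeasE; exact: (measurableT_comp (@measurable_g1 R) md).
have d0 v : 0 <= dists K s v by rewrite divr_ge0 ?dist_set_ge0// ltW.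
split; rewrite -lee_fin -sum_E.
  (* Lower bound: [K / s] contains [t *: k0], so the distance to it is at most the distance to this
     point, and a translated Gaussian has full mass. *)
  have mgs := vmeasE (@vmeas_gs R n.+2).
  have gs0 (v : 'rV[R]_n.+2) : (0 <= (gs v)%:E)%E by rewrite lee_fin gs_ge0.
  have [mtr /(_ _ mgs gs0) ptr] := mpres_translate (- (t *: k0)).
  rewrite -vint_gs -ptr; apply: le_vint => //; first exact: (vmeas_comp mtr mgs).
  move=> v; rewrite lee_fin gs_enorm; apply: g1_le => //.
  rewrite /dists ler_pdivrMr//; apply: le_trans (dist_set_le _ Kk0) _.
  rewrite mulrC -[X in X * _](gtr0_norm s0) -enormZ enormB scalerBr scalerA mulVf ?gt_eqF//.
  by rewrite scale1r.
have h1 := gI_D (gI_D I1 (gI_Z t HI)) (gI_Z (t ^+ 2) E2I).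
have <- : gE (fun v => 1 + t * H v + t ^+ 2 * E2 v) = c2pi R ^+ n.+2 + t * gE H + t ^+ 2 * gE E2.
  rewrite gED; [|exact: gI_D I1 (gI_Z t HI)|exact: (gI_Z (t ^+ 2) E2I)].
  by rewrite (gED I1 (gI_Z t HI)) gE_cst mul1r (gEZ t HI) (gEZ (t ^+ 2) E2I).
rewrite gE_vint//; apply: le_vint => //.
- exact: (vmeasE (f := fun v => (1 + t * H v + t ^+ 2 * E2 v) * gs v)
    (measurable_funM (gI_meas h1) (@vmeas_gs R _))).
- by move=> v; rewrite lee_fin g1_ge0.
move=> v; rewrite lee_fin.
(* Upper bound: [|y - s v|^2] is expanded for [y] in [K], with [|y|^2 >= 0] and [<y, v> <= H v]. *)
have qd : dotv v v - 2 * (t * H v) <= dists K s v ^+ 2.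
  have [neg|pos] := ltP (dotv v v - 2 * (t * H v)) 0; first by rewrite (le_trans (ltW neg))// sqr_ge0.
  rewrite -[leLHS]sqr_sqrtr// ler_pXn2r ?nnegrE ?sqrtr_ge0//.
  rewrite /dists ler_pdivlMr//; apply: (dist_set_ge K0) => y Ky.
  rewrite -(ler_pXn2r (n := 2))// ?nnegrE ?mulr_ge0 ?sqrtr_ge0 ?enorm_ge0 ?(ltW s0)//.
  rewrite exprMn sqr_sqrtr// sqr_enorm dotvBl !dotvBr !dotvZl !dotvZr (dotvC v y).
  have ts : t * s = 1 by rewrite mulfV ?gt_eqF.
  have yH : s * dotv y v <= s * H v by rewrite ler_pM2l// KH.
  have -> : (dotv v v - 2 * (t * H v)) * s ^+ 2 = s * (s * dotv v v) - 2 * ((t * s) * (s * H v)) by ring.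
  by rewrite ts mul1r; have := dotv_ge0 y; lra.
apply: (@le_trans _ _ (expR (t * H v) * gs v)).
  by rewrite /g1 /gs -expRD ler_expR; lra.
apply: ler_wpM2r; first exact: gs_ge0.
apply: le_trans (expR_le_quad _) _; rewrite lerD2l exprMn -mulrA ler_wpM2l ?sqr_ge0//.
rewrite /E2 mulrA -exprMn; apply: ler_pM; rewrite ?sqr_ge0 ?expR_ge0//.
  rewrite -[leLHS](ger0_norm (sqr_ge0 _)) normrX ler_pXn2r ?nnegrE ?mulr_ge0 ?enorm_ge0//.
rewrite ler_expR normrM (gtr0_norm t0); apply: le_trans (Hc v).
by rewrite ler_piMl.
Qed.

End mean_width.

(** * From great circles to Gaussian means by averaging over rotations *)

Section averaging.
Variable R : realType.
Local Notation RR := (measurableTypeR R).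
Variables (n : nat) (F : 'rV[R]_n.+2 -> R) (L d : R).
Hypothesis F_int : gI F.
Hypothesis L0 : 0 <= L.
Hypothesis F_lip : forall x y, `|F x - F y| <= L * enorm (x - y).
Hypothesis F_homog : forall c x, 0 <= c -> F (c *: x) = c * F x.
Hypothesis F_circ : forall u v, dotv u u = 1 -> dotv v v = 1 -> dotv u v = 0 ->
  circ (fun t => F (cos t *: u + sin t *: v)) <= d.

Let rot := {T : 'rV[R]_n.+2 -> 'rV[R]_n.+2 | rotv T}.

Definition rot_sum (s : seq rot) x : R := \sum_(T <- s) F (sval T x).

Let rot_sum_cons T s x : rot_sum (T :: s) x = F (sval T x) + rot_sum s x.
Proof. by rewrite /rot_sum big_cons. Qed.

Let rot_sum_nil x : rot_sum [::] x = 0.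
Proof. by rewrite /rot_sum big_nil. Qed.

Lemma rot_sum_gE s : gI (rot_sum s) /\ gE (rot_sum s) = (size s)%:R * gE F.
Proof.
elim: s => [|T s [IH1 IH2]].
  have -> : rot_sum [::] = (fun=> 0) by apply/funext => x; exact: rot_sum_nil.
  by split; [exact: gI_cst|rewrite gE_cst !mul0r].
have TI := gI_rotv (svalP T) F_int.
have -> : rot_sum (T :: s) = (fun x => F (sval T x) + rot_sum s x).
  by apply/funext => x; exact: rot_sum_cons.
split; first exact: gI_D.
by rewrite gED// IH2 (gE_rotv (svalP T))//= -natr1; ring.
Qed.

Lemma rot_sum_lip s x y : `|rot_sum s x - rot_sum s y| <= (size s)%:R * L * enorm (x - y).
Proof.
elim: s => [|T s IH]; first by rewrite !rot_sum_nil subrr normr0 !mul0r.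
rewrite !rot_sum_cons opprD addrACA /= -natr1 !mulrDl mul1r addrC.
apply: le_trans (ler_normD _ _) _; apply: lerD => //.
by apply: le_trans (F_lip _ _) _; rewrite -(rotvB _ _ (svalP T)) (rotv_enorm _ (svalP T)).
Qed.

Lemma rot_sum_homog s c x : 0 <= c -> rot_sum s (c *: x) = c * rot_sum s x.
Proof.
move=> c0; rewrite /rot_sum mulr_sumr; apply: eq_bigr => T _.
by rewrite (rotvZ _ _ (svalP T)) F_homog.
Qed.

Lemma lip_circle_continuous (f : 'rV[R]_n.+2 -> R) (M : R) (u v : 'rV[R]_n.+2) :
  0 <= M -> (forall x y, `|f x - f y| <= M * enorm (x - y)) ->
  enorm u = 1 -> enorm v = 1 -> continuous (fun t : R => f (cos t *: u + sin t *: v)).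
Proof.
move=> M0 flip u1 v1 t; apply/cvgrPdist_le => e e0.
have M1 : 0 < e / (2 * (M + 1)) by rewrite divr_gt0// mulr_gt0// ltr_wpDl.
have /cvgrPdist_le /(_ _ M1) nc := @continuous_cos R t.
have /cvgrPdist_le /(_ _ M1) ns := @continuous_sin R t.
near=> z.
apply: le_trans (flip _ _) _.
have hc : `|cos t - cos z| <= e / (2 * (M + 1)).
  by near: z; exact: nc.
have hs : `|sin t - sin z| <= e / (2 * (M + 1)).
  by near: z; exact: ns.
have -> : cos t *: u + sin t *: v - (cos z *: u + sin z *: v) =
    (cos t - cos z) *: u + (sin t - sin z) *: v.
  by rewrite !scalerBl opprD addrACA.
apply: (@le_trans _ _ (M * (e / (2 * (M + 1)) + e / (2 * (M + 1))))).
  rewrite ler_wpM2l//; apply: le_trans (enormD _ _) _; rewrite !enormZ u1 v1 !mulr1.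
  exact: lerD.
have -> : M * (e / (2 * (M + 1)) + e / (2 * (M + 1))) = e * (M / (M + 1)).
  by field; rewrite gt_eqF// ltr_wpDl.
by rewrite ler_piMr ?(ltW e0)// ler_pdivrMr ?mul1r ?lerDl// ltr_wpDl.
Unshelve. all: by end_near. Qed.

Lemma rot_sum_circ s u v : dotv u u = 1 -> dotv v v = 1 -> dotv u v = 0 ->
  circ (fun t => rot_sum s (cos t *: u + sin t *: v)) <= (size s)%:R * d.
Proof.
move=> u1 v1 uv; have nu : enorm u = 1 by rewrite /enorm u1 sqrtr1.
have nv : enorm v = 1 by rewrite /enorm v1 sqrtr1.
elim: s => [|T s IH].
  have -> : circ (fun t => rot_sum [::] (cos t *: u + sin t *: v)) = 0 * circ (fun=> 0 : R).
    rewrite /circ -cintZ; last exact: cst_continuous.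
    by apply: eq_cint => t; rewrite mul0r rot_sum_nil.
  by rewrite !mul0r.
have [lT dT _] := svalP T; have rT := svalP T.
have -> : circ (fun t => rot_sum (T :: s) (cos t *: u + sin t *: v)) =
    circ (fun t => F (cos t *: sval T u + sin t *: sval T v) + rot_sum s (cos t *: u + sin t *: v)).
  by apply: eq_cint => t; rewrite rot_sum_cons (rotvD _ _ rT) !(rotvZ _ _ rT).
rewrite /circ cintD.
- rewrite [leRHS](_ : _ = d + (size s)%:R * d); last by rewrite /= -natr1; ring.
  apply: lerD => //.
  by apply: F_circ; rewrite dT.
- by apply: (lip_circle_continuous L0 F_lip); rewrite (rotv_enorm _ rT).
- by apply: (lip_circle_continuous _ (rot_sum_lip s)) => //; rewrite mulr_ge0.
Qed.

Let D := d / (pi *+ 2).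

(** On a great circle the integral is at most [size s * d], hence the mean over the length [2 pi] is
    at most [size s * D]; a larger lower bound at all its points is impossible. *)
Lemma rot_sum_low s eps : (0 < size s)%N -> 0 < eps ->
  exists2 x, enorm x = 1 & rot_sum s x <= (size s)%:R * (D + eps).
Proof.
move=> s0 eps0; pose u := e0 R n.+1; pose v : 'rV[R]_n.+2 := consv 0 (e0 R n).
have u1 : dotv u u = 1 by rewrite dotv_consv dot0v mulr1 addr0.
have v1 : dotv v v = 1 by rewrite !dotv_consv dot0v mulr1 addr0 mulr0 add0r.
have uv : dotv u v = 0 by rewrite dotv_consv dot0v mulr0 addr0.
have nu : enorm u = 1 by rewrite /enorm u1 sqrtr1.
have nv : enorm v = 1 by rewrite /enorm v1 sqrtr1.
pose p t := cos t *: u + sin t *: v.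
apply: contrapT => H.
have big t : (size s)%:R * (D + eps) <= rot_sum s (p t).
  rewrite leNgt; apply/negP => h; apply: H; exists (p t); last exact: ltW.
  rewrite /enorm dotvDl !dotvDr !dotvZl !dotvZr u1 v1 uv (dotvC v u) uv.
  rewrite !mulr0 !mulr1 addr0 add0r -!expr2 cos2Dsin2.
  by rewrite sqrtr1.
have sR : 0 < (size s)%:R :> R by rewrite ltr0n.
have cp : continuous (fun t => rot_sum s (p t)).
  by apply: (lip_circle_continuous _ (rot_sum_lip s)) => //; rewrite mulr_ge0.
have := rot_sum_circ s u1 v1 uv; apply/negP; rewrite -ltNge.
have pi2 : 0 < pi *+ 2 :> R by rewrite mulrn_wgt0// pi_gt0.
apply: (@lt_le_trans _ _ (circ (fun=> (size s)%:R * (D + eps)))); last first.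
  by apply: cint_le; [exact: cst_continuous|exact: cp|move=> t _; exact: big].
have cF t : is_derive t (1 : R) (fun t => (size s)%:R * (D + eps) * t) ((size s)%:R * (D + eps)).
  by apply: is_derive_eq; rewrite /GRing.scale/= mulr1.
rewrite /circ (cint_FTC _ _ cF); [|exact: cst_continuous|by rewrite lerDl ltW].
rewrite -mulrBr addrAC subrr add0r -mulrA ltr_pM2l// mulrDl /D divfK ?gt_eqF//.
by rewrite ltrDl mulr_gt0.
Qed.

Let rcomp (S T : rot) : rot := exist _ (sval T \o sval S) (rotv_comp (svalP S) (svalP T)).

(** Each [q] of the net contributes a copy of the sum, rotated so that [q] goes to the low point
    [x0]. At a unit vector [x], the copy of a nearby [q] is evaluated within [rho] of [x0], which
    costs at most [L * rho] per summand; the other copies are bounded through [M]. *)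
Lemma averaging_step s M m x0 : (0 < size s)%N -> enorm x0 = 1 ->
  (forall x, enorm x = 1 -> rot_sum s x <= (size s)%:R * M) ->
  rot_sum s x0 <= (size s)%:R * m -> forall rho, 0 < rho ->
  forall c : seq 'rV[R]_n.+2, (forall q, q \in c -> enorm q = 1) ->
    (forall y, enorm y = 1 -> exists2 q, q \in c & enorm (y - q) <= rho) ->
  exists s', size s' = (size c * size s)%N /\
    forall x, enorm x = 1 -> rot_sum s' x <=
      (size s)%:R * ((size c).-1%:R * M + (m + L * rho)).
Proof.
move=> s0 x01 hM hm rho rho0 c c1 cnet.
have tr (q : 'rV[R]_n.+2) : exists T : rot, enorm q = 1 -> sval T q = x0.
  have [q1|q1] := eqVneq (enorm q) 1; last by exists (exist _ _ (@rotv_id R n.+2)) => /eqP; rewrite (negbTE q1).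
  have qx : enorm q = enorm x0 by rewrite x01.
  by have [T rT Tq] := rotv_transitive qx; exists (exist _ T rT).
have [Tf hTf] := choice tr.
exists [seq rcomp (Tf q) T | q <- c, T <- s]; split; first by rewrite size_allpairs.
move=> x x1.
have -> : rot_sum [seq rcomp (Tf q) T | q <- c, T <- s] x = \sum_(q <- c) rot_sum s (sval (Tf q) x).
  by rewrite /rot_sum big_allpairs_dep.
have [q qc xq] := cnet x x1.
rewrite (big_rem _ qc)/= mulrDr addrC; apply: lerD.
  rewrite mulrCA -[(size c).-1](size_rem qc).
  elim: (rem q c) => [|q' c' IH]; first by rewrite big_nil mul0r.
  rewrite big_cons /= -natr1 mulrDl mul1r addrC lerD// hM//.
  by rewrite (rotv_enorm _ (svalP _)).
have := rot_sum_lip s (sval (Tf q) x) x0; rewrite ler_norml => /andP[_ h].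
rewrite mulrDr; have : enorm (sval (Tf q) x - x0) <= rho.
  rewrite -(hTf q (c1 q qc)) -(rotvB _ _ (svalP _)) (rotv_enorm _ (svalP _)).
  exact: xq.
have sL : 0 <= (size s)%:R * L by rewrite mulr_ge0.
move=> /(ler_wpM2l sL); rewrite mulrA; lra.
Qed.

(* While the supremum of the averages of [F] stays above [D], averaging a near-optimal
   one over rotations sending a net of the sphere to a low point improves it. *)
Lemma averaging eps : 0 < eps -> exists2 s, (0 < size s)%N &
  forall x, enorm x = 1 -> rot_sum s x <= (size s)%:R * (D + eps).
Proof.
move=> eps0.
pose A := [set M | exists2 s, (0 < size s)%N & forall x, enorm x = 1 -> rot_sum s x <= (size s)%:R * M].
have rs0 s : rot_sum s 0 = 0 by rewrite -(scale0r 0) rot_sum_homog// mul0r.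
have bnd s x : enorm x = 1 -> `|rot_sum s x| <= (size s)%:R * L.
  by move=> x1; have := rot_sum_lip s x 0; rewrite rs0 !subr0 x1 mulr1.
have hA : has_inf A.
  split.
    exists L; exists [:: exist _ _ (@rotv_id R n.+2)] => // x x1.
    by apply: le_trans (ler_norm _) _; exact: bnd.
  exists (- L) => M [s s0 hs].
  have u1 : enorm (e0 R n.+1) = 1 by rewrite /enorm dotv_consv dot0v mulr1 addr0 sqrtr1.
  have sR : 0 < (size s)%:R :> R by rewrite ltr0n.
  rewrite -(ler_pM2l sR) mulrN; apply: le_trans (hs _ u1).
  by have := bnd s _ u1; rewrite ler_norml => /andP[].
suff infD : inf A <= D.
  have [M [s s0 hs] hM] := inf_adherent eps0 hA; exists s => // x x1.
  apply: le_trans (hs x x1) _; rewrite ler_wpM2l//; lra.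
rewrite leNgt; apply/negP => Dm; set m := inf A in Dm.
pose e := m - D; have e_gt0 : 0 < e by rewrite subr_gt0.
(* The errors from [rho], from [delta] and from the low value are at most [e / 4] each, less in
   total than the gap [e]; so the new average falls below the infimum. *)
pose rho := e / (4 * (L + 1)); have rho0 : 0 < rho.
  by rewrite divr_gt0// mulr_gt0// ltr_wpDl.
have Lrho : L * rho <= e / 4.
  rewrite /rho mulrA ler_pdivrMr ?mulr_gt0 ?ltr_wpDl//; nra.
have [c [c1 cnet]] := @sphere_net R n.+1 rho rho0.
have csz : (0 < size c)%N.
  have u1 : enorm (e0 R n.+1) = 1 by rewrite /enorm dotv_consv dot0v mulr1 addr0 sqrtr1.
  by have [q qc _] := cnet _ u1; case: (c) qc.
have cR : 0 < (size c)%:R :> R by rewrite ltr0n.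
pose delta := e / (4 * (size c)%:R); have delta0 : 0 < delta by rewrite divr_gt0// mulr_gt0.
have [M [s s0 hs] hM] := inf_adherent delta0 hA; rewrite -/m in hM.
have e4 : 0 < e / 4 by rewrite divr_gt0.
have [x0 x01 hx0] := rot_sum_low s0 e4.
have [s' [s'sz hs']] := averaging_step s0 x01 hs hx0 rho0 c1 cnet.
pose M' := ((size c).-1%:R * M + (D + e / 4 + L * rho)) / (size c)%:R.
have AM' : A M'.
  exists s'; first by rewrite s'sz muln_gt0 csz.
  move=> x x1; apply: le_trans (hs' x x1) _.
  rewrite le_eqVlt; apply/orP; left; apply/eqP; rewrite s'sz natrM /M'.
  by field; rewrite gt_eqF.
have : m <= M' by apply: ge_inf => //; exact: hA.2.
rewrite /M' ler_pdivlMr//; apply/negP; rewrite -ltNge.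
have szE : (size c)%:R = (size c).-1%:R + 1 :> R by rewrite natr1 prednK.
have p0 : 0 <= (size c).-1%:R :> R by [].
have pM : (size c).-1%:R * M <= (size c).-1%:R * (m + delta) by rewrite ler_wpM2l// ltW.
have pd : (size c).-1%:R * delta <= e / 4.
  rewrite /delta mulrA ler_pdivrMr ?mulr_gt0// szE; nra.
rewrite szE; rewrite /e in e_gt0 Lrho pd *; nra.
Qed.

(** Rotation invariance gives [rot_sum s] the expectation [size s * gE F], and homogeneity carries
    its bound from the sphere to the space. *)
Lemma gE_le_circ : gE F <= D * gE (@enorm R n.+2).
Proof.
apply/ler_addgt0Pr => eps eps0.
have M0 : 0 <= gE (@enorm R n.+2).
  by rewrite -[leLHS](mul0r (c2pi R ^+ n.+2)) -gE_cst; apply: le_gE; [exact: gI_cst|exact: gI_enorm|exact: enorm_ge0].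
have M1 : 0 < gE (@enorm R n.+2) + 1 by rewrite ltr_wpDl.
have [s s0 hs] := averaging (divr_gt0 eps0 M1).
set e := eps / _ in hs; have [sI sE] := rot_sum_gE s.
have sR : 0 < (size s)%:R :> R by rewrite ltr0n.
have le_s : gE (rot_sum s) <= gE (fun x : 'rV[R]_n.+2 => ((size s)%:R * (D + e)) * enorm x).
  apply: (le_gE sI (gI_Z _ (@gI_enorm R n))) => x.
  have [x0|x0] := eqVneq (enorm x) 0.
    by rewrite (enorm_eq0 x0) enorm0 mulr0 -(scale0r 0) rot_sum_homog// mul0r.
  have xp : 0 < enorm x by rewrite lt_neqAle eq_sym x0 enorm_ge0.
  have x1 : enorm ((enorm x)^-1 *: x) = 1 by rewrite enormZ gtr0_norm ?invr_gt0// mulVf.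
  have := hs _ x1; rewrite rot_sum_homog ?invr_ge0 ?enorm_ge0//.
  by rewrite mulrC ler_pdivrMr.
move: le_s; rewrite sE gEZ; last exact: gI_enorm.
rewrite -mulrA ler_pM2l// mulrDl => /le_trans; apply; rewrite lerD2l.
rewrite /e mulrAC ler_pdivrMr//; nra.
Qed.

End averaging.

Arguments dotv {R n} u v.

(** * The Gaussian inequality for a finite set and a dominating polygon *)

Section polygon.
Variable R : realType.
Local Notation RR := (measurableTypeR R).
Variable n : nat.
Local Notation V := 'rV[R]_n.+2.
Implicit Types (u v w x y : V) (s k z : seq V).

Fixpoint vlen x s : R := if s is y :: s' then enorm (x - y) + vlen y s' else 0.

(** The total variation of the linear form [<., w>] along the polygon, the Crofton integrand of its
    length. *)
Fixpoint variation x s w : R :=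
  if s is y :: s' then `|dotv (x - y) w| + variation y s' w else 0.

Lemma vlen_ge0 x s : 0 <= vlen x s.
Proof. by elim: s x => //= y s ih x; rewrite addr_ge0 ?enorm_ge0. Qed.

Lemma variation_gE x s :
  gI (variation x s) /\ gE (variation x s) = 2 * c2pi R ^+ n.+1 * vlen x s.
Proof.
elim: s x => [|y s IH] x /=; first by split; [exact: gI_cst|rewrite gE_cst mul0r mulr0].
have [I1 E1] := IH y; have I2 := gI_abs_dotv (x - y).
split; first exact: (gI_D I2 I1).
by rewrite (gED I2 I1) E1 gE_abs_dotv; ring.
Qed.

Lemma variation_lip x s v w : `|variation x s v - variation x s w| <= vlen x s * enorm (v - w).
Proof.
elim: s x => [|y s IH] x /=; first by rewrite subrr normr0 mul0r.
rewrite opprD addrACA mulrDl; apply: le_trans (ler_normD _ _) _; apply: lerD => //.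
apply: le_trans (ler_dist_dist _ _) _; rewrite -dotvBr; exact: dotv_le.
Qed.

Lemma variation_homog x s (c : R) v : 0 <= c -> variation x s (c *: v) = c * variation x s v.
Proof.
move=> c0; elim: s x => [|y s IH] x /=; first by rewrite mulr0.
by rewrite IH dotvZr normrM ger0_norm// mulrDr.
Qed.

Definition proj2 u v x : R * R := (dotv x u, dotv x v).

Lemma pdot_proj2 u v x t : pdot (proj2 u v x) t = dotv x (cos t *: u + sin t *: v).
Proof. by rewrite dotvDr !dotvZr /pdot /=; ring. Qed.

Lemma pdist_proj2 u v x y : pdist (proj2 u v x) (proj2 u v y) = pnorm (proj2 u v (x - y)).
Proof. by rewrite /pdist /psub /proj2 !dotvBl. Qed.

(** Bessel's inequality, from the squared norm of [x] minus its projection. *)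
Lemma pnorm_proj2_le u v x : dotv u u = 1 -> dotv v v = 1 -> dotv u v = 0 ->
  pnorm (proj2 u v x) <= enorm x.
Proof.
move=> u1 v1 uv; apply: ler_wsqrtr => /=.
have := dotv_ge0 (x + (- dotv x u) *: u + (- dotv x v) *: v).
rewrite !(dotvDl, dotvDr, dotvZl, dotvZr) u1 v1 (dotvC v u) uv.
by rewrite (dotvC u x) (dotvC v x); nra.
Qed.

Lemma circ_abs_pdot (p : R * R) : circ (fun t => `|pdot p t|) = 4 * pnorm p.
Proof.
have cf : continuous (fun t => `|pdot p t|).
  by move=> t; apply: (@cvg_norm _ R); exact: continuous_pdot.
have p0 := pi_ge0 R.
rewrite /circ (cint_split (b := pi / 2) cf); [|lra|lra].
have -> : cint (pi / 2) (- (pi / 2) + pi *+ 2) (fun t => `|pdot p t|) =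
    cint (- (pi / 2)) (pi / 2) (fun t => `|pdot p t|).
  have -> : - (pi / 2) + pi *+ 2 = pi / 2 + pi :> R by field.
  have {1}-> : pi / 2 = - (pi / 2) + pi :> R by field.
  rewrite (cint_shift _ cf); last by lra.
  by apply: eq_cint => t; rewrite /pdot cosDpi sinDpi !mulrN -opprD normrN.
by rewrite cint_abs_pdot; ring.
Qed.

Lemma circle_continuous_dotv u v x : continuous (fun t : R => dotv x (cos t *: u + sin t *: v)).
Proof.
have := @continuous_pdot R (proj2 u v x).
by rewrite (_ : pdot _ = (fun t => dotv x (cos t *: u + sin t *: v)))//; apply/funext => t; rewrite pdot_proj2.
Qed.

Lemma continuous_variation u v x s : continuous (fun t : R => variation x s (cos t *: u + sin t *: v)).
Proof.
elim: s x => [|y s IH] x /=; first exact: cst_continuous.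
move=> t; apply: cvgD; last exact: IH.
by apply: (@cvg_norm _ R); exact: circle_continuous_dotv.
Qed.

Lemma circ_variation u v x s : circ (fun t => variation x s (cos t *: u + sin t *: v)) =
  4 * plen (proj2 u v x) (map (proj2 u v) s).
Proof.
elim: s x => [|y s IH] x /=.
  rewrite mulr0 -[RHS](mul0r (circ (fun=> 0 : R))) /circ -cintZ; last exact: cst_continuous.
  by apply: eq_cint => t; rewrite mul0r.
rewrite /circ cintD.
- rewrite [X in _ + X]IH mulrDr pdist_proj2 -circ_abs_pdot; congr (_ + _).
  by apply: eq_cint => t; rewrite pdot_proj2.
- move=> t; apply: (@cvg_norm _ R); exact: circle_continuous_dotv.
- exact: continuous_variation.
Qed.

Lemma maxs_lip (x0 : V) s v w : `|maxs x0 s (dotv^~ v) - maxs x0 s (dotv^~ w)| <=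
  maxs x0 s (@enorm R n.+2) * enorm (v - w).
Proof.
have h v' w' : maxs x0 s (dotv^~ v') <= maxs x0 s (dotv^~ w') + maxs x0 s (@enorm R n.+2) * enorm (v' - w').
  apply: maxs_le => q qs; rewrite -[v' in leLHS](subrK w') dotvDr addrC.
  apply: lerD; first exact: (maxs_ge (dotv^~ w') qs).
  apply: (@le_trans _ _ (enorm q * enorm (v' - w'))).
    by apply: le_trans (ler_norm _) _; exact: dotv_le.
  by rewrite ler_wpM2r ?enorm_ge0//; exact: maxs_ge.
rewrite ler_norml; have := h v w; have := h w v; rewrite enormB; lra.
Qed.

Lemma maxs_homog (x0 : V) s (c : R) v : 0 <= c ->
  maxs x0 s (dotv^~ (c *: v)) = c * maxs x0 s (dotv^~ v).
Proof.
move=> c0; elim: s => [|x s IH]; first by rewrite !maxs_nil dotvZr.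
by rewrite !maxs_head IH dotvZr maxr_pMr.
Qed.

Lemma vmeas_support (x0 : V) s : vmeas (fun v => maxs x0 s (dotv^~ v) : RR).
Proof.
apply: (vmeas_maxs x0 s (f := fun x v => dotv x v)) => x.
exact: (vmeas_dotv (vmap_cst x) (@vmap_id R _)).
Qed.

Lemma support_bound (x0 : V) s v :
  `|maxs x0 s (dotv^~ v)| <= maxs x0 s (@enorm R n.+2) * enorm v.
Proof.
by have := maxs_lip x0 s v 0; rewrite subr0 -{1}(scale0r 0) maxs_homog// mul0r subr0.
Qed.

Lemma gI_support (x0 : V) s : gI (fun v => maxs x0 s (dotv^~ v)).
Proof.
exact: (gI_dom (vmeas_support x0 s) (gI_Z _ (@gI_enorm R n)) (support_bound x0 s)).
Qed.

(** On a great circle a quarter of the variation integrates to the length of the projected polygon,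
    so the circle hypothesis on [F] is [planar_bound] for the projections, which do not increase
    distances. Over the space a quarter of [variation_gE] gives the factor [1 / 2] in front of the
    length. *)
Theorem gauss_support_le (k0 z0 : V) k z (d : R) :
  (forall p q, p \in k0 :: k -> q \in k0 :: k -> enorm (p - q) <= d) ->
  (forall v, maxs k0 k (dotv^~ v) <= maxs z0 z (dotv^~ v)) ->
  gE (fun v => maxs k0 k (dotv^~ v)) <=
    c2pi R ^+ n.+1 / 2 * vlen z0 z + d / (pi *+ 2) * gE (@enorm R n.+2).
Proof.
move=> kd kz; pose F v := maxs k0 k (dotv^~ v) + (- 4^-1) * variation z0 z v.
have [vI vE] := variation_gE z0 z; have kI := gI_support k0 k; have v4I := gI_Z (- 4^-1) vI.
pose L := maxs k0 k (@enorm R n.+2) + 4^-1 * vlen z0 z.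
have L0 : 0 <= L.
  rewrite addr_ge0 ?mulr_ge0 ?vlen_ge0//.
  by apply: le_trans (maxs_ge0 _ _ _); exact: enorm_ge0.
have /(_ d) := @gE_le_circ R n F L _ (gI_D kI v4I) L0.
have -> : gE F = gE (fun v => maxs k0 k (dotv^~ v)) - c2pi R ^+ n.+1 / 2 * vlen z0 z.
  rewrite (gED kI v4I) gEZ// vE; congr (_ + _); rewrite mulNr; congr (- _).
  by field.
move=> H; rewrite -lerBlDl; apply: H.
- move=> x y; rewrite /F /L opprD addrACA mulrDl; apply: le_trans (ler_normD _ _) _.
  apply: lerD; first exact: maxs_lip.
  have q0 : 0 <= 4^-1 :> R by rewrite invr_ge0.
  rewrite -mulrBr normrM normrN (ger0_norm q0) -mulrA; apply: ler_wpM2l => //; exact: variation_lip.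
- by move=> c x c0; rewrite /F maxs_homog// variation_homog// mulrDr [in RHS]mulrCA.
move=> u v u1 v1 uv.
have cv := @continuous_variation u v z0 z.
have ck : continuous (fun t => maxs k0 k (dotv^~ (cos t *: u + sin t *: v))).
  apply: (@maxs_continuous R V R k0 k (fun x t => dotv x (cos t *: u + sin t *: v))) => x.
  exact: circle_continuous_dotv.
rewrite /circ cintD//; last by move=> t; apply: cvgMr; exact: cv.
rewrite cintZ// -/(circ _) -/(circ _) circ_variation mulNr mulrA mulVf// mul1r lerBlDl.
have := @planar_bound R (proj2 u v k0) (proj2 u v z0) (map (proj2 u v) k) (map (proj2 u v) z) d.
have mE (y0 : V) (y : seq V) t : maxs (proj2 u v y0) (map (proj2 u v) y) (pdot^~ t) =
    maxs y0 y (dotv^~ (cos t *: u + sin t *: v)).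
  by rewrite maxs_map; congr maxs; apply/funext => x /=; rewrite pdot_proj2.
have -> : (fun t => maxs (proj2 u v k0) (map (proj2 u v) k) (pdot^~ t)) =
    (fun t => maxs k0 k (dotv^~ (cos t *: u + sin t *: v))) by apply/funext => t; rewrite mE.
apply.
- move=> p q; rewrite -map_cons => /mapP[p' p'k ->] /mapP[q' q'k ->].
  rewrite pdist_proj2; apply: le_trans (pnorm_proj2_le _ u1 v1 uv) _; exact: kd.
- by move=> t; rewrite !mE.
Qed.

End polygon.

(** * Polygons inscribed in the curve *)

Section curve.
Variable R : realType.
Variable n : nat.
Local Notation V := 'rV[R]_n.+2.

Lemma vlen_nth (x : V) s : vlen x s =
  \sum_(i < size s) enorm (nth x (x :: s) i - nth x (x :: s) i.+1).
Proof.
have nthE (y0 y1 : V) l i : (i < size l)%N -> nth y0 l i = nth y1 l i by exact: set_nth_default.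
elim: s x => [|y s IH] x; first by rewrite big_ord0.
rewrite big_ord_recl /=; congr (_ + _); rewrite IH; apply: eq_bigr => i _ /=.
have h := ltn_ord i.
by rewrite (nthE y x (y :: s)) /= ?ltnS 1?ltnW// (nthE y x s).
Qed.

Lemma dotv_conv_hull (A : set V) (q : V) : conv_hull A q ->
  exists s : seq V, (forall p, p \in s -> A p) /\
    forall v, exists2 p, p \in s & dotv q v <= dotv p v.
Proof.
move=> [m [w [p [w0 [w1 [Ap qE]]]]]].
exists (codom p); split => [_ /codomP[i ->]//|v].
case: m w p w0 w1 Ap qE => [|m] w p w0 w1 Ap qE.
  by move: w1; rewrite big_ord0 => /eqP; rewrite eq_sym oner_eq0.
have [i _ hi] := maxs_ex ord0 (enum 'I_m.+1) (fun i => dotv (p i) v).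
exists (p i); first exact: codom_f.
have sumE : dotv q v = \sum_j w j * dotv (p j) v.
  rewrite qE; have : forall r : seq 'I_m.+1, dotv (\sum_(j <- r) w j *: p j) v = \sum_(j <- r) w j * dotv (p j) v.
    elim => [|j r IH]; first by rewrite !big_nil dot0v.
    by rewrite !big_cons dotvDl dotvZl IH.
  exact.
rewrite sumE -[leRHS]mul1r -w1 mulr_suml; apply: ler_sum => j _.
rewrite ler_wpM2l// -hi; apply: (maxs_ge (fun i => dotv (p i) v)).
by rewrite in_cons mem_enum orbT.
Qed.

Lemma curve_points (phi : R -> V) (a b : R) (k : seq V) :
  (forall q, q \in k -> conv_hull (phi @` `[a, b]) q) ->
  exists ts : seq R, (forall t, t \in ts -> a <= t <= b) /\
    forall q, q \in k -> forall v, exists2 t, t \in ts & dotv q v <= dotv (phi t) v.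
Proof.
elim: k => [|q k IH] h; first by exists [::].
have [ts [tab hts]] := IH (fun p pk => h p (mem_behead (s := q :: k) pk)).
have [s [sA hs]] := dotv_conv_hull (h q (mem_head _ _)).
have [us [uab hus]] : exists us : seq R, (forall t, t \in us -> a <= t <= b) /\
    forall p, p \in s -> exists2 t, t \in us & phi t = p.
  elim: s sA {hs} => [|p s IHs] sA; first by exists [::].
  have [us [uab hus]] := IHs (fun p' p's => sA p' (mem_behead (s := p :: s) p's)).
  have [t /= tab' tp] := sA p (mem_head _ _).
  exists (t :: us); split => [t'|p'].
    by rewrite in_cons => /predU1P[->|/uab//]; move: tab'; rewrite in_itv.
  rewrite in_cons => /predU1P[->|/hus[t' t'us <-]]; first by exists t => //; exact: mem_head.
  by exists t' => //; rewrite in_cons t'us orbT.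
exists (us ++ ts); split => [t|p]; first by rewrite mem_cat => /orP[/uab|/tab].
rewrite in_cons => /predU1P[->|pk] v.
  have [p' p's hp'] := hs v; have [t tus tp'] := hus p' p's.
  by exists t; [rewrite mem_cat tus|rewrite tp'].
by have [t tts ht] := hts p pk v; exists t => //; rewrite mem_cat tts orbT.
Qed.

(** Finitely many parameters of the curve dominate the points of [k] in all directions. Since
    [curve_length] asks for strictly increasing partitions from [a] to [b], both ends are added and
    the list is sorted without repetition; for [a = b] it has a single entry. *)
Lemma inscribed_polygon (phi : R -> V) (a b : R) (k0 : V) (k : seq V) : a <= b ->
  (forall q, q \in k0 :: k -> conv_hull (phi @` `[a, b]) q) ->
  exists z0 z, ((vlen z0 z)%:E <= curve_length phi a b)%E /\
    forall v, maxs k0 k (dotv^~ v) <= maxs z0 z (dotv^~ v).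
Proof.
move=> ab h; have [ts [tab hts]] := curve_points h.
pose S := sort <=%R (undup (a :: b :: ts)).
have memS t : (t \in S) = (t \in a :: b :: ts) by rewrite mem_sort mem_undup.
have Sab t : t \in S -> a <= t <= b.
  rewrite memS !in_cons => /predU1P[->|/predU1P[->|/tab//]]; first by rewrite lexx ab.
  by rewrite lexx ab.
have Slt : sorted <%R S by rewrite lt_sorted_uniq_le sort_uniq undup_uniq sort_le_sorted.
have aS : a \in S by rewrite memS mem_head.
have bS : b \in S by rewrite memS !in_cons eqxx orbT.
case SE : S => [|c S']; first by rewrite SE in aS.
have nth_mono i j : (i < j < size S)%N -> nth a S i < nth a S j.
  move=> /andP[ij jS]; apply: (sorted_ltn_nth lt_trans a Slt) => //; rewrite inE//.
  exact: ltn_trans jS.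
have nthab i : (i < size S)%N -> a <= nth a S i <= b by move=> iS; apply/Sab/mem_nth.
have S0 : (0 < size S)%N by rewrite SE.
have nth0 : nth a S 0 = a.
  apply/eqP; rewrite eq_le; have /andP[-> _] := nthab _ S0; rewrite andbT.
  have ia : (index a S < size S)%N by rewrite index_mem.
  rewrite -{2}(nth_index a aS); have [->//|] := posnP (index a S).
  by move=> p; apply: ltW; apply: nth_mono; rewrite p.
have nthl : nth a S (size S).-1 = b.
  have lS : ((size S).-1 < size S)%N by rewrite prednK.
  apply/eqP; rewrite eq_le; have /andP[_ ->] := nthab _ lS; rewrite /=.
  have ib : (index b S < size S)%N by rewrite index_mem.
  rewrite -{1}(nth_index a bS).
  have : (index b S <= (size S).-1)%N by rewrite -ltnS prednK.
  by rewrite leq_eqVlt => /predU1P[->//|p]; apply: ltW; apply: nth_mono; rewrite p.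
exists (phi c), (map phi S'); split.
  apply: ereal_sup_ubound; exists (size S'), (nth a S); split.
  - exact: nth0.
  - by rewrite -nthl SE.
  - by move=> i iS'; apply: nth_mono; rewrite ltnSn SE /=.
  - rewrite vlen_nth size_map; congr (_%:E); apply: eq_bigr => i _.
    have h1 : (i < size S)%N by rewrite SE /= ltnW// ltnS.
    have h2 : (i.+1 < size S)%N by rewrite SE /= ltnS.
    by rewrite edistE -map_cons -SE !(nth_map a).
move=> v; apply: maxs_le => q qk; have [t tts ht] := hts q qk v.
apply: le_trans ht _; apply: (maxs_ge (dotv^~ v)); rewrite -map_cons -SE; apply: map_f.
by rewrite memS !in_cons tts !orbT.
Qed.

Lemma enorm_le_diam (K : set V) : compact K -> forall p q, K p -> K q -> enorm (p - q) <= diam K.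
Proof.
move=> cK p q Kp Kq; have [k0 [k [hk net]]] := compact_net cK (ex_intro _ p Kp) ltr01.
have bnd y : K y -> enorm y <= maxs k0 k (@enorm R n.+2) + 1.
  move=> Ky; have [r rk yr] := net y Ky; rewrite -[y](subrK r).
  apply: le_trans (enormD _ _) _; rewrite [leRHS]addrC; apply: lerD => //.
  exact: (maxs_ge (@enorm R n.+2) rk).
apply: ub_le_sup; last by exists p => //; exists q => //; rewrite edistE.
exists ((maxs k0 k (@enorm R n.+2) + 1) *+ 2) => _ [x Kx [y Ky <-]].
rewrite edistE mulr2n; apply: le_trans (enormD _ _) _; rewrite enormN.
by apply: lerD; exact: bnd.
Qed.

End curve.

(** * The two constants, and the passage from polygons to the curve *)

Section constants.
Variable R : realType.

Lemma c2piE (m : nat) : c2pi R ^+ m = Num.sqrt 2 ^+ m * pi `^ (m%:R / 2).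
Proof.
rewrite /c2pi; have -> : pi *+ 2 = 2 * pi :> R by rewrite mulr_natl.
by rewrite sqrtrM// exprMn (sqrt_powR m (pi_ge0 R)).
Qed.

Lemma Gamma_gt0 (k : nat) : 0 < Gamma (k.+2%:R / 2 : R).
Proof.
have := Jm_gt0 R k; rewrite Jm_Gamma pmulr_rgt0// exprn_gt0// sqrtr_gt0//.
Qed.

Lemma length_constant (n : nat) : c2pi R ^+ n.+1 / 2 / Jm R n.+2 =
  pi `^ ((n.+2%:R - 1) / 2) / (2 * Gamma ((n.+2%:R + 1) / 2)).
Proof.
have s2 : Num.sqrt (2 : R) ^+ n.+1 != 0 by rewrite expf_neq0// gt_eqF// sqrtr_gt0.
have G0 := Gamma_gt0 n.+1.
have -> : n.+2%:R - 1 = n.+1%:R :> R by rewrite -[n.+2]addn1 natrD addrK.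
rewrite natr1 Jm_Gamma c2piE.
by field; rewrite (gt_eqF G0) s2.
Qed.

Lemma diam_constant (n : nat) : (pi *+ 2)^-1 * (c2pi R ^+ n.+2 * Jm R n.+2 / Jm R n.+1) / Jm R n.+2 =
  pi `^ (n.+2%:R / 2 - 1) / Gamma (n.+2%:R / 2).
Proof.
have s2 : Num.sqrt (2 : R) ^+ n != 0 by rewrite expf_neq0// gt_eqF// sqrtr_gt0.
have G0 := Gamma_gt0 n; have J0 := Jm_gt0 R n.+1; have p0 := pi_gt0 R.
have -> : n.+2%:R / 2 - 1 = n%:R / 2 :> R by rewrite -[n.+2]addn2 natrD; field.
have -> : c2pi R ^+ n.+2 = pi *+ 2 * c2pi R ^+ n.
  by rewrite -[n.+2]add2n exprD sqr_sqrtr// mulrn_wge0// ltW.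
rewrite [Jm R n.+1]Jm_Gamma c2piE.
have p2 : pi *+ 2 != 0 :> R by rewrite gt_eqF// mulrn_wgt0.
move: p2; move: (pi *+ 2) (pi `^ _) => P Q P0.
by field; rewrite s2 P0 !gt_eqF.
Qed.

End constants.

(** The function [H] is the support function of an [r]-net of [K] plus [r * |v|], so it dominates
    that of [K]; [r] is chosen so that the added term has expectation at most [e]. *)
Lemma mean_width_le (R : realType) (n : nat) (K : set 'rV[R]_n.+2) (W : 'I_n.+3 -> R)
    (phi : R -> 'rV[R]_n.+2) (a b l : R) :
  convex_body K -> a <= b -> K `<=` conv_hull (phi @` `[a, b]) -> quermass K W ->
  curve_length phi a b = l%:E ->
  n.+2%:R * W (inord n.+1) * Jm R n.+2 <=
    c2pi R ^+ n.+1 / 2 * l + diam K / (pi *+ 2) * gE (@enorm R n.+2).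
Proof.
move=> [K0 [cK _]] ab Kco hW lE.
have E0 : 0 <= gE (@enorm R n.+2).
  rewrite -[leLHS](mul0r (c2pi R ^+ n.+2)) -gE_cst.
  by apply: le_gE; [exact: gI_cst|exact: gI_enorm|exact: enorm_ge0].
have E1 : 0 < gE (@enorm R n.+2) + 1 by rewrite ltr_wpDl.
apply/ler_addgt0Pr => e e_gt0; set r := e / (gE (@enorm R n.+2) + 1).
have r0 : 0 < r by rewrite divr_gt0.
have [k0 [k [kK net]]] := compact_net cK K0 r0.
have [z0 [z [zl kz]]] := inscribed_polygon ab (fun q qk => Kco q (kK q qk)).
have {}zl : vlen z0 z <= l by rewrite -lee_fin -lE.
have kI := gI_support k0 k; have rI := gI_Z r (@gI_enorm R n).
have kd p q : p \in k0 :: k -> q \in k0 :: k -> enorm (p - q) <= diam K.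
  by move=> pk qk; apply: enorm_le_diam => //; exact: kK.
have hk := gauss_support_le kd kz.
pose H v := maxs k0 k (dotv^~ v) + r * enorm v.
pose c := maxs k0 k (@enorm R n.+2) + r.
have c0 : 0 <= c.
  by rewrite addr_ge0 ?(ltW r0)//; apply: le_trans (maxs_ge0 _ _ _); exact: enorm_ge0.
have HI : gI H := gI_D kI rI.
have Hc v : `|H v| <= c * enorm v.
  rewrite /H /c mulrDl; apply: le_trans (ler_normD _ _) _; apply: lerD.
    exact: support_bound.
  by rewrite ger0_norm// mulr_ge0 ?enorm_ge0// ltW.
have KH y v : K y -> dotv y v <= H v.
  move=> Ky; have [q qk yq] := net y Ky; rewrite -[y](subrK q) dotvDl addrC /H.
  apply: lerD; first exact: (maxs_ge (dotv^~ v) qk).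
  apply: le_trans (ler_norm _) _; apply: le_trans (dotv_le _ _) _.
  by rewrite ler_wpM2r ?enorm_ge0.
have := steiner_gauss cK K0 hW (gI_meas HI) c0 Hc KH.
rewrite (gED kI rI) (gEZ r (@gI_enorm R n)) => /le_trans; apply; apply: lerD.
  apply: le_trans hk _; rewrite lerD2r ler_wpM2l// divr_ge0// exprn_ge0//.
  by rewrite ltW// c2pi_gt0.
rewrite /r mulrAC ler_pdivrMr//; nra.
Qed.

Theorem theorem2 (R : realType) (n : nat) (hn : (2 <= n)%N)
  (K : set 'rV[R]_n) (hK : convex_body K)
  (phi : R -> 'rV[R]_n) (a b : R) (hab : a <= b)
  (hphi : {within `[a, b], continuous phi})
  (hco : K `<=` conv_hull (phi @` `[a, b]))
  (W : 'I_n.+1 -> R) (hW : quermass K W) :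
  ((n%:R * W (inord n.-1))%:E <=
   (pi `^ ((n%:R - 1) / 2) / (2 * Gamma ((n%:R + 1) / 2)))%:E
     * curve_length phi a b
   + (pi `^ (n%:R / 2 - 1) / Gamma (n%:R / 2) * diam K)%:E)%E.
Proof.
case: n hn K hK phi hphi hco W hW => [//|[//|n]] _ K hK phi _ hco W hW.
rewrite -length_constant -diam_constant /=.
have J0 := Jm_gt0 R n.+1; have c0 : 0 < c2pi R ^+ n.+1 by rewrite exprn_gt0// c2pi_gt0.
have [[k Kk] [cK _]] := hK.
have k_hull q : q \in [:: k] -> conv_hull (phi @` `[a, b]) q.
  by rewrite inE => /eqP ->; exact: hco.
(* An inscribed polygon shows that the supremum [curve_length] is not [-oo]; for [+oo] the claim is
   trivial, the coefficient of the length being positive. *)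
have [z0 [z [zl _]]] := inscribed_polygon hab k_hull.
move lE : (curve_length phi a b) zl => l; case: l lE => [l| |] lE //= _; last first.
  by rewrite gt0_muley ?addye ?leey// lte_fin !divr_gt0.
have := mean_width_le hK hab hco hW lE; rewrite gE_enorm => h.
rewrite -EFinM -EFinD lee_fin -(ler_pM2r J0); apply: le_trans h _.
rewrite le_eqVlt; apply/orP; left; apply/eqP.
have p2 : pi *+ 2 != 0 :> R by rewrite gt_eqF// mulrn_wgt0// pi_gt0.
have J1 := Jm_gt0 R n.
move: p2; move: (pi *+ 2) (c2pi R ^+ n.+2) (c2pi R ^+ n.+1) (diam K) => P C1 C2 d P0.
by field; rewrite P0 !gt_eqF.
Qed.
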